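(* Let $d,K,J\ge 1$ be integers, let $\kappa_y,\kappa_\Psi,\kappa_h>0$, and let $\Sigma\in\mathbb R^{d\times d}$, $\Gamma\in\mathbb R^{K\times K}$ be symmetric positive definite matrices. Then there exists a constant $C=C(J,\kappa_y,\kappa_\Psi,\kappa_h,\Sigma,\Gamma)$ such that the following holds. Let $y_1^\dagger,\dots,y_J^\dagger\in\mathbb R^K$ satisfy $\max_{1\le j\le J}|y_j^\dagger|\le\kappa_y$; let $\Psi\colon\mathbb R^d\to\mathbb R^d$ be Borel measurable with $|\Psi(u)|\le\kappa_\Psi$ for all $u$; let $h\colon\mathbb R^d\to\mathbb R^K$ be continuous with $|h(u)|\le\kappa_h$ for all $u$. Let $\mu_0=\mu_0^G$ be a Gaussian probability measure on $\mathbb R^d$ and, for $j=0,\dots,J-1$, let $$\mu_{j+1}=\mathsf B_j\mathsf Q\mathsf P\mu_j,\qquad \mu^G_{j+1}=\mathsf B_j\mathsf G\mathsf Q\mathsf P\mu^G_j .$$ Then $$d_g(\mu_J^G,\mu_J)\le C\max_{0\le j\le J-1} d_g(\mathsf Q\mathsf P\mu_j,\ \mathsf G\mathsf Q\mathsf P\mu_j).$$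
   Context: Notation: $|\cdot|$ is the Euclidean norm and, for $S$ symmetric positive definite, $|v|_S=|S^{-1/2}v|$. $\mathcal P^2(\mathbb R^n)$ is the set of Borel probability measures on $\mathbb R^n$ with finite second moment; $\mathcal M(\mu)$ and $\mathcal C(\mu)$ are the mean and covariance of $\mu$. Measures and their Lebesgue densities are denoted by the same symbol. Weighted total variation metric: with $g(v)=1+|v|^2$ on $\mathbb R^n$, $d_g(\mu_1,\mu_2)=\sup_{|f|\le g}\left|\int f\,d\mu_1-\int f\,d\mu_2\right|$ for $\mu_1,\mu_2\in\mathcal P^2(\mathbb R^n)$, the supremum being over measurable $f\colon\mathbb R^n\to\mathbb R$ with $|f|\le g$ pointwise. Operators associated with $\Psi,h,\Sigma,\Gamma$ and the data: - $\mathsf P\mu(u)=\frac{1}{\sqrt{(2\pi)^d\det\Sigma}}\int_{\mathbb R^d}\exp\left(-\tfrac12|u-\Psi(v)|_\Sigma^2\right)\mu(dv)$ (the law of $\Psi(U)+\xi$ with $U\sim\mu$, $\xi\sim\mathcal N(0,\Sigma)$ independent). - $\mathsf Q\mu(u,y)=\frac{1}{\sqrt{(2\pi)^K\det\Gamma}}\exp\left(-\tfrac12|y-h(u)|_\Gamma^2\right)\mu(u)$ (the law on $\mathbb R^d\times\mathbb R^K$ of $(U,h(U)+\eta)$ with $U\sim\mu$, $\eta\sim\mathcal N(0,\Gamma)$ independent). - For $\pi$ on $\mathbb R^d\times\mathbb R^K$ with continuous Lebesgue density, $\mathsf B_j\pi(u)=\pi(u,y_{j+1}^\dagger)\big/\int_{\mathbb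 R^d}\pi(U,y_{j+1}^\dagger)\,dU$. - $\mathsf G\pi=\mathcal N(\mathcal M(\pi),\mathcal C(\pi))$ for $\pi$ with finite second moments. $(\mu_j)$ is the true filtering distribution and $(\mu_j^G)$ is the Gaussian projected filter. *)

(* Defs.v *)
From HB Require Import structures.
From mathcomp Require Import all_boot all_order all_algebra.
From mathcomp Require Import all_classical all_reals all_analysis.
From mathcomp Require Import measurable_realfun.

Set Implicit Arguments.
Unset Strict Implicit.
Unset Printing Implicit Defensive.

Import Order.TTheory GRing.Theory Num.Theory.
Import numFieldNormedType.Exports.

Local Open Scope classical_set_scope.
Local Open Scope ring_scope.

(* Vectors of R^n are column vectors 'cV[R]_n, and R^d * R^K is identified with
   R^(d+K) through col_mx. Matrix spaces carry the Borel sigma-algebra of their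
   topology. *)

Section borel_matrix.
Context (R : realType) (m n : nat).
Implicit Types M : 'M[R]_(m, n).

Let mx_open0 : <<s @open 'M[R]_(m, n) >> set0.
Proof. exact: sigma_algebra0. Qed.

Let mx_openC (A : set 'M[R]_(m, n)) : <<s open >> A -> <<s open >> (~` A).
Proof. exact: sigma_algebraC. Qed.

Let mx_open_bigcup (F : (set 'M[R]_(m, n))^nat) :
  (forall i, <<s open >> (F i)) -> <<s open >> (\bigcup_i F i).
Proof. exact: sigma_algebra_bigcup. Qed.

HB.instance Definition _ := @isMeasurable.Build
  (sigma_display (@open 'M[R]_(m, n))) 'M[R]_(m, n)
  <<s open >> mx_open0 mx_openC mx_open_bigcup.

Let box (p : 'M[rat]_(m, n) * nat) : set 'M[R]_(m, n) :=
  [set M | forall i j, ball (ratr (p.1 i j) : R) p.2.+1%:R^-1 (M i j)].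

Let open_boxE (U : set 'M[R]_(m, n)) : open U ->
  U = \bigcup_(p : 'M[rat]_(m, n) * nat)
        (if `[< box p `<=` U >] then box p else set0).
Proof.
move=> oU; apply/seteqP; split=> [M UM|M [p _]]; last first.
  by case: asboolP => // + pM; exact.
have /nbhs_ballP[e /= e0 eU] : nbhs M U by exact: open_nbhs_nbhs.
have [k /= ke] : exists k : nat, k.+1%:R^-1 < e / 2.
  have e20 : 0 < e / 2 by exact: divr_gt0.
  have [k _ /(_ _ (leqnn _))] := near_infty_natSinv_lt (PosNum e20).
  by exists k.
have rB (x : R) : exists q : rat, ball (ratr q : R) k.+1%:R^-1 x.
  have : ball x k.+1%:R^-1 `&` range ratr !=set0.
    apply: dense_rat; last exact: ball_open.
    by exists x; apply: ballxx.
  by move=> [_ []] /[swap] -[q _ <-] /ball_sym; exists q.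
pose Q : 'M[rat]_(m, n) := \matrix_(i, j) sval (cid (rB (M i j))).
have bM : box (Q, k) M by move=> i j /=; rewrite mxE; case: cid.
exists (Q, k) => //.
rewrite asboolT// => N bN; apply: eU; split=> // i j.
rewrite (splitr e); apply: ball_triangle.
  by apply: (le_ball (ltW ke)); apply/ball_sym; exact: bM.
by apply: (le_ball (ltW ke)); exact: bN.
Qed.

Lemma measurable_fun_mxP d (T : measurableType d) (f : T -> 'M[R]_(m, n)) :
  (forall i j, measurable_fun [set: T] (fun x => f x i j)) ->
  measurable_fun [set: T] f.
Proof.
move=> mf; apply: (@measurability _ _ _ _ _ _ (@open 'M[R]_(m, n))) => //.
move=> _ [U oU <-]; rewrite setTI (open_boxE oU) preimage_bigcup.
apply: countable_bigcupT_measurable => // p.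
case: asboolP => _; last by rewrite preimage_set0.
have -> : f @^-1` box p = \bigcap_(i : 'I_m) \bigcap_(j : 'I_n)
    ((fun x => f x i j) @^-1` ball (ratr (p.1 i j) : R) p.2.+1%:R^-1).
  by apply/seteqP; split=> [x px i _ j _|x px i j]; [exact: px|exact: px].
apply: fin_bigcap_measurable => // i _; apply: fin_bigcap_measurable => // j _.
rewrite -[X in measurable X]setTI; apply: mf => //.
by apply: open_measurable; exact: ball_open.
Qed.

Lemma measurable_coord (i : 'I_m) (j : 'I_n) :
  measurable_fun [set: 'M[R]_(m, n)] (fun M => M i j).
Proof.
apply: (measurability _ (RGenOpens.measurableE R)).
move=> _ [U [a [b ->]] <-]; rewrite setTI; apply: sub_sigma_algebra.
have /continuousP : continuous (fun M : 'M[R]_(m, n) => M i j).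
  exact: coord_continuous.
by apply; exact: interval_open.
Qed.

End borel_matrix.

Section measures.
Context d d' (T : measurableType d) (T' : measurableType d') (R : realType).
Implicit Types mu : {measure set T -> \bar R}.

Definition image_measure mu (f : {mfun T >-> T'}) : set T' -> \bar R :=
  pushforward mu f.

Section image_measure_is_measure.
Variables (mu : {measure set T -> \bar R}) (f : {mfun T >-> T'}).

Let image_measure0 : image_measure mu f set0 = 0%E.
Proof. exact: measure0. Qed.

Let image_measure_ge0 A : (0 <= image_measure mu f A)%E.
Proof. exact: measure_ge0. Qed.

Let image_measure_sigma_additive : semi_sigma_additive (image_measure mu f).
Proof. exact: measure_semi_sigma_additive. Qed.

HB.instance Definition _ := isMeasure.Build _ _ _ (image_measure mu f)
  image_measure0 image_measure_ge0 image_measure_sigma_additive.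

End image_measure_is_measure.

(* The measure f(x) mu(dx). So that it is a measure for every f, it is the
   zero measure when f is not a nonnegative measurable function. *)
Definition density_measure mu (f : T -> R) : set T -> \bar R := fun A =>
  if `[< measurable_fun [set: T] f /\ forall x, 0 <= f x >]
  then (\int[mu]_(x in A) (f x)%:E)%E else 0%E.

Section density_measure_is_measure.
Variables (mu : {measure set T -> \bar R}) (f : T -> R).

Let density_measure0 : density_measure mu f set0 = 0%E.
Proof. by rewrite /density_measure integral_set0; case: ifP. Qed.

Let density_measure_ge0 A : (0 <= density_measure mu f A)%E.
Proof.
rewrite /density_measure; case: asboolP => // -[_ f0].
by apply: integral_ge0 => x _; rewrite lee_fin.
Qed.

Let density_measure_sigma_additive :
  semi_sigma_additive (density_measure mu f).
Proof.
rewrite /density_measure; case: asboolP => [[mf f0]|_].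
  apply: semi_sigma_additive_nng_induced; first exact/measurable_EFinP.
  by move=> x; rewrite lee_fin.
exact: (@measure_semi_sigma_additive _ _ _ mzero).
Qed.

HB.instance Definition _ := isMeasure.Build _ _ _ (density_measure mu f)
  density_measure0 density_measure_ge0 density_measure_sigma_additive.

End density_measure_is_measure.
End measures.

Section lebesgue_measure_Rn.
Context (R : realType).

Definition cons_cV n (p : measurableTypeR R * 'cV[R]_n) : 'cV[R]_n.+1 :=
  col_mx (p.1%:M : 'M[R]_1) p.2.

Lemma cons_cV0 n (p : measurableTypeR R * 'cV[R]_n) j :
  cons_cV p ord0 j = p.1.
Proof.
rewrite /cons_cV (_ : ord0 = lshift n (ord0 : 'I_1)); last exact/val_inj.
by rewrite (@col_mxEu _ 1 n 1) mxE (ord1 j).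
Qed.

Lemma cons_cVS n (p : measurableTypeR R * 'cV[R]_n) i j :
  cons_cV p (lift ord0 i) j = p.2 i j.
Proof.
rewrite /cons_cV (_ : lift ord0 i = rshift 1 i); last exact/val_inj.
by rewrite (@col_mxEd _ 1 n 1).
Qed.

Lemma measurable_cons_cV n : measurable_fun setT (@cons_cV n).
Proof.
apply: measurable_fun_mxP => i j; case: (unliftP ord0 i) => [k|] ->.
  under eq_fun do rewrite cons_cVS.
  apply: (measurableT_comp (@measurable_coord R n 1 k j)).
  exact: measurable_snd.
under eq_fun do rewrite cons_cV0.
exact: measurable_fst.
Qed.

HB.instance Definition _ n := isMeasurableFun.Build _ _ _ _ (@cons_cV n)
  (@measurable_cons_cV n).

Section step.
Variables (n : nat) (mu : {sigma_finite_measure set 'cV[R]_n -> \bar R}).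

Definition lebesgue_step : set 'cV[R]_n.+1 -> \bar R :=
  image_measure (lebesgue_measure \x mu)%E (@cons_cV n).

HB.instance Definition _ := Measure.on lebesgue_step.

Let lebesgue_step_sigma_finite : sigma_finite setT lebesgue_step.
Proof.
have [F [FT mF]] : exists F : (set (measurableTypeR R * 'cV[R]_n))^nat,
    setT = \bigcup_k F k /\
    forall k, measurable (F k) /\ ((lebesgue_measure \x mu)%E (F k) < +oo)%E.
  have /sigma_finiteP[A [AT Ainc mA]] := sigma_finiteT (@lebesgue_measure R).
  have /sigma_finiteP[B [BT Binc mB]] := sigma_finiteT mu.
  exists (fun k => A k `*` B k); split.
    rewrite -setXTT AT BT; apply/seteqP; split=> [[x v] [[i _ Ax] [j _ Bv]]|].
      exists (maxn i j) => //; split.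
        by have /subsetPset := Ainc _ _ (leq_maxl i j); apply.
      by have /subsetPset := Binc _ _ (leq_maxr i j); apply.
    by move=> [x v] [k _ [? ?]]; split; exists k.
  move=> k; have [? ?] := mA k; have [? ?] := mB k.
  split; first exact: measurableX.
  by rewrite product_measure1E// lte_mul_pinfty// ge0_fin_numE.
pose u (M : 'cV[R]_(1 + n)) : measurableTypeR R * 'cV[R]_n :=
  (M ord0 ord0, dsubmx M).
have mu_ : measurable_fun setT u.
  apply/measurable_fun_pairP; split => /=; first exact: measurable_coord.
  apply: measurable_fun_mxP => i j.
  under eq_fun do rewrite mxE.
  exact: measurable_coord.
have uK p : u (cons_cV p) = p.
  case: p => x v; rewrite /u cons_cV0; congr pair.
  apply/colP => i; rewrite mxE -[RHS](cons_cVS (x, v)).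
  by congr fun_of_matrix; exact/val_inj.
exists (fun k => u @^-1` F k).
  by rewrite -preimage_bigcup -FT preimage_setT.
move=> k; split.
  by rewrite -[X in measurable X]setTI; apply: mu_ => //; exact: (mF k).1.
rewrite /lebesgue_step /image_measure /pushforward.
rewrite (_ : _ @^-1` _ = F k); first exact: (mF k).2.
by apply/seteqP; split => p /=; rewrite uK.
Qed.

HB.instance Definition _ := Measure_isSigmaFinite.Build _ _ _ lebesgue_step
  lebesgue_step_sigma_finite.

End step.

(* Lebesgue measure on R^n, as the n-fold product of the one on R. *)
Fixpoint lebesgue_cV n : {sigma_finite_measure set 'cV[R]_n -> \bar R} :=
  match n with
  | 0 => \d_(0 : 'cV[R]_0)
  | n'.+1 => lebesgue_step (lebesgue_cV n')
  end.

Lemma lebesgue_cV_box n (A : 'I_n -> set (measurableTypeR R)) :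
  (forall i, measurable (A i)) ->
  lebesgue_cV n [set v | forall i, A i (v i ord0)] =
  (\prod_(i < n) lebesgue_measure (A i))%E.
Proof.
elim: n A => [|n IH] A mA.
  by rewrite big_ord0 /= diracE mem_set// => -[].
rewrite /= /lebesgue_step /image_measure /pushforward.
pose B : set 'cV[R]_n :=
  [set v | forall i : 'I_n, A (lift ord0 i) (v i ord0)].
have mB : measurable B.
  rewrite (_ : B = \bigcap_(i : 'I_n)
    ((fun v : 'cV[R]_n => v i ord0) @^-1` A (lift ord0 i))).
    apply: fin_bigcap_measurable => // i _.
    rewrite -[X in measurable X]setTI.
    by apply: measurable_coord => //; exact: mA.
  by apply/seteqP; split => [v vA i _|v vA i]; exact: vA.
rewrite big_ord_recl -IH; last by move=> i; exact: mA.
transitivity ((lebesgue_measure \x lebesgue_cV n)%E (A ord0 `*` B)); last first.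
  exact: product_measure1E.
congr (_ _).
apply/seteqP; split => [p pA|p [pA0 pA] i] /=.
  split => [|i]; first by rewrite -(cons_cV0 p ord0); exact: pA.
  by rewrite -(cons_cVS p i ord0); exact: pA.
by case: (unliftP ord0 i) => [j|] ->; rewrite ?cons_cVS ?cons_cV0.
Qed.

End lebesgue_measure_Rn.

Section linear_algebra.
Context (R : realType) (n : nat).
Implicit Types (S : 'M[R]_n) (v : 'cV[R]_n).

Definition posdefmx S := S^T = S /\
  forall v, v != 0 -> 0 < (v^T *m S *m v) ord0 ord0.

Definition possemidefmx S := S^T = S /\
  forall v, 0 <= (v^T *m S *m v) ord0 ord0.

(* S^(1/2), the unique positive semidefinite square root of a positive
   semidefinite S *)
Definition sqrtmx S : 'M[R]_n :=
  xget 0 [set B | possemidefmx B /\ B *m B = S].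

Definition enorm v : R := Num.sqrt (\sum_i v i ord0 ^+ 2).

Definition wnorm S v : R := enorm (invmx (sqrtmx S) *m v).

End linear_algebra.

Section probability_Rn.
Context (R : realType) (n : nat).
Implicit Types mu : {measure set 'cV[R]_n -> \bar R}.

Definition weight (v : 'cV[R]_n) : R := 1 + enorm v ^+ 2.

(* Weighted total variation; a supremum in \bar R, finite for measures with
   finite second moment. The norm `|v| of the library is the sup norm, hence
   enorm in weight. *)
Definition dist_g mu1 mu2 : \bar R :=
  ereal_sup [set `| \int[mu1]_v (f v)%:E - \int[mu2]_v (f v)%:E |%E |
    f in [set f : 'cV[R]_n -> R |
          measurable_fun setT f /\ forall v, `|f v| <= weight v]].

Definition mean mu : 'cV[R]_n := \col_i \int[mu]_v v i ord0.

Definition covariance_mx mu : 'M[R]_n := \matrix_(i, j)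
  \int[mu]_v ((v i ord0 - mean mu i ord0) * (v j ord0 - mean mu j ord0)).

(* density of the centered normal law with positive definite covariance S *)
Definition gauss_pdf (S : 'M[R]_n) (v : 'cV[R]_n) : R :=
  (Num.sqrt ((2 * pi) ^+ n * \det S))^-1 * expR (- (2^-1 * wnorm S v ^+ 2)).

Definition std_gauss : {measure set 'cV[R]_n -> \bar R} :=
  density_measure (@lebesgue_cV R n)
    (fun v => (Num.sqrt ((2 * pi) ^+ n))^-1 * expR (- (2^-1 * enorm v ^+ 2))).

Definition affine_mx (a : 'cV[R]_n) (B : 'M[R]_n) (z : 'cV[R]_n) : 'cV[R]_n :=
  a + B *m z.

Lemma measurable_affine_mx a B : measurable_fun setT (affine_mx a B).
Proof.
apply: measurable_fun_mxP => i j; rewrite /affine_mx.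
under eq_fun do rewrite !mxE.
apply: measurable_funD => //; apply: measurable_sum => k.
by apply: measurable_funM => //; exact: measurable_coord.
Qed.

HB.instance Definition _ a B := isMeasurableFun.Build _ _ _ _ (affine_mx a B)
  (@measurable_affine_mx a B).

(* N(a, S), the law of a + S^(1/2) Z for a standard normal Z; S may be any
   positive semidefinite matrix. *)
Definition normal_measure (a : 'cV[R]_n) (S : 'M[R]_n) :
    {measure set 'cV[R]_n -> \bar R} :=
  image_measure std_gauss (affine_mx a (sqrtmx S)).

Definition is_gaussian mu := exists a S, possemidefmx S /\
  forall A, measurable A -> mu A = normal_measure a S A.

(* the continuous Lebesgue density of mu, unique when there is one *)
Definition continuous_density mu : 'cV[R]_n -> R :=
  xget (cst 0) [set p : 'cV[R]_n -> R | [/\ continuous p, forall v, 0 <= p v &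
    forall A, measurable A ->
      mu A = (\int[@lebesgue_cV R n]_(v in A) (p v)%:E)%E]].

End probability_Rn.

Section filters.
Context (R : realType) (d K : nat).

Definition pair_cV (p : 'cV[R]_d * 'cV[R]_K) : 'cV[R]_(d + K) :=
  col_mx p.1 p.2.

Lemma measurable_pair_cV : measurable_fun setT pair_cV.
Proof.
apply: measurable_fun_mxP => i j; rewrite /pair_cV.
case: (split_ordP i) => k ->.
  under eq_fun do rewrite col_mxEu.
  apply: (measurableT_comp (@measurable_coord R d 1 k j)).
  exact: measurable_fst.
under eq_fun do rewrite col_mxEd.
apply: (measurableT_comp (@measurable_coord R K 1 k j)).
exact: measurable_snd.
Qed.

HB.instance Definition _ := isMeasurableFun.Build _ _ _ _ pair_cV
  measurable_pair_cV.

Variables (Psi : 'cV[R]_d -> 'cV[R]_d) (h : 'cV[R]_d -> 'cV[R]_K).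
Variables (Sigma : 'M[R]_d) (Gamma : 'M[R]_K).

Definition op_P (mu : {measure set 'cV[R]_d -> \bar R}) :
    {measure set 'cV[R]_d -> \bar R} :=
  density_measure (@lebesgue_cV R d) (fun u =>
    (Num.sqrt ((2 * pi) ^+ d * \det Sigma))^-1 *
    \int[mu]_v expR (- (2^-1 * wnorm Sigma (u - Psi v) ^+ 2))).

(* gauss_pdf Gamma (y - h u) mu(du) dy, where mu need not have a density *)
Definition op_Q (mu : {measure set 'cV[R]_d -> \bar R}) :
    {measure set 'cV[R]_(d + K) -> \bar R} :=
  image_measure
    (density_measure (mu \x @lebesgue_cV R K)%E
      (fun p => gauss_pdf Gamma (p.2 - h p.1)))
    pair_cV.

Definition op_B (y : 'cV[R]_K) (ppi : {measure set 'cV[R]_(d + K) -> \bar R}) :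
    {measure set 'cV[R]_d -> \bar R} :=
  density_measure (@lebesgue_cV R d) (fun u =>
    continuous_density ppi (col_mx u y) /
    \int[@lebesgue_cV R d]_U continuous_density ppi (col_mx U y)).

Definition op_G n (ppi : {measure set 'cV[R]_n -> \bar R}) :
    {measure set 'cV[R]_n -> \bar R} :=
  normal_measure (mean ppi) (covariance_mx ppi).

Variables (y : nat -> 'cV[R]_K) (mu0 : {measure set 'cV[R]_d -> \bar R}).

Fixpoint true_filter j : {measure set 'cV[R]_d -> \bar R} :=
  if j is i.+1 then op_B (y i.+1) (op_Q (op_P (true_filter i))) else mu0.

Fixpoint gauss_filter j : {measure set 'cV[R]_d -> \bar R} :=
  if j is i.+1 then op_B (y i.+1) (op_G (op_Q (op_P (gauss_filter i))))
  else mu0.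

End filters.

(* Main.v *)
Require Import Defs.
From HB Require Import structures.
From mathcomp Require Import all_boot all_order all_algebra all_fingroup.
From mathcomp Require Import all_classical all_reals all_analysis.
From mathcomp Require Import measurable_realfun ring lra.
From mathcomp Require spectral complex.
Set Implicit Arguments.
Unset Strict Implicit.
Unset Printing Implicit Defensive.
Import Order.TTheory GRing.Theory Num.Theory.
Import numFieldNormedType.Exports.
Local Open Scope classical_set_scope.
Local Open Scope ring_scope.

(** The estimate combines the stability of the Gaussian projected filter with the
    consistency of one projection. Let [E] be the largest of the distances
    between a joint law of state and observation and its Gaussian fit, along
    the true filter. One step of both filters turns an error [e] before the
    step into an error at most [C1 * e + C2 * E] after it ([filter_step]), with
    constants that depend only on the bounds in the hypotheses; iterating from
    the common initial law gives the result.

    Uniformity comes from the prediction. As the drift is bounded, the density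
    of a predicted law lies below a fixed Gaussian envelope and its covariance
    above that of the noise ([predict_density]). With bounded [h] it follows
    that all joint laws have their means in a bounded set and their covariances
    in a fixed class of elliptic matrices ([joint_elliptic]), over which Gaussian
    densities are bounded above and below and depend Lipschitz continuously on
    their parameters ([gauss_pdf_lip]).

    Stability: integrating against Gaussian kernels turns a total variation error
    into an error for the weighted distance ([predict_lip]); this error passes to
    the moments of the joint law ([moments_lip]), and from them to the Gaussian
    density conditioned on the observation ([gauss_analysis_lip]).

    Consistency: conditioning on one value of the observation is not continuous
    for the weighted distance, so the form of the two joint laws has to be used.
    One has the density [p u] times that of [N(h u, Gamma)] in the observation;
    its Gaussian fit has a density [q u] times that of [N(a u, N)], where [a] is
    the affine regression of the observation on the state. Testing the
    difference of the joint laws with functions of the observation bounds, state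
    by state, the difference of [p] and [q] ([slice_mass]) and that of [h] and
    [a] ([slice_clip]). The difference of [N] and [Gamma] is the mean square error
    of the regression, which is bounded in the same way ([slice_mean_sqr],
    [reg_cov_dist]). Since Gaussian densities are Lipschitz in their parameters,
    the two joint densities are close on the slice at the observed value
    ([slice_compare], [gauss_analysis_consistency]).

    The densities of the joint laws have to be continuous and unique for the
    conditioning to be the one computed here ([continuous_densityE]). All
    integrands are dominated by Gaussians ([gdom]), which makes integrability and
    Fubini available everywhere. *)

(** * Euclidean norms and quadratic forms; square roots of positive definite matrices *)

Section euclidean.
Context (R : realType).

Definition sqn n (v : 'cV[R]_n) : R := \sum_i v i ord0 ^+ 2.

Definition dotv n (u v : 'cV[R]_n) : R := \sum_i u i ord0 * v i ord0.

Definition qform n (S : 'M[R]_n) (v : 'cV[R]_n) : R :=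
  (v^T *m S *m v) ord0 ord0.

Lemma dotvE n (u v : 'cV[R]_n) : (u^T *m v) ord0 ord0 = dotv u v.
Proof. by rewrite mxE; apply: eq_bigr => i _; rewrite mxE. Qed.

Lemma sqn_dotv n (v : 'cV[R]_n) : sqn v = dotv v v.
Proof. by apply: eq_bigr => i _; rewrite expr2. Qed.

Lemma qformE n (S : 'M[R]_n) v : qform S v = dotv v (S *m v).
Proof. by rewrite /qform -mulmxA dotvE. Qed.

Lemma sqn_ge0 n (v : 'cV[R]_n) : 0 <= sqn v.
Proof. by apply: sumr_ge0 => i _; exact: sqr_ge0. Qed.

Lemma enorm_sqr n (v : 'cV[R]_n) : enorm v ^+ 2 = sqn v.
Proof. by rewrite /enorm sqr_sqrtr// sqn_ge0. Qed.

Lemma sqr_coord_le n (v : 'cV[R]_n) i : v i ord0 ^+ 2 <= sqn v.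
Proof.
rewrite /sqn (bigD1 i)//= lerDl; apply: sumr_ge0 => j _; exact: sqr_ge0.
Qed.

Lemma sqn_eq0 n (v : 'cV[R]_n) : (sqn v == 0) = (v == 0).
Proof.
apply/eqP/eqP => [v0|->]; last first.
  by rewrite /sqn big1// => i _; rewrite mxE expr0n.
apply/colP => i; rewrite mxE; apply/eqP; rewrite -sqrf_eq0 eq_le sqr_ge0 andbT.
by rewrite -v0 sqr_coord_le.
Qed.

Lemma sqn_gt0 n (v : 'cV[R]_n) : v != 0 -> 0 < sqn v.
Proof. by move=> v0; rewrite lt_neqAle sqn_ge0 eq_sym sqn_eq0 v0. Qed.

Lemma sqnN n (v : 'cV[R]_n) : sqn (- v) = sqn v.
Proof. by apply: eq_bigr => i _; rewrite mxE sqrrN. Qed.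

Lemma sqnZ n a (v : 'cV[R]_n) : sqn (a *: v) = a ^+ 2 * sqn v.
Proof. by rewrite /sqn mulr_sumr; apply: eq_bigr => i _; rewrite mxE exprMn. Qed.

Lemma sqnD_le n (u v : 'cV[R]_n) : sqn (u + v) <= 2 * sqn u + 2 * sqn v.
Proof.
rewrite /sqn !mulr_sumr -big_split/=; apply: ler_sum => i _; rewrite mxE.
by have := sqr_ge0 (u i ord0 - v i ord0); lra.
Qed.

Lemma sqnB_le n (u v : 'cV[R]_n) : sqn (u - v) <= 2 * sqn u + 2 * sqn v.
Proof. by rewrite -(sqnN v) sqnD_le. Qed.

Lemma sqn_col_mx m n (u : 'cV[R]_m) (v : 'cV[R]_n) :
  sqn (col_mx u v) = sqn u + sqn v.
Proof.
rewrite /sqn big_split_ord/=; congr (_ + _); apply: eq_bigr => i _.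
  by rewrite col_mxEu.
by rewrite col_mxEd.
Qed.

Lemma dotvC n (u v : 'cV[R]_n) : dotv u v = dotv v u.
Proof. by apply: eq_bigr => i _; rewrite mulrC. Qed.

Lemma dotvDl n (u w v : 'cV[R]_n) : dotv (u + w) v = dotv u v + dotv w v.
Proof. by rewrite -big_split/=; apply: eq_bigr => i _; rewrite mxE mulrDl. Qed.

Lemma dotvZl n a (u v : 'cV[R]_n) : dotv (a *: u) v = a * dotv u v.
Proof. by rewrite mulr_sumr; apply: eq_bigr => i _; rewrite mxE mulrA. Qed.

Lemma dotvBl n (u w v : 'cV[R]_n) : dotv (u - w) v = dotv u v - dotv w v.
Proof. by rewrite dotvDl -scaleN1r dotvZl mulN1r. Qed.

Lemma dotvDr n (u w v : 'cV[R]_n) : dotv v (u + w) = dotv v u + dotv v w.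
Proof. by rewrite !(dotvC v) dotvDl. Qed.

Lemma dotvBr n (u w v : 'cV[R]_n) : dotv v (u - w) = dotv v u - dotv v w.
Proof. by rewrite !(dotvC v) dotvBl. Qed.

Lemma dotv_mulmx m n (u : 'cV[R]_m) (A : 'M[R]_(m, n)) v :
  dotv u (A *m v) = dotv (A^T *m u) v.
Proof. by rewrite -!dotvE trmx_mul trmxK mulmxA. Qed.

Lemma dotv_CS n (u v : 'cV[R]_n) : dotv u v ^+ 2 <= sqn u * sqn v.
Proof.
have [->|v0] := eqVneq v 0.
  rewrite /dotv big1 ?expr0n ?mulr_ge0 ?sqn_ge0// => i _.
  by rewrite mxE mulr0.
have s0 := sqn_gt0 v0.
have := sqn_ge0 (u - (dotv u v / sqn v) *: v).
rewrite sqn_dotv dotvBl !dotvBr !dotvZl !(dotvC _ (_ *: v)) !dotvZl.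
rewrite -!sqn_dotv (dotvC v u) => H.
have {H} : 0 <= sqn v * (sqn u - dotv u v / sqn v * dotv u v -
  (dotv u v / sqn v * dotv u v -
   dotv u v / sqn v * (dotv u v / sqn v * sqn v))) by rewrite mulr_ge0// ltW.
set a := sqn v in s0 *; set b := dotv u v; set c := sqn u.
have -> : a * (c - b / a * b - (b / a * b - b / a * (b / a * a))) =
   c * a - b ^+ 2 by field; rewrite gt_eqF.
by rewrite subr_ge0.
Qed.

Lemma sqn_mulmx m n (S : 'M[R]_(m, n)) (M : R) v :
  (forall i j, `|S i j| <= M) ->
  sqn (S *m v) <= (m%:R * n%:R * M ^+ 2) * sqn v.
Proof.
move=> SM; rewrite {1}/sqn.
have -> : m%:R * n%:R * M ^+ 2 * sqn v =
    \sum_(i < m) (n%:R * M ^+ 2 * sqn v).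
  by rewrite sumr_const card_ord -!mulrA mulr_natl.
apply: ler_sum => i _.
have -> : (S *m v) i ord0 = dotv (row i S)^T v.
  by rewrite mxE; apply: eq_bigr => j _; rewrite !mxE.
apply: (le_trans (dotv_CS _ _)); apply: ler_wpM2r; first exact: sqn_ge0.
have -> : n%:R * M ^+ 2 = \sum_(i < n) M ^+ 2.
  by rewrite sumr_const card_ord mulr_natl.
apply: ler_sum => j _; rewrite !mxE -real_normK ?num_real//.
by apply: lerXn2r; rewrite ?nnegrE//; exact: le_trans (SM i j).
Qed.

Lemma posdef_unitmx n (S : 'M[R]_n) : posdefmx S -> S \in unitmx.
Proof.
move=> [_ S0]; rewrite -row_free_unit; apply/inj_row_free => v vS.
apply/eqP; apply: contraT => v0.
have := S0 v^T; rewrite trmxK vS mul0mx mxE ltxx; apply.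
by rewrite -trmx0 (inj_eq trmx_inj).
Qed.

Lemma posdef_psd n (S : 'M[R]_n) : posdefmx S -> possemidefmx S.
Proof.
move=> [ST S0]; split => // v; have [->|/S0/ltW//] := eqVneq v 0.
by rewrite mulmx0 mxE.
Qed.

End euclidean.

Section sqrt_existence.
Import spectral complex sesquilinear.
Context (R : realType).

Lemma poly_interpolation (f : R -> R) (s : seq R) : uniq s ->
  exists p : {poly R}, forall x, x \in s -> p.[x] = f x.
Proof.
elim: s => [_|a s IH /= /andP[ais /IH[p ps]]]; first by exists 0.
pose r := \prod_(x <- s) ('X - x%:P).
exists (p + ((f a - p.[a]) / r.[a]) *: r) => x; rewrite inE => /orP[/eqP ->|xs].
  rewrite hornerD hornerZ divfK; first by rewrite addrCA subrr addr0.
  rewrite horner_prod prodf_seq_neq0; apply/allP => y ys /=.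
  by rewrite hornerXsubC subr_eq0; apply: contraNneq ais => ->.
rewrite hornerD hornerZ ps// (_ : r.[x] = 0) ?mulr0 ?addr0//.
by apply/eqP; change (root r x); rewrite /r root_prod_XsubC.
Qed.

Lemma trmx_horner_mx n (A : 'M[R]_n.+1) p : A^T = A ->
  (horner_mx A p)^T = horner_mx A p.
Proof.
move=> AT; elim/poly_ind: p => [|p c IH]; first by rewrite rmorph0 trmx0.
rewrite rmorphD rmorphM/= horner_mx_X horner_mx_C linearD/= tr_scalar_mx.
by rewrite -mulmxE trmx_mul IH AT (comm_horner_mx _ (comm_mx_refl A)).
Qed.

(** The eigenvalues of a positive definite matrix are positive, and the square
    of a polynomial sending each of them to its fourth root is a root of the
    matrix; the second square is what makes that root positive semidefinite. *)
Lemma sqrtmx_exists n (S : 'M[R]_n) : posdefmx S ->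
  exists B, possemidefmx B /\ B *m B = S.
Proof.
case: n S => [|n] S pS.
  by exists 0; split; [split=> [|v]|]; rewrite ?[_ 0]flatmx0 //;
    rewrite ?(flatmx0 v) ?mulmx0 ?mxE//; apply/matrixP => -[].
have [ST S0] := pS.
pose toC : {rmorphism R -> R[i]} := real_complex R.
pose SC := map_mx toC S.
have SCherm : SC \is hermsymmx.
  apply: realsym_hermsym.
    apply/is_hermitianmxP; rewrite expr0 scale1r; apply/matrixP => i j.
    by rewrite !mxE -{1}ST mxE.
  apply/mxOverP => i j; rewrite mxE /=.
  by apply/complex_realP; exists (S i j).
have /orthomx_spectralP := hermitian_normalmx SCherm.
set P := spectralmx SC; set D := spectral_diag SC => SCE.
have Pu : P \in unitmx by exact: spectral_unit.
have DR i : exists x : R, D ord0 i = toC x.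
  have /mxOverP/(_ ord0 i) := hermitian_spectral_diag_real SCherm.
  by move=> /complex_realP[x ->]; exists x.
have [d dD] : {d : 'I_n.+1 -> R | forall i, D ord0 i = toC (d i)}.
  by exists (fun i => sval (cid (DR i))) => i; case: cid.
have d0 i : 0 <= d i.
  have : \det (S - (d i)%:M) = 0.
    apply: (fmorph_inj toC); rewrite rmorph0 -det_map_mx map_mxB map_scalar_mx/=.
    rewrite -/SC SCE -dD.
    have -> : invmx P *m diag_mx D *m P - (D ord0 i)%:M =
        invmx P *m (diag_mx D - (D ord0 i)%:M) *m P.
      rewrite mulmxBr mulmxBl mul_mx_scalar -scalemxAl mulVmx//.
      by rewrite scalemx1.
    rewrite !det_mulmx (_ : \det (diag_mx D - _) = 0) ?mulr0 ?mul0r//.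
    have -> : diag_mx D - (D ord0 i)%:M = diag_mx (\row_j (D ord0 j - D ord0 i)).
      by apply/matrixP => a b; rewrite !mxE mulrnBl.
    by rewrite det_diag (bigD1 i)//= mxE subrr mul0r.
  move=> /eqP /det0P[v v0 /eqP]; rewrite mulmxBr mul_mx_scalar subr_eq0 => /eqP vS.
  have v0' : v^T != 0 by rewrite -trmx0 (inj_eq trmx_inj).
  have := S0 _ v0'; rewrite trmxK vS -scalemxAl mxE.
  have -> : (v *m v^T) ord0 ord0 = sqn v^T.
    by rewrite mxE; apply: eq_bigr => k _; rewrite !mxE expr2.
  by rewrite pmulr_lgt0 ?sqn_gt0// => /ltW.
have [q qd] := poly_interpolation (fun x => Num.sqrt (Num.sqrt x))
  (undup_uniq [seq d i | i <- enum 'I_n.+1]).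
have {}qd i : q.[d i] = Num.sqrt (Num.sqrt (d i)).
  by apply: qd; rewrite mem_undup map_f// mem_enum.
pose B := horner_mx S (q ^+ 2).
have qT p : (horner_mx S p)^T = horner_mx S p by exact: trmx_horner_mx.
exists B; split; first split=> [|v]; first exact: qT.
  rewrite /B rmorphXn/= expr2 -mulmxE mulmxA -(mulmxA _ _ v).
  rewrite -{1}(qT q) -trmx_mul dotvE -sqn_dotv; exact: sqn_ge0.
apply/eqP; rewrite -subr_eq0; apply/eqP.
have -> : B *m B - S = horner_mx S (q ^+ 4 - 'X).
  rewrite rmorphB/= horner_mx_X mulmxE /B -rmorphM/=.
  by rewrite -exprD.
have inj : injective (map_mx toC : 'M[R]_n.+1 -> _).
  move=> X Y /matrixP XY; apply/matrixP => i j; have := XY i j.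
  by rewrite !mxE => /fmorph_inj.
apply: inj; rewrite map_horner_mx map_mx0 -/SC.
set r := map_poly _ _.
have SCE' : SC = invmx P *m diag_mx D *m invmx (invmx P) by rewrite invmxK.
rewrite SCE' horner_mx_uconj ?unitmx_inv// horner_mx_diag.
have -> : map_mx (horner r) D = 0.
  apply/rowP => i; rewrite !mxE dD /r horner_map !hornerE qd.
  rewrite (_ : 4 = 2 * 2)%N// exprM !sqr_sqrtr ?sqrtr_ge0//.
  by rewrite subrr rmorph0.
by rewrite (_ : diag_mx 0 = 0) ?mulmx0 ?mul0mx//; apply/matrixP => i j; rewrite !mxE mul0rn.
Qed.
End sqrt_existence.

(** * Uniformly elliptic matrices *)

Section posdef.
Context (R : realType).

Lemma sqrtmxP n (S : 'M[R]_n) : posdefmx S ->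
  possemidefmx (sqrtmx S) /\ sqrtmx S *m sqrtmx S = S.
Proof. by move=> /sqrtmx_exists; exact: xgetPex. Qed.

Lemma sqrtmx_unit n (S : 'M[R]_n) : posdefmx S -> sqrtmx S \in unitmx.
Proof.
move=> pS; have := posdef_unitmx pS; rewrite -{1}(sqrtmxP pS).2.
by rewrite unitmx_mul => /andP[].
Qed.

(** A vector at which a positive semidefinite form vanishes lies in its kernel,
    for otherwise the form would take a negative value nearby. *)
Lemma psd_unit_posdef n (B : 'M[R]_n) : possemidefmx B -> B \in unitmx ->
  posdefmx B.
Proof.
move=> [BT B0] uB; split => // v v0; rewrite lt_neqAle B0 andbT eq_sym.
apply/negP => /eqP qv; rewrite -/(qform B v) in qv.
have w0 : B *m v != 0.
  by apply: contra_neq v0 => /(congr1 (mulmx (invmx B))); rewrite mulKmx// mulmx0.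
set w := B *m v in w0; have sw := sqn_gt0 w0.
have qw : 0 <= qform B w by exact: B0.
pose t := sqn w / (qform B w + 1).
have : 0 <= qform B (v - t *: w) by exact: B0.
have -> : qform B (v - t *: w) = qform B v - 2 * t * sqn w + t ^+ 2 * qform B w.
  have vB : dotv v (B *m w) = sqn w by rewrite dotv_mulmx BT -sqn_dotv.
  rewrite !qformE mulmxBr -scalemxAr -/w dotvBl !dotvBr !dotvZl.
  rewrite (dotvC v (t *: _)) (dotvC w (t *: _)) !dotvZl (dotvC (B *m w) v) vB.
  rewrite -sqn_dotv (dotvC (B *m w)).
  by ring.
rewrite qv add0r.
have -> : - (2 * t * sqn w) + t ^+ 2 * qform B w =
  - ((sqn w / (qform B w + 1)) ^+ 2 * (qform B w + 2)).
  by rewrite /t; field; rewrite gt_eqF// ltr_wpDl.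
rewrite oppr_ge0 leNgt => /negP; apply.
by rewrite mulr_gt0 ?exprn_gt0 ?divr_gt0// ltr_wpDl.
Qed.

Lemma posdef_sqrtmx n (S : 'M[R]_n) : posdefmx S -> posdefmx (sqrtmx S).
Proof.
by move=> pS; apply: psd_unit_posdef (sqrtmx_unit pS); exact: (sqrtmxP pS).1.
Qed.

Lemma sqrtmx_tr n (S : 'M[R]_n) : posdefmx S -> (sqrtmx S)^T = sqrtmx S.
Proof. by move=> /posdef_sqrtmx[]. Qed.

Lemma det_sqrtmx n (S : 'M[R]_n) : posdefmx S -> \det S = (\det (sqrtmx S)) ^+ 2.
Proof. by move=> pS; rewrite expr2 -det_mulmx (sqrtmxP pS).2. Qed.

Lemma posdef_det_gt0 n (S : 'M[R]_n) : posdefmx S -> 0 < \det S.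
Proof.
move=> pS; rewrite lt_neqAle {2}(det_sqrtmx pS) sqr_ge0 andbT eq_sym.
by rewrite -unitfE -unitmxE posdef_unitmx.
Qed.

Lemma wnorm_sqr n (S : 'M[R]_n) v : posdefmx S ->
  wnorm S v ^+ 2 = qform (invmx S) v.
Proof.
move=> pS; rewrite /wnorm enorm_sqr sqn_dotv qformE.
set B := sqrtmx S; have uB : B \in unitmx := sqrtmx_unit pS.
have BT : (invmx B)^T = invmx B by rewrite trmx_inv sqrtmx_tr.
rewrite [LHS]dotv_mulmx BT dotvC mulmxA; congr (dotv _ (_ *m _)).
apply: (can_inj (mulKmx (posdef_unitmx pS))); rewrite mulmxV ?posdef_unitmx//.
by rewrite -{1}(sqrtmxP pS).2 mulmxA -(mulmxA B) mulmxV// mulmx1 mulmxV.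
Qed.

Lemma qform_sqrtmx n (S : 'M[R]_n) v : posdefmx S ->
  qform S v = sqn (sqrtmx S *m v).
Proof.
move=> pS; rewrite qformE -{1}(sqrtmxP pS).2 -mulmxA dotv_mulmx (sqrtmx_tr pS).
by rewrite sqn_dotv.
Qed.

End posdef.

Section elliptic.
Context (R : realType).

(** The lower bound controls the inverse and the determinant from below, the
    bound on the entries everything else: on such a class of matrices every
    Gaussian estimate holds with the same constants. *)
Definition elliptic n (lam M : R) (S : 'M[R]_n) :=
  [/\ S^T = S, forall v, lam * sqn v <= qform S v & forall i j, `|S i j| <= M].

Lemma mx_entry_bound m n (S : 'M[R]_(m, n)) :
  exists2 M : R, 0 < M & forall i j, `|S i j| <= M.
Proof.
exists (1 + \sum_i \sum_j `|S i j|) => [|i j].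
  by rewrite ltr_pwDl// sumr_ge0// => i _; rewrite sumr_ge0.
rewrite (bigD1 i)//= (bigD1 j)//=.
have : 0 <= \sum_(k | k != j) `|S i k| by rewrite sumr_ge0.
have : 0 <= \sum_(k | k != i) \sum_j0 `|S k j0|.
  by rewrite sumr_ge0// => k _; rewrite sumr_ge0.
by lra.
Qed.

(** The square root is invertible, and the bound on its inverse is a lower
    bound for the form. *)
Lemma posdef_elliptic n (S : 'M[R]_n) : posdefmx S ->
  exists lam M : R, [/\ 0 < lam, 0 < M & elliptic lam M S].
Proof.
move=> pS; have [M M0 SM] := mx_entry_bound S.
have uB := sqrtmx_unit pS.
have [N N0 BN] := mx_entry_bound (invmx (sqrtmx S)).
have c0 : 0 <= n%:R * n%:R * N ^+ 2 by rewrite mulr_ge0 ?sqr_ge0 ?mulr_ge0.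
set c := n%:R * n%:R * N ^+ 2 in c0.
exists (1 + c)^-1, M; split => //; first by rewrite invr_gt0; lra.
split => // [|v]; first by case: pS.
rewrite (qform_sqrtmx _ pS) mulrC ler_pdivrMr; last by lra.
have := sqn_mulmx (sqrtmx S *m v) BN; rewrite mulKmx// -/c => H.
by apply: le_trans H _; rewrite mulrC; apply: ler_wpM2l; [exact: sqn_ge0|lra].
Qed.

Context (n : nat) (lam M : R).
Hypothesis lam0 : 0 < lam.
Implicit Types S : 'M[R]_n.

Lemma elliptic_posdef S : elliptic lam M S -> posdefmx S.
Proof.
move=> [ST Sl _]; split => // v v0; apply: lt_le_trans (Sl v).
by rewrite mulr_gt0// sqn_gt0.
Qed.

Lemma sqn_invmx_le S v : elliptic lam M S ->
  sqn (invmx S *m v) <= lam^-1 ^+ 2 * sqn v.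
Proof.
move=> eS; have [_ Sl _] := eS.
have uS := posdef_unitmx (elliptic_posdef eS).
set w := invmx S *m v.
have vE : v = S *m w by rewrite mulKVmx.
have := Sl w; rewrite qformE -vE => H.
have H2 : (lam * sqn w) ^+ 2 <= sqn w * sqn v.
  apply: le_trans (dotv_CS w v); apply: lerXn2r => //; rewrite ?nnegrE.
    by rewrite mulr_ge0 ?sqn_ge0// ltW.
  by apply: le_trans H; rewrite mulr_ge0 ?sqn_ge0// ltW.
have [->|w0] := eqVneq (sqn w) 0; first by rewrite mulr_ge0 ?sqr_ge0 ?sqn_ge0.
have w1 : 0 < sqn w by rewrite lt_neqAle sqn_ge0 eq_sym w0.
rewrite exprVn mulrC ler_pdivlMr ?exprn_gt0//.
rewrite -(ler_pM2l w1); apply: le_trans H2.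
by rewrite (_ : sqn w * (sqn w * lam ^+ 2) = (lam * sqn w) ^+ 2)//; ring.
Qed.

Lemma invmx_entry_le S i j : elliptic lam M S -> `|invmx S i j| <= lam^-1.
Proof.
move=> eS; have := sqn_invmx_le (delta_mx j ord0) eS.
have -> : sqn (delta_mx j ord0 : 'cV[R]_n) = 1.
  rewrite /sqn (bigD1 j)//= mxE !eqxx big1 ?addr0 ?expr1n// => k /negbTE kj.
  by rewrite mxE kj expr0n.
rewrite -colE mulr1 => /(le_trans (sqr_coord_le _ i)); rewrite mxE => H.
have l0 : 0 <= lam^-1 by rewrite invr_ge0 ltW.
by rewrite -(@ler_pXn2r _ 2) ?nnegrE// real_normK ?num_real.
Qed.

Let kap := lam / (1 + n%:R * n%:R * M ^+ 2).

Let den0 : 0 < 1 + n%:R * n%:R * M ^+ 2.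
Proof. by rewrite ltr_pwDl// mulr_ge0 ?sqr_ge0 ?mulr_ge0. Qed.

Lemma qform_invmx_ge S v : elliptic lam M S ->
  lam / (1 + n%:R * n%:R * M ^+ 2) * sqn v <= qform (invmx S) v.
Proof.
move=> eS; have [ST Sl SM] := eS.
have uS := posdef_unitmx (elliptic_posdef eS).
set w := invmx S *m v.
have vE : v = S *m w by rewrite mulKVmx.
have -> : qform (invmx S) v = qform S w.
  by rewrite !qformE -vE dotvC.
apply: le_trans (Sl w); rewrite -mulrA ler_pM2l// mulrC ler_pdivrMr//.
rewrite {1}vE; apply: (le_trans (sqn_mulmx w SM)).
by rewrite mulrC ler_wpM2l ?sqn_ge0//; lra.
Qed.

Lemma dotv_le m (u v : 'cV[R]_m) : `|dotv u v| <= (sqn u + sqn v) / 2.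
Proof.
rewrite /dotv; apply: (le_trans (ler_norm_sum _ _ _)).
rewrite /sqn -big_split/= mulr_suml; apply: ler_sum => i _; rewrite ler_norml.
have := sqr_ge0 (u i ord0 - v i ord0); have := sqr_ge0 (u i ord0 + v i ord0).
by move=> ? ?; apply/andP; split; lra.
Qed.

Lemma qform_invmx_le S v : elliptic lam M S ->
  qform (invmx S) v <= (1 + lam^-1 ^+ 2) / 2 * sqn v.
Proof.
move=> eS; rewrite qformE; apply: le_trans (ler_norm _) _.
apply: (le_trans (dotv_le _ _)); have := sqn_invmx_le v eS; lra.
Qed.

Lemma bilinear_le m1 m2 (D : 'M[R]_(m1, m2)) u v e :
  (forall i j, `|D i j| <= e) ->
  `|dotv u (D *m v)| <= e * ((m2%:R * sqn u + m1%:R * sqn v) / 2).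
Proof.
move=> De; rewrite /dotv; apply: (le_trans (ler_norm_sum _ _ _)).
have -> : m2%:R * sqn u + m1%:R * sqn v =
    \sum_(i < m1) \sum_(j < m2) (u i ord0 ^+ 2 + v j ord0 ^+ 2).
  under eq_bigr do rewrite big_split/= sumr_const card_ord -/(sqn v).
  by rewrite big_split/= sumr_const card_ord sumrMnl !mulr_natl.
rewrite mulr_suml mulr_sumr; apply: ler_sum => i _.
rewrite mxE mulr_sumr mulr_suml mulr_sumr; apply: (le_trans (ler_norm_sum _ _ _)).
apply: ler_sum => j _; rewrite normrM normrM mulrCA; apply: ler_pM => //.
rewrite -normrM ler_norml.
have := sqr_ge0 (u i ord0 - v j ord0); have := sqr_ge0 (u i ord0 + v j ord0).
by move=> ? ?; apply/andP; split; lra.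
Qed.

(** The difference of two inverses is [S1^-1 (S2 - S1) S2^-1]. *)
Lemma qform_invmx_lip S1 S2 v e : 0 <= e -> elliptic lam M S1 -> elliptic lam M S2 ->
  (forall i j, `|S1 i j - S2 i j| <= e) ->
  `|qform (invmx S1) v - qform (invmx S2) v| <= e * (n%:R * lam^-1 ^+ 2 * sqn v).
Proof.
move=> e0 e1 e2 S12.
have u1 := posdef_unitmx (elliptic_posdef e1).
have u2 := posdef_unitmx (elliptic_posdef e2).
have -> : qform (invmx S1) v - qform (invmx S2) v =
    dotv (invmx S1 *m v) ((S2 - S1) *m (invmx S2 *m v)).
  rewrite mulmxBl mulKVmx// dotvBr !qformE; congr (_ - _); first by rewrite dotvC.
  by have [S1T _ _] := e1; rewrite [RHS]dotv_mulmx S1T mulKVmx.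
have S21 i j : `|(S2 - S1) i j| <= e by rewrite !mxE distrC.
apply: (le_trans (bilinear_le _ _ S21)); apply: ler_wpM2l => //.
have := sqn_invmx_le v e1; have := sqn_invmx_le v e2.
set a := sqn _; set b := sqn _ => H1 H2.
rewrite -mulrDr -!mulrA; apply: ler_wpM2l => //.
by lra.
Qed.


End elliptic.

Section determinant.
Context (R : realType).

Lemma prod_lip (I : Type) (r : seq I) (a b : I -> R) (M e : R) : 1 <= M ->
  (forall i, `|a i| <= M) -> (forall i, `|b i| <= M) ->
  (forall i, `|a i - b i| <= e) ->
  `|\prod_(i <- r) a i - \prod_(i <- r) b i| <= (size r)%:R * M ^+ size r * e.
Proof.
move=> M1 aM bM ab; elim: r => [|i r IH].
  by rewrite !big_nil subrr normr0 !mul0r.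
rewrite !big_cons /=; set A := \prod_(j <- r) a j; set B := \prod_(j <- r) b j.
have -> : a i * A - b i * B = a i * (A - B) + (a i - b i) * B by ring.
have BM : `|B| <= M ^+ size r.
  rewrite normr_prod; elim: {IH A B} r => [|j r IH]; first by rewrite big_nil.
  by rewrite big_cons exprS ler_pM// prodr_ge0.
have e0 : 0 <= e by apply: le_trans (ab i).
have M0 : 0 <= M by lra.
apply: (le_trans (ler_normD _ _)); rewrite !normrM.
have H1 : `|a i| * `|A - B| <= M * ((size r)%:R * M ^+ size r * e).
  by rewrite ler_pM.
have H2 : `|a i - b i| * `|B| <= e * M ^+ size r by rewrite ler_pM.
apply: (le_trans (lerD H1 H2)).
have -> : (size r).+1%:R * M ^+ (size r).+1 * e =
   M * ((size r)%:R * M ^+ size r * e) + e * (M * M ^+ size r).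
  by rewrite -natr1 exprS; ring.
by rewrite lerD2l ler_wpM2l// ler_peMl// exprn_ge0.
Qed.

Lemma det_lip n (M e : R) (A B : 'M[R]_n) : 1 <= M ->
  (forall i j, `|A i j| <= M) -> (forall i j, `|B i j| <= M) ->
  (forall i j, `|A i j - B i j| <= e) ->
  `|\det A - \det B| <= (n`!)%:R * (n%:R * M ^+ n) * e.
Proof.
move=> M1 AM BM AB; rewrite /determinant -sumrB.
apply: (le_trans (ler_norm_sum _ _ _)).
have -> : (n`!)%:R * (n%:R * M ^+ n) * e = \sum_(s : 'S_n) (n%:R * M ^+ n * e).
  by rewrite sumr_const card_Sn -[RHS]mulr_natl !mulrA.
apply: ler_sum => s _; rewrite -mulrBr normrM normrX normrN1 expr1n mul1r.
have sz : size (index_enum 'I_n) = n.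
  by rewrite /index_enum locked_withE -enumT size_enum_ord.
rewrite -[X in X%:R * _]sz -[X in M ^+ X]sz.
exact: prod_lip.
Qed.

Lemma det_le n (M : R) (A : 'M[R]_n) :
  (forall i j, `|A i j| <= M) -> `|\det A| <= (n`!)%:R * M ^+ n.
Proof.
move=> AM; rewrite /determinant.
apply: (le_trans (ler_norm_sum _ _ _)).
have -> : (n`!)%:R * M ^+ n = \sum_(s : 'S_n) M ^+ n.
  by rewrite sumr_const card_Sn mulr_natl.
apply: ler_sum => s _; rewrite normrM normrX normrN1 expr1n mul1r normr_prod.
rewrite (_ : M ^+ n = \prod_(i < n) M); last by rewrite prodr_const card_ord.
by apply: ler_prod => i _; rewrite normr_ge0 AM.
Qed.

(** The Leibniz formula bounds the determinant of the inverse from above. *)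
Lemma elliptic_det_ge n (lam M : R) (S : 'M[R]_n) : 0 < lam ->
  elliptic lam M S -> ((n`!)%:R * lam^-1 ^+ n)^-1 <= \det S.
Proof.
move=> lam0 eS; have pS := elliptic_posdef lam0 eS.
have d0 := posdef_det_gt0 pS.
have := det_le (fun i j => invmx_entry_le lam0 i j eS).
rewrite det_inv ger0_norm ?invr_ge0 ?(ltW d0)// => H.
rewrite -[leRHS]invrK lef_pV2// posrE ?invr_gt0//.
by rewrite mulr_gt0 ?exprn_gt0 ?invr_gt0// ltr0n fact_gt0.
Qed.

Lemma isqrt_lip (c x y : R) : 0 < c -> c <= x -> c <= y ->
  `|(Num.sqrt x)^-1 - (Num.sqrt y)^-1| <= (Num.sqrt c ^+ 3)^-1 * `|x - y|.
Proof.
move=> c0 cx cy.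
have x0 : 0 < x by lra.
have y0 : 0 < y by lra.
have sc : 0 < Num.sqrt c by rewrite sqrtr_gt0.
have sx : Num.sqrt c <= Num.sqrt x by rewrite ler_sqrt// ltW.
have sy : Num.sqrt c <= Num.sqrt y by rewrite ler_sqrt// ltW.
rewrite -{2}[x]sqr_sqrtr ?(ltW x0)// -{2}[y]sqr_sqrtr ?(ltW y0)//.
move: sc sx sy; move: (Num.sqrt c) (Num.sqrt x) (Num.sqrt y) => s a b s0 sa sb.
have a0 : 0 < a by lra.
have b0 : 0 < b by lra.
have -> : a^-1 - b^-1 = (b - a) / (a * b).
  by field; rewrite !gt_eqF.
have -> : a ^+ 2 - b ^+ 2 = (a - b) * (a + b) by ring.
rewrite !normrM distrC mulrCA ler_wpM2l//.
rewrite (gtr0_norm (_ : 0 < (a * b)^-1)) ?invr_gt0 ?mulr_gt0//.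
rewrite (gtr0_norm (_ : 0 < a + b)) ?addr_gt0//.
rewrite ler_pdivlMl ?exprn_gt0// ler_pdivrMr ?mulr_gt0//.
have sab : s * s <= a * b by rewrite ler_pM// ltW.
have h1 : s ^+ 3 <= (a * b) * (a + b).
  rewrite (_ : s ^+ 3 = (s * s) * s); last by ring.
  by apply: ler_pM => //; [rewrite mulr_ge0// ltW|lra|lra].
by rewrite mulrC.
Qed.

End determinant.

(** * Integration over Euclidean space *)

Section measure_integral.
Local Open Scope ereal_scope.
Import HBNNSimple.

(** True for indicators by definition of the density, hence for simple functions
    and, by monotone convergence, for all nonnegative ones. *)
Lemma ge0_integral_density d (T : measurableType d) (R : realType)
    (mu : {measure set T -> \bar R}) (rho : T -> R) (f : T -> \bar R) :
  measurable_fun setT rho -> (forall x, 0 <= rho x)%R ->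
  measurable_fun setT f -> (forall x, 0 <= f x) ->
  \int[density_measure mu rho]_x f x = \int[mu]_x (f x * (rho x)%:E).
Proof.
move=> mrho rho0 mf f0.
have mrhoE : measurable_fun setT (EFin \o rho) by exact/measurable_EFinP.
have dE A : density_measure mu rho A = \int[mu]_(x in A) (rho x)%:E.
  by rewrite /density_measure asboolT.
pose h := nnsfun_approx measurableT mf.
have -> : \int[density_measure mu rho]_x f x =
    limn (fun n => \int[density_measure mu rho]_x (h n x)%:E).
  rewrite -monotone_convergence//.
  - apply: eq_integral => x _; apply/esym/cvg_lim => //.
    exact: cvg_nnsfun_approx.
  - by move=> n; exact/measurable_EFinP.
  - by move=> n x _; rewrite lee_fin.
  - by move=> x _ a b ab; rewrite lee_fin; exact/lefP/nd_nnsfun_approx.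
have -> : \int[mu]_x (f x * (rho x)%:E) =
    limn (fun n => \int[mu]_x ((h n x)%:E * (rho x)%:E)).
  rewrite -monotone_convergence//.
  - apply: eq_integral => x _; apply/esym/cvg_lim => //.
    by apply: cvgeZr => //; exact: cvg_nnsfun_approx.
  - by move=> n; apply: emeasurable_funM => //; exact/measurable_EFinP.
  - by move=> n x _; rewrite mule_ge0// lee_fin.
  - move=> x _ a b ab; rewrite lee_wpmul2r// lee_fin//.
    exact/lefP/nd_nnsfun_approx.
congr (limn _); apply/funext => n.
have mind (r : R) : measurable_fun setT (fun x => (r * \1_(h n @^-1` [set r]) x)%:E).
  by apply/measurable_EFinP; apply: measurable_funM => //; exact: measurable_indic.
have mind0 (r : R) x : 0 <= (r * \1_(h n @^-1` [set r]) x)%:E.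
  by rewrite EFinM; exact: nnfun_muleindic_ge0.
transitivity (\int[density_measure mu rho]_x
   (\sum_(y \in range (h n)) (y * \1_(h n @^-1` [set y]) x)%:E)).
  by apply: eq_integral => t tE; rewrite /= fimfunE -fsumEFin.
rewrite ge0_integral_fsum//.
transitivity (\int[mu]_x (\sum_(y \in range (h n))
    (y * \1_(h n @^-1` [set y]) x)%:E * (rho x)%:E)); last first.
  apply: eq_integral => x _; rewrite -ge0_mule_fsuml//.
  by rewrite fsumEFin // -fimfunE.
rewrite ge0_integral_fsum//; last 2 first.
  - by move=> y; exact: emeasurable_funM.
  - by move=> m y _; apply: mule_ge0 => //; rewrite lee_fin.
apply: eq_fsbigr => r rhn.
under eq_integral do rewrite EFinM.
under [RHS]eq_integral do rewrite EFinM -muleA.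
rewrite integralZl_indic_nnsfun// integral_indic// setIT.
have r0 : (0 <= r)%R by move: rhn; rewrite inE => -[x _ <-].
rewrite ge0_integralZl//; last 2 first.
  - by apply: emeasurable_funM => //; apply/measurable_EFinP; exact: measurable_indic.
  - by move=> x _; rewrite mule_ge0// lee_fin.
congr (_ * _).
rewrite [LHS]dE [LHS]integral_mkcond; apply: eq_integral => x _.
by rewrite muleC epatch_indic.
Qed.

End measure_integral.

Section line.
Context (R : realType).
Local Open Scope ereal_scope.
Let lam := @lebesgue_measure R.

Lemma measurable_scale_shift (b c : R) :
  measurable_fun setT (fun x : measurableTypeR R => (b * x + c)%R : measurableTypeR R).
Proof. by apply: measurable_funD => //; apply: measurable_funM. Qed.

(** The image of Lebesgue measure under the affine map, multiplied by [b], has the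
    right value on intervals. *)
Lemma integral_scale_shift (b c : R) (f : measurableTypeR R -> \bar R) : (0 < b)%R ->
  measurable_fun setT f -> (forall x, 0 <= f x) ->
  \int[lam]_x f (b * x + c)%R = (b^-1)%:E * \int[lam]_x f x.
Proof.
move=> b0 mf f0.
pose T (x : measurableTypeR R) : measurableTypeR R := (b * (x : R) + c)%R.
have mT : measurable_fun setT T := measurable_scale_shift b c.
have b0' : (0 <= b)%R by exact: ltW.
pose bn : {nonneg R} := NngNum b0'.
pose T' : {mfun measurableTypeR R >-> measurableTypeR R} :=
  HB.pack T (isMeasurableFun.Build _ _ _ _ T mT).
have H A : measurable A -> lam A = mscale bn (image_measure lam T') A.
  apply: (@lebesgue_measure_unique R (mscale bn (image_measure lam T'))).
  move=> _ [[s t]] _ <-.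
  change (lebesgue_measure `]s, t]%classic = b%:E * lam (T @^-1` `]s, t]%classic)).
  have -> : T @^-1` `]s, t] = `]((s - c) / b)%R, ((t - c) / b)%R]%classic.
    apply/seteqP; split => x /=; rewrite /T !in_itv/=;
      by rewrite ltr_pdivrMr// ler_pdivlMr// (mulrC x) ltrBlDr lerBrDr.
  rewrite [lam _]lebesgue_measure_itv/= [LHS]lebesgue_measure_itv/=.
  rewrite !lte_fin ltr_pM2r ?invr_gt0// ltrD2r.
  case: ifPn => st; last by rewrite mule0.
  by rewrite -!EFinB -EFinM; congr EFin; field; rewrite gt_eqF.
transitivity (\int[image_measure lam T']_x f x).
  by rewrite ge0_integral_pushforward// preimage_setT.
have -> : \int[lam]_x f x = \int[mscale bn (image_measure lam T')]_x f x.
  by apply: eq_measure_integral => A mA _; exact: H.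
rewrite ge0_integral_mscale// muleA -EFinM mulVf ?mul1e// gt_eqF//.
Qed.

End line.

Section measurable_cV.
Context (R : realType).

Lemma continuous_measurable_cV m n (f : 'M[R]_(m, n) -> R) :
  continuous f -> measurable_fun setT f.
Proof.
move=> cf; apply: (measurability _ (RGenOpens.measurableE R)).
move=> _ [U [a [b ->]] <-]; rewrite setTI; apply: sub_sigma_algebra.
by move/continuousP : cf; apply; exact: interval_open.
Qed.

Lemma measurable_sqn n : measurable_fun setT (@sqn R n).
Proof.
apply: measurable_sum => i; apply: measurable_funX; exact: measurable_coord.
Qed.

Lemma measurable_mx_coord d (T : measurableType d) m n (f : T -> 'M[R]_(m, n)) i j :
  measurable_fun setT f -> measurable_fun setT (fun x => f x i j).
Proof. exact: (measurableT_comp (@measurable_coord R m n i j)). Qed.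

Lemma measurable_mulmx m n (A : 'M[R]_(m, n)) :
  measurable_fun setT (fun v : 'cV[R]_n => A *m v).
Proof.
apply: measurable_fun_mxP => i j; under eq_fun do rewrite mxE.
apply: measurable_sum => k; apply: measurable_funM => //.
exact: measurable_coord.
Qed.

Lemma measurable_addmx d (T : measurableType d) m n (f g : T -> 'M[R]_(m, n)) :
  measurable_fun setT f -> measurable_fun setT g ->
  measurable_fun setT (fun x => f x + g x).
Proof.
move=> mf mg; apply: measurable_fun_mxP => i j; under eq_fun do rewrite mxE.
by apply: measurable_funD; exact: measurable_mx_coord.
Qed.

Lemma measurable_oppmx d (T : measurableType d) m n (f : T -> 'M[R]_(m, n)) :
  measurable_fun setT f -> measurable_fun setT (fun x => - f x).
Proof.
move=> mf; apply: measurable_fun_mxP => i j; under eq_fun do rewrite mxE.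
by apply: measurableT_comp => //; exact: measurable_mx_coord.
Qed.

Lemma measurable_scalemx d (T : measurableType d) m n (a : T -> R)
    (f : T -> 'M[R]_(m, n)) :
  measurable_fun setT a -> measurable_fun setT f ->
  measurable_fun setT (fun x => a x *: f x).
Proof.
move=> ma mf; apply: measurable_fun_mxP => i j; under eq_fun do rewrite mxE.
by apply: measurable_funM => //; exact: measurable_mx_coord.
Qed.

Lemma measurable_qform n (S : 'M[R]_n) : measurable_fun setT (qform S).
Proof.
rewrite (_ : qform S = fun v => dotv v (S *m v)); last first.
  by apply/funext => v; rewrite qformE.
apply: measurable_sum => i; apply: measurable_funM; first exact: measurable_coord.
exact: measurable_mx_coord (measurable_mulmx S).
Qed.

Lemma measurable_subl_mx n (a : 'cV[R]_n) :
  measurable_fun setT (fun v : 'cV[R]_n => v - a).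
Proof. by apply: measurable_addmx => //; exact: measurable_cst. Qed.

End measurable_cV.

Section lebesgue_integral_cV.
Context (R : realType).
Local Open Scope ereal_scope.
Let lam := @lebesgue_measure R.

Lemma integral_cVS n (f : 'cV[R]_n.+1 -> \bar R) :
  measurable_fun setT f -> (forall v, 0 <= f v) ->
  \int[lebesgue_cV R n.+1]_v f v =
  \int[lam]_x \int[lebesgue_cV R n]_v f (cons_cV (x, v)).
Proof.
move=> mf f0 /=; rewrite /lebesgue_step /image_measure.
rewrite ge0_integral_pushforward//= preimage_setT.
by rewrite fubini_tonelli1//; apply: measurableT_comp.
Qed.

Lemma integral_cVS_swap n (f : 'cV[R]_n.+1 -> \bar R) :
  measurable_fun setT f -> (forall v, 0 <= f v) ->
  \int[lebesgue_cV R n.+1]_v f v =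
  \int[lebesgue_cV R n]_v \int[lam]_x f (cons_cV (x, v)).
Proof.
move=> mf f0 /=; rewrite /lebesgue_step /image_measure.
rewrite ge0_integral_pushforward//= preimage_setT.
by rewrite fubini_tonelli2//; apply: measurableT_comp.
Qed.

Lemma integral_cV0 (f : 'cV[R]_0 -> \bar R) :
  measurable_fun setT f -> \int[lebesgue_cV R 0]_v f v = f 0%R.
Proof. by move=> mf; rewrite /= integral_dirac// diracT mul1e. Qed.

(** The measure of a space is built from that of the line one coordinate at a
    time, so the coordinates of the first block are peeled off by induction. *)
Lemma integral_col_mx m n (f : 'cV[R]_(m + n) -> \bar R) :
  measurable_fun setT f -> (forall v, 0 <= f v) ->
  \int[lebesgue_cV R (m + n)]_v f v =
  \int[lebesgue_cV R m]_u \int[lebesgue_cV R n]_v f (col_mx u v).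
Proof.
elim: m f => [|m IH] f mf f0.
  rewrite integral_cV0; last first.
    apply: (measurable_fun_fubini_tonelli_F (f \o @pair_cV R 0 n)) => // [|x].
      exact: (measurableT_comp mf (@measurable_pair_cV R 0 n)).
    exact: f0.
  apply: eq_integral => v _; congr f.
  apply/colP => i; case: (@split_ordP 0 n i) => k ->; first by case: k.
  by rewrite col_mxEd; congr (v _ _); exact/val_inj.
have mf2 : measurable_fun setT
    (fun u : 'cV[R]_m.+1 => \int[lebesgue_cV R n]_v f (col_mx u v)).
  apply: (measurable_fun_fubini_tonelli_F (f \o @pair_cV R m.+1 n)) => // [|x].
    exact: (measurableT_comp mf (@measurable_pair_cV R m.+1 n)).
  exact: f0.
rewrite [RHS]integral_cVS//; last by move=> u; exact: integral_ge0.
transitivity (\int[lam]_x \int[lebesgue_cV R (m + n)]_v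
   f (cons_cV (x, v))); first exact: integral_cVS.
apply: eq_integral => x _; rewrite IH//; last first.
  apply: (measurableT_comp mf); apply: (measurableT_comp (@measurable_cons_cV R _)).
  exact: measurable_pair1.
apply: eq_integral => u _; apply: eq_integral => v _; congr f.
apply/colP => i; case: (unliftP ord0 i) => [j|] ->.
  rewrite cons_cVS; case: (split_ordP j) => k ->.
    rewrite col_mxEu (_ : lift ord0 (lshift n k) = lshift n (lift ord0 k)).
      by rewrite col_mxEu cons_cVS.
    exact/val_inj.
  rewrite col_mxEd (_ : lift ord0 (rshift m k) = rshift m.+1 k).
    by rewrite col_mxEd.
  exact/val_inj.
rewrite cons_cV0 (_ : ord0 = lshift n ord0); last exact/val_inj.
by rewrite col_mxEu cons_cV0.
Qed.

End lebesgue_integral_cV.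

(** * Schur complements and affine changes of variables *)

Section schur_complement.
Context (R : realType) (m n : nat).
Variables (A : 'M[R]_m) (B : 'M[R]_(n, m)) (D : 'M[R]_n).
Hypothesis pA : posdefmx A.

Definition schur : 'M[R]_n := D - B *m invmx A *m B^T.

Let G := B *m invmx A.
Let L : 'M[R]_(m + n) := block_mx 1%:M 0 G 1%:M.
Let L' : 'M[R]_(m + n) := block_mx 1%:M 0 (- G) 1%:M.
Let uA : A \in unitmx := posdef_unitmx pA.
Let AT : A^T = A := pA.1.

Let GT : G^T = invmx A *m B^T.
Proof. by rewrite trmx_mul trmx_inv AT. Qed.

Let LT : L^T = block_mx 1%:M G^T 0 1%:M.
Proof. by rewrite tr_block_mx !trmx1 trmx0. Qed.

(** Block elimination; the triangular factors have determinant 1 and turn the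
    quadratic forms into sums of two squares. *)
Lemma block_schur :
  block_mx A B^T B D = L *m block_mx A 0 0 schur *m L^T.
Proof.
rewrite LT !mulmx_block !(mul0mx, mulmx0, mul1mx, mulmx1, addr0, add0r).
rewrite /G mulmxKV// GT mulKVmx//; congr block_mx.
by rewrite mulmxA /schur addrC subrK.
Qed.

Lemma det_block_schur : \det (block_mx A B^T B D) = \det A * \det schur.
Proof.
rewrite block_schur !det_mulmx LT (det_ublock A) det_lblock (det_ublock 1%:M).
by rewrite !det1 !mul1r mulr1.
Qed.

Lemma qform_block_diag (P : 'M[R]_m) (Q : 'M[R]_n) u v :
  qform (block_mx P 0 0 Q) (col_mx u v) = qform P u + qform Q v.
Proof.
rewrite !qformE mul_block_col !mul0mx addr0 add0r /dotv big_split_ord/=.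
by congr (_ + _); apply: eq_bigr => i _; rewrite ?col_mxEu ?col_mxEd.
Qed.

Lemma qform_block u v : qform (block_mx A B^T B D) (col_mx u v) =
  qform A (u + G^T *m v) + qform schur v.
Proof.
rewrite block_schur qformE -!mulmxA dotv_mulmx.
have -> : L^T *m col_mx u v = col_mx (u + G^T *m v) v.
  by rewrite LT mul_block_col !mul1mx mul0mx add0r.
by rewrite -qformE qform_block_diag.
Qed.

Lemma schur_posdef : posdefmx (block_mx A B^T B D) -> posdefmx schur.
Proof.
move=> [CT C0]; split.
  have DT : D^T = D.
    by move: CT; rewrite tr_block_mx trmxK => /eq_block_mx[].
  by rewrite /schur linearB/= DT !trmx_mul trmxK trmx_inv AT mulmxA.
move=> v v0; have := C0 (col_mx (- G^T *m v) v).
rewrite -!/(qform _ _) qform_block mulNmx addNr.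
rewrite {1}/qform mulmx0 mxE add0r; apply.
by apply: contra_neq v0 => /(congr1 dsubmx); rewrite col_mxKd linear0.
Qed.

(** Completing the square: the second form is evaluated at the residual of the
    regression of [v] on [u]. *)
Lemma qform_invmx_block u v : posdefmx schur ->
  qform (invmx (block_mx A B^T B D)) (col_mx u v) =
  qform (invmx A) u + qform (invmx schur) (v - G *m u).
Proof.
move=> pS; have uS := posdef_unitmx pS.
have LL' : L *m L' = 1%:M.
  rewrite mulmx_block !(mul0mx, mulmx0, mul1mx, mulmx1, addr0, add0r).
  by rewrite subrr -scalar_mx_block.
have uL : L \in unitmx by case: (mulmx1_unit LL').
have uD : block_mx A 0 0 schur \in unitmx by rewrite block_diag_mx_unit uA.
have uC : block_mx A B^T B D \in unitmx.
  by rewrite block_schur !unitmx_mul unitmx_tr uL uD.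
set z := L^T *m (invmx (block_mx A B^T B D) *m col_mx u v).
have zE : block_mx A 0 0 schur *m z = col_mx u (v - G *m u).
  have : L *m (block_mx A 0 0 schur *m z) = col_mx u v.
    by rewrite /z !mulmxA -block_schur mulmxV// mul1mx.
  move=> /(congr1 (mulmx L')).
  have -> : L' *m (L *m (block_mx A 0 0 schur *m z)) = block_mx A 0 0 schur *m z.
    by rewrite mulmxA (mulmx1C LL') mul1mx.
  by rewrite mul_block_col !mul1mx mul0mx addr0 mulNmx addrC.
have zE' : z = block_mx (invmx A) 0 0 (invmx schur) *m col_mx u (v - G *m u).
  by rewrite -zE -invmx_block_diag// mulKmx.
have -> : qform (invmx (block_mx A B^T B D)) (col_mx u v) =
    dotv (block_mx A 0 0 schur *m z) z.
  rewrite qformE; set y := invmx _ *m _.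
  have -> : col_mx u v = block_mx A B^T B D *m y by rewrite mulKVmx.
  by rewrite block_schur -!mulmxA dotvC dotv_mulmx dotvC.
by rewrite zE zE' -qformE qform_block_diag.
Qed.

End schur_complement.

Section affine_change.
Context (R : realType).
Local Open Scope ereal_scope.
Let lam := @lebesgue_measure R.

Lemma qform_scalar1 (B : 'M[R]_1) : posdefmx B ->
  B = (B ord0 ord0)%:M /\ (0 < B ord0 ord0)%R.
Proof.
move=> [_ B0]; split.
  by apply/matrixP => i j; rewrite !ord1 !mxE mulr1n.
have := B0 1%:M; rewrite trmx1 mul1mx mulmx1; apply.
by apply/eqP => /matrixP/(_ ord0 ord0)/eqP; rewrite !mxE/= oner_eq0.
Qed.

Lemma posdef_ulsubmx m n (B : 'M[R]_(m + n)) : posdefmx B -> posdefmx (ulsubmx B).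
Proof.
move=> [BT B0]; split; first by rewrite trmx_ulsub BT.
move=> v v0; have := B0 (col_mx v 0).
have -> : (col_mx v 0)^T *m B *m col_mx v 0 = v^T *m ulsubmx B *m v.
  rewrite -{1}[B]submxK tr_col_mx mul_row_block mul_row_col trmx0 !mul0mx.
  by rewrite !addr0 mulmx0 addr0.
apply.
by apply: contra_neq v0 => /(congr1 usubmx); rewrite col_mxKu linear0.
Qed.

(** Splitting off the first coordinate factors a positive definite map into two
    triangular ones, through its Schur complement; each is treated by Fubini,
    one scaling at a time. *)
Lemma integral_affine n (B : 'M[R]_n) a (f : 'cV[R]_n -> \bar R) : posdefmx B ->
  measurable_fun setT f -> (forall v, 0 <= f v) ->
  \int[lebesgue_cV R n]_v f (affine_mx a B v) =
  ((\det B)^-1)%:E * \int[lebesgue_cV R n]_v f v.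
Proof.
elim: n B a f => [|n IH] B a f pB mf f0.
  rewrite det_mx00 invr1 mul1e; apply: eq_integral => v _.
  by congr f; apply/colP => -[].
have [BT _] := pB.
pose A : 'M[R]_1 := @ulsubmx R 1 n 1 n B.
pose w : 'cV[R]_n := @dlsubmx R 1 n 1 n B.
pose D : 'M[R]_n := @drsubmx R 1 n 1 n B.
have pA : posdefmx A := @posdef_ulsubmx 1 n B pB.
have BE : B = block_mx A w^T w D.
  by rewrite -[LHS](@submxK R 1 n 1 n B) /w trmx_dlsub BT.
have [AE b0] := qform_scalar1 pA; set b := A ord0 ord0 in AE b0.
have pS : posdefmx (schur A w D) by apply: schur_posdef => //; rewrite -BE.
set S := schur A w D in pS.
have SE : S = (D - b^-1 *: (w *m w^T))%R.
  by rewrite /S /schur AE invmx_scalar mul_mx_scalar -scalemxAl.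
have detB : \det B = (b * \det S)%R.
  by rewrite BE (det_block_schur _ _ pA) {1}AE det_scalar1.
pose a0 := a ord0 ord0; pose a' : 'cV[R]_n := @dsubmx R 1 n 1 a.
pose g (p : measurableTypeR R * 'cV[R]_n) : \bar R :=
  f (cons_cV (p.1, S *m p.2 + (a' + ((p.1 - a0) / b) *: w))%R).
have mg : measurable_fun setT g.
  apply: (measurableT_comp mf); apply: (measurableT_comp (@measurable_cons_cV R n)).
  apply: measurable_fun_pair; first exact: measurable_fst.
  apply: measurable_addmx.
    apply: (measurableT_comp (measurable_mulmx S)); exact: measurable_snd.
  apply: measurable_addmx; first exact: measurable_cst.
  apply: measurable_scalemx; last exact: measurable_cst.
  apply: measurable_funM; last exact: measurable_cst.
  by apply: measurable_funB; [exact: measurable_fst|exact: measurable_cst].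
have g0 p : 0 <= g p by exact: f0.
have fg x v : f (affine_mx a B (cons_cV (x, v))) =
    g ((b * x + (dotv w v + a0))%R, v).
  have Bx : B *m cons_cV (x, v) =
      cons_cV ((b * x + dotv w v)%R, (x *: w + D *m v)%R).
    rewrite {1}BE [LHS](@mul_block_col R 1 n 1 n 1 A w^T w D x%:M v).
    rewrite /cons_cV !mul_mx_scalar; apply: (f_equal2 (@col_mx R 1 n 1)) => //.
    apply/matrixP => i j; rewrite !ord1 [LHS]mxE [(x *: A) _ _]mxE.
    rewrite [(w^T *m v) _ _]mxE [RHS]mxE mulr1n (mulrC x); congr (_ + _)%R.
    by apply: eq_bigr => k _; rewrite mxE.
  congr f; apply/colP => i; rewrite mxE Bx; case: (unliftP ord0 i) => [k|] ->.
    have wv : w^T *m v = (dotv w v)%:M.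
      by apply/matrixP => i' j'; rewrite !ord1 dotvE mxE.
    have SvE : S *m v = (D *m v - (b^-1 * dotv w v) *: w)%R.
      by rewrite SE mulmxBl -scalemxAl -mulmxA wv mul_mx_scalar scalerA.
    have ak : a (lift ord0 k) ord0 = a' k ord0.
      by rewrite [RHS]mxE; congr (a _ _); exact/val_inj.
    have gen (Dv c z : 'cV[R]_n) t : (c k ord0 + (x *: z + Dv) k ord0 =
        (Dv - (b^-1 * t) *: z +
         (c + ((b * x + (t + a0) - a0) / b) *: z)) k ord0)%R.
      by rewrite !mxE; field; rewrite gt_eqF.
    by rewrite !cons_cVS SvE ak (gen _ _ _ (dotv w v)).
  by rewrite !cons_cV0 addrC -addrA.
rewrite integral_cVS_swap//; last first.
  by apply: (measurableT_comp mf); exact: measurable_affine_mx.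
transitivity (\int[lebesgue_cV R n]_v ((b^-1)%:E * \int[lam]_x g (x, v))).
  apply: eq_integral => v _; rewrite -(integral_scale_shift (dotv w v + a0)%R (f := fun x => g (x, v)))//.
    by apply: eq_integral => x _; rewrite fg.
  by apply: (measurableT_comp mg); exact: measurable_pair2.
rewrite ge0_integralZl//; last 3 first.
  - exact: measurable_fun_fubini_tonelli_G.
  - by move=> v _; exact: integral_ge0.
  - by rewrite lee_fin invr_ge0 ltW.
rewrite -[\int[lebesgue_cV R n]_v _](fubini_tonelli g)// detB invfM EFinM -muleA.
congr (_ * _); rewrite integral_cVS// -ge0_integralZl//; last 3 first.
  - apply: (measurable_fun_fubini_tonelli_F (f \o @cons_cV R n)).
      exact: measurableT_comp.
    by move=> p; exact: f0.
  - by move=> x _; exact: integral_ge0.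
  - by rewrite lee_fin invr_ge0 ltW// posdef_det_gt0.
apply: eq_integral => x _.
rewrite -(IH S (a' + ((x - a0) / b) *: w)%R (fun v => f (cons_cV (x, v))))//.
  by apply: eq_integral => v _; rewrite /g /affine_mx addrC.
apply: (measurableT_comp mf); apply: (measurableT_comp (@measurable_cons_cV R n)).
exact: measurable_pair1.
Qed.

End affine_change.

(** * Functions with Gaussian decay *)

Section line_gauss.
Context (R : realType).
Local Open Scope ereal_scope.
Let lam := @lebesgue_measure R.

Lemma measurable_gauss_line (c : R) :
  measurable_fun setT (fun x : measurableTypeR R => expR (- (c * x ^+ 2))).
Proof.
apply: measurableT_comp => //; apply: measurableT_comp => //.
by apply: measurable_funM => //; exact: measurable_funX.
Qed.

Lemma integral_gauss_line (c : R) : (0 < c)%R ->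
  \int[lam]_x (expR (- (c * x ^+ 2)))%:E = ((Num.sqrt c)^-1 * Num.sqrt pi)%:E.
Proof.
move=> c0; have sc0 : (0 < Num.sqrt c)%R by rewrite sqrtr_gt0.
have := @integral_scale_shift R (Num.sqrt c) 0 (fun x => (gauss_fun x)%:E) sc0.
rewrite integralT_gauss EFinM => <-.
- apply: eq_integral => x _; rewrite /gauss_fun addr0 exprMn sqr_sqrtr// ltW//.
- by apply/measurable_EFinP; exact: measurable_gauss_fun.
- by move=> x; rewrite lee_fin gauss_fun_ge0.
Qed.

Lemma integralN_line (f : measurableTypeR R -> \bar R) :
  measurable_fun setT f -> (forall x, 0 <= f x) ->
  \int[lam]_x f (- x)%R = \int[lam]_x f x.
Proof.
move=> mf f0; transitivity (\int[pushforward lam (-%R : _ -> measurableTypeR R)]_x f x).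
  rewrite ge0_integral_pushforward//.
by apply: eq_measure_integral => A mA _; exact: lebesgue_measureN.
Qed.

End line_gauss.

Section gaussian_decay.
Context (R : realType).

(** A weight of order one costs half of the rate of decay. *)
Lemma expR_weight_le (c t : R) : 0 < c -> 0 <= t ->
  (1 + t) * expR (- (c * t)) <= (1 + 2 / c) * expR (- (c / 2 * t)).
Proof.
move=> c0 t0.
have c1 : 0 <= c / 2 by rewrite divr_ge0// ltW.
have c2 : 0 <= 2 / c by rewrite divr_ge0// ltW.
have -> : - (c * t) = - (c / 2 * t) + - (c / 2 * t) by field.
rewrite expRD mulrA ler_wpM2r ?expR_ge0// expRN ler_pdivrMr ?expR_gt0//.
apply: (@le_trans _ _ ((1 + 2 / c) * (1 + c / 2 * t))).
  have -> : (1 + 2 / c) * (1 + c / 2 * t) = 1 + t + (2 / c + c / 2 * t).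
    by field; rewrite gt_eqF.
  by rewrite lerDl addr_ge0// mulr_ge0.
by rewrite ler_wpM2l ?expR_ge1Dx// addr_ge0.
Qed.

(** The functions to be integrated all have this form, so integrability and
    Fubini cost nothing beyond measurability and one pointwise bound. *)
Definition gdom n (f : 'cV[R]_n -> R) := measurable_fun setT f /\
  exists C c : R, 0 < c /\ forall v, `|f v| <= C * expR (- (c * sqn v)).

Lemma gdom_meas n (f : 'cV[R]_n -> R) : gdom f -> measurable_fun setT f.
Proof. by case. Qed.

Lemma gdom_le n (f g : 'cV[R]_n -> R) : measurable_fun setT g ->
  (forall v, `|g v| <= `|f v|) -> gdom f -> gdom g.
Proof.
move=> mg gf [_ [C [c [c0 fC]]]]; split => //; exists C, c; split => // v.
exact: le_trans (gf v) (fC v).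
Qed.

Lemma gdom_norm n (f : 'cV[R]_n -> R) : gdom f -> gdom (fun v => `|f v|).
Proof.
move=> gf; apply: gdom_le (gf) => [|v]; last by rewrite normr_id.
by apply: measurableT_comp => //; exact: gdom_meas.
Qed.

Lemma gdom_exp n (C c : R) : 0 < c ->
  gdom (fun v : 'cV[R]_n => C * expR (- (c * sqn v))).
Proof.
move=> c0; split.
  apply: measurable_funM => //; apply: measurableT_comp => //.
  apply: measurableT_comp => //; apply: measurable_funM => //.
  exact: measurable_sqn.
by exists `|C|, c; split => // v; rewrite normrM (ger0_norm (expR_ge0 _)).
Qed.

Lemma gdomD n (f g : 'cV[R]_n -> R) : gdom f -> gdom g ->
  gdom (fun v => f v + g v).
Proof.
move=> [mf [C [c [c0 fC]]]] [mg [D [d [d0 gD]]]]; split.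
  exact: measurable_funD.
exists (`|C| + `|D|), (Num.min c d); split => [|v]; first by rewrite lt_min c0.
rewrite mulrDl; apply: (le_trans (ler_normD _ _)); apply: lerD.
  apply: (le_trans (fC v)); apply: ler_pM; rewrite ?expR_ge0 ?ler_norm//; last first.
    by rewrite ler_expR lerN2 ler_wpM2r ?sqn_ge0// ge_min lexx.
  have := fC 0; move/(le_trans (normr_ge0 _)).
  by rewrite pmulr_lge0 ?expR_gt0.
apply: (le_trans (gD v)); apply: ler_pM; rewrite ?expR_ge0 ?ler_norm//; last first.
  by rewrite ler_expR lerN2 ler_wpM2r ?sqn_ge0// ge_min lexx orbT.
have := gD 0; move/(le_trans (normr_ge0 _)).
by rewrite pmulr_lge0 ?expR_gt0.
Qed.

Lemma gdomZ n a (f : 'cV[R]_n -> R) : gdom f -> gdom (fun v => a * f v).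
Proof.
move=> [mf [C [c [c0 fC]]]]; split; first exact: measurable_funM.
exists (`|a| * C), c; split => // v; rewrite normrM -mulrA.
by rewrite ler_wpM2l.
Qed.

Lemma gdomN n (f : 'cV[R]_n -> R) : gdom f -> gdom (fun v => - f v).
Proof.
move=> gf; apply: gdom_le (gf) => [|v]; last by rewrite normrN.
by apply: measurableT_comp => //; exact: gdom_meas.
Qed.

Lemma gdomB n (f g : 'cV[R]_n -> R) : gdom f -> gdom g ->
  gdom (fun v => f v - g v).
Proof. by move=> gf gg; exact/gdomD/gdomN. Qed.

Lemma gdom0 n : gdom (fun _ : 'cV[R]_n => 0).
Proof.
split; first exact: measurable_cst.
by exists 1, 1; split => // v; rewrite normr0 mul1r expR_ge0.
Qed.

Lemma gdom_sum n (I : Type) (r : seq I) (f : I -> 'cV[R]_n -> R) :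
  (forall i, gdom (f i)) -> gdom (fun v => \sum_(i <- r) f i v).
Proof.
move=> gf; elim: r => [|i r IH].
  by under eq_fun do rewrite big_nil; exact: gdom0.
by under eq_fun do rewrite big_cons; exact: gdomD.
Qed.

Lemma gdomM_weight n (h f : 'cV[R]_n -> R) A : measurable_fun setT h ->
  (forall v, `|h v| <= A * (1 + sqn v)) -> gdom f -> gdom (fun v => h v * f v).
Proof.
move=> mh hA [mf [C [c [c0 fC]]]]; split; first exact: measurable_funM.
exists (A * C * (1 + 2 / c)), (c / 2); split => [|v]; first by rewrite divr_gt0.
rewrite normrM; apply: (le_trans (ler_pM _ _ (hA v) (fC v))) => //.
have A0 : 0 <= A.
  have := le_trans (normr_ge0 _) (hA v); rewrite pmulr_lge0// ltr_pwDl// sqn_ge0//.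
have C0 : 0 <= C.
  by have := le_trans (normr_ge0 _) (fC v); rewrite pmulr_lge0// expR_gt0.
have -> : A * (1 + sqn v) * (C * expR (- (c * sqn v))) =
  (A * C) * ((1 + sqn v) * expR (- (c * sqn v))) by ring.
by rewrite -[leRHS]mulrA ler_wpM2l ?mulr_ge0// expR_weight_le// sqn_ge0.
Qed.

Lemma gdomM_bounded n (h f : 'cV[R]_n -> R) A : measurable_fun setT h ->
  (forall v, `|h v| <= A) -> gdom f -> gdom (fun v => h v * f v).
Proof.
move=> mh hA; apply: (gdomM_weight (A := A)) => // v.
have A0 : 0 <= A by apply: le_trans (hA v).
by apply: (le_trans (hA v)); rewrite mulrDr mulr1 lerDl mulr_ge0// sqn_ge0.
Qed.

Lemma coord_le_weight n (v : 'cV[R]_n) i : `|v i ord0| <= 1 + sqn v.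
Proof.
apply: (@le_trans _ _ (1 + v i ord0 ^+ 2)); last by rewrite lerD2l sqr_coord_le.
rewrite ler_norml; apply/andP; split.
  by have := sqr_ge0 (v i ord0 + 1); nra.
by have := sqr_ge0 (v i ord0 - 1); nra.
Qed.

Lemma coord2_le_weight n (v : 'cV[R]_n) i j : `|v i ord0 * v j ord0| <= 1 + sqn v.
Proof.
rewrite ler_norml.
have hi := sqr_coord_le v i; have hj := sqr_coord_le v j.
have := sqr_ge0 (v i ord0 + v j ord0); have := sqr_ge0 (v i ord0 - v j ord0).
by move=> ? ?; apply/andP; split; lra.
Qed.

Lemma gdomM_coord n (f : 'cV[R]_n -> R) i : gdom f ->
  gdom (fun v => v i ord0 * f v).
Proof.
apply: (gdomM_weight (A := 1)); first exact: measurable_coord.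
by move=> v; rewrite mul1r coord_le_weight.
Qed.

Lemma gdom_shift n (f : 'cV[R]_n -> R) a : gdom f -> gdom (fun v => f (v - a)).
Proof.
move=> [mf [C [c [c0 fC]]]]; split.
  exact: (measurableT_comp mf (measurable_subl_mx a)).
exists (C * expR (c * sqn a)), (c / 2); split => [|v]; first by rewrite divr_gt0.
apply: (le_trans (fC _)).
have C0 : 0 <= C.
  by have := le_trans (normr_ge0 _) (fC 0); rewrite pmulr_lge0// expR_gt0.
rewrite -mulrA ler_wpM2l// -expRD ler_expR.
have := sqnD_le (v - a) a; rewrite subrK => H.
have : c * sqn v <= c * (2 * sqn (v - a) + 2 * sqn a) by rewrite ler_wpM2l// ltW.
lra.
Qed.

Lemma measurable_col_mx d (T : measurableType d) m n (f : T -> 'cV[R]_m)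
    (g : T -> 'cV[R]_n) :
  measurable_fun setT f -> measurable_fun setT g ->
  measurable_fun setT (fun x => col_mx (f x) (g x)).
Proof.
move=> mf mg.
exact: (measurableT_comp (@measurable_pair_cV R m n) (measurable_fun_pair mf mg)).
Qed.

Lemma gdom_col_mxr m n (f : 'cV[R]_(m + n) -> R) u : gdom f ->
  gdom (fun v => f (col_mx u v)).
Proof.
move=> [mf [C [c [c0 fC]]]]; split.
  by apply: (measurableT_comp mf); apply: measurable_col_mx.
exists C, c; split => // v; apply: (le_trans (fC _)).
have C0 : 0 <= C.
  by have := le_trans (normr_ge0 _) (fC 0); rewrite pmulr_lge0// expR_gt0.
rewrite ler_wpM2l// ler_expR lerN2 ler_wpM2l ?(ltW c0)// sqn_col_mx lerDr.
exact: sqn_ge0.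
Qed.

Lemma gdom_col_mxl m n (f : 'cV[R]_(m + n) -> R) v : gdom f ->
  gdom (fun u => f (col_mx u v)).
Proof.
move=> [mf [C [c [c0 fC]]]]; split.
  by apply: (measurableT_comp mf); apply: measurable_col_mx.
exists C, c; split => // u; apply: (le_trans (fC _)).
have C0 : 0 <= C.
  by have := le_trans (normr_ge0 _) (fC 0); rewrite pmulr_lge0// expR_gt0.
rewrite ler_wpM2l// ler_expR lerN2 ler_wpM2l ?(ltW c0)// sqn_col_mx lerDl.
exact: sqn_ge0.
Qed.

End gaussian_decay.

Section integral_decay.
Context (R : realType).
Let lam := @lebesgue_measure R.

Lemma integral_exp_sqn n (c : R) : 0 < c ->
  (\int[lebesgue_cV R n]_v (expR (- (c * sqn v)))%:E =
   (((Num.sqrt c)^-1 * Num.sqrt pi) ^+ n)%:E)%E.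
Proof.
move=> c0; elim: n => [|n IH].
  rewrite integral_cV0; first by rewrite /sqn big_ord0 mulr0 oppr0 expR0 expr0.
  apply/measurable_EFinP; have [] := gdom_exp 0 1 c0.
  by under eq_fun do rewrite mul1r.
have m n' : measurable_fun setT (fun v : 'cV[R]_n' => (expR (- (c * sqn v)))%:E).
  apply/measurable_EFinP; have [] := gdom_exp n' 1 c0.
  by under eq_fun do rewrite mul1r.
rewrite integral_cVS//.
transitivity (\int[lam]_x ((expR (- (c * x ^+ 2)))%:E *
   (((Num.sqrt c)^-1 * Num.sqrt pi) ^+ n)%:E)%E)%E.
  apply: eq_integral => x _; rewrite -IH -ge0_integralZl ?lee_fin ?expR_ge0//.
  apply: eq_integral => v _; rewrite -EFinM -expRD; congr (expR _)%:E.
  rewrite /sqn big_ord_recl cons_cV0 mulrDr opprD; congr (_ - c * _).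
  by apply: eq_bigr => i _; rewrite cons_cVS.
rewrite ge0_integralZr//.
  by rewrite integral_gauss_line// -EFinM -exprS.
exact: ((measurable_EFinP _ _).2 (measurable_gauss_line c)).
Qed.

Lemma gdom_integrable n (f : 'cV[R]_n -> R) : gdom f ->
  (lebesgue_cV R n).-integrable setT (EFin \o f).
Proof.
move=> [mf [C [c [c0 fC]]]].
have [mE _] := gdom_exp n C c0.
apply: (@le_integrable _ _ _ _ _ measurableT _
  (EFin \o (fun v : 'cV[R]_n => C * expR (- (c * sqn v))))).
- exact/measurable_EFinP.
- move=> v _ /=; rewrite lee_fin (le_trans (fC v))// ler_norm//.
- apply: (@eq_integrable _ _ _ _ _ measurableT
    (fun v => C%:E * (expR (- (c * sqn v)))%:E)%E) => //.
  apply: integrableZl => //; apply/integrableP; split.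
    apply/measurable_EFinP; have [] := gdom_exp n 1 c0.
    by under eq_fun do rewrite mul1r.
  under eq_integral do rewrite /= ger0_norm ?expR_ge0//.
  by rewrite integral_exp_sqn// ltry.
Qed.

Notation "'\I' f" := (\int[lebesgue_cV R _]_v f v) (at level 10).

Lemma EFin_I n (f : 'cV[R]_n -> R) : gdom f ->
  ((\I f)%:E = \int[lebesgue_cV R n]_v (f v)%:E)%E.
Proof.
move=> gf; rewrite /Rintegral fineK//.
exact: integrable_fin_num (gdom_integrable gf).
Qed.

Lemma I_D n (f g : 'cV[R]_n -> R) : gdom f -> gdom g ->
  \I (fun v => f v + g v) = \I f + \I g.
Proof. by move=> gf gg; rewrite RintegralD//; exact: gdom_integrable. Qed.

Lemma I_B n (f g : 'cV[R]_n -> R) : gdom f -> gdom g ->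
  \I (fun v => f v - g v) = \I f - \I g.
Proof. by move=> gf gg; rewrite RintegralB//; exact: gdom_integrable. Qed.

Lemma I_Z n a (f : 'cV[R]_n -> R) : gdom f ->
  \I (fun v => a * f v) = a * \I f.
Proof. by move=> gf; rewrite RintegralZl//; exact: gdom_integrable. Qed.

Lemma I_0 n : \I (fun _ : 'cV[R]_n => 0) = 0.
Proof. by rewrite /Rintegral integral0. Qed.

Lemma I_sum n (J : Type) (r : seq J) (f : J -> 'cV[R]_n -> R) :
  (forall i, gdom (f i)) ->
  \I (fun v => \sum_(i <- r) f i v) = \sum_(i <- r) \I (f i).
Proof.
move=> gf; elim: r => [|i r IH].
  by rewrite big_nil; under eq_Rintegral do rewrite big_nil; exact: I_0.
rewrite big_cons -IH -I_D//; last exact: gdom_sum.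
by under eq_Rintegral do rewrite big_cons.
Qed.

Lemma eq_I n (f g : 'cV[R]_n -> R) : f =1 g -> \I f = \I g.
Proof. by move=> fg; apply: eq_Rintegral => v _; exact: fg. Qed.

Lemma I_le n (f g : 'cV[R]_n -> R) : gdom f -> gdom g ->
  (forall v, f v <= g v) -> \I f <= \I g.
Proof.
by move=> gf gg fg; apply: le_Rintegral => //; exact: gdom_integrable.
Qed.

Lemma I_ge0 n (f : 'cV[R]_n -> R) : (forall v, 0 <= f v) -> 0 <= \I f.
Proof. by move=> f0; exact: Rintegral_ge0. Qed.

Lemma I_norm_le n (f : 'cV[R]_n -> R) : gdom f -> `|\I f| <= \I (fun v => `|f v|).
Proof. by move=> gf; apply: le_normr_Rintegral => //; exact: gdom_integrable. Qed.

(** Signed functions reduce to the nonnegative case by splitting both sides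
    into positive and negative parts. *)
Lemma I_affine n (B : 'M[R]_n) a (f : 'cV[R]_n -> R) : posdefmx B -> gdom f ->
  \I (fun v => f (affine_mx a B v)) = (\det B)^-1 * \I f.
Proof.
move=> pB gf; have d0 := posdef_det_gt0 pB.
have mf : measurable_fun setT (EFin \o f) by apply/measurable_EFinP; exact: gdom_meas.
have /integrableP[_ iy] := gdom_integrable gf.
rewrite /Rintegral -[X in X * _]/(fine (((\det B)^-1)%:E)) -fineM//; last first.
  exact: integrable_fin_num (gdom_integrable gf).
congr fine; rewrite integralE [in RHS]integralE.
pose fp := (EFin \o f)^\+%E; pose fn := (EFin \o f)^\-%E.
transitivity (\int[lebesgue_cV R n]_v fp (affine_mx a B v) -
   \int[lebesgue_cV R n]_v fn (affine_mx a B v))%E.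
  by congr (_ - _)%E; apply: eq_integral => v _; rewrite /fp /fn ?funeposE ?funenegE.
have fp0 v : (0 <= fp v)%E by exact: funepos_ge0.
have fn0 v : (0 <= fn v)%E by exact: funeneg_ge0.
have mfp : measurable_fun setT fp by exact: measurable_funepos.
have mfn : measurable_fun setT fn by exact: measurable_funeneg.
rewrite !integral_affine//.
have ifin := gdom_integrable gf.
have : (\int[lebesgue_cV R n]_v fp v \is a fin_num)%E.
  rewrite ge0_fin_numE; first exact: integral_funepos_lt_pinfty.
  exact: integral_ge0.
rewrite -/fp -/fn.
move: (integral _ _ fp) (integral _ _ fn) => P N Pfin.
by rewrite muleBr// fin_num_adde_defr.
Qed.

Lemma integralN_cV n (f : 'cV[R]_n -> \bar R) :
  measurable_fun setT f -> (forall x, (0 <= f x)%E) ->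
  (\int[lebesgue_cV R n]_v f (- v)%R = \int[lebesgue_cV R n]_v f v)%E.
Proof.
elim: n f => [|n IH] f mf f0.
  by apply: eq_integral => v _; congr f; apply/colP => -[].
have mN k : measurable_fun setT (fun v : 'cV[R]_k => - v).
  by apply: measurable_oppmx; exact: measurable_id.
rewrite (integral_cVS mf f0).
have -> := @integral_cVS R n (fun v => f (- v))
  (measurableT_comp mf (mN _)) (fun v => f0 _).
pose h (x : measurableTypeR R) := (\int[lebesgue_cV R n]_v f (cons_cV (x, v)))%E.
have mh : measurable_fun setT h.
  apply: (measurable_fun_fubini_tonelli_F (f \o @cons_cV R n)) => [|p].
    exact: (measurableT_comp mf (@measurable_cons_cV R n)).
  exact: f0.
have h0 x : (0 <= h x)%E by apply: integral_ge0 => v _; exact: f0.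
rewrite -[RHS](integralN_line mh h0).
apply: eq_integral => x _.
rewrite -[RHS](IH (fun v => f (cons_cV ((- x)%R, v))))//; last first.
  apply: (measurableT_comp mf); apply: (measurableT_comp (@measurable_cons_cV R n)).
  exact: measurable_pair1.
apply: eq_integral => v _; congr f; apply/colP => i; rewrite mxE.
by case: (unliftP ord0 i) => [k|] ->; rewrite ?cons_cVS ?cons_cV0 ?mxE.
Qed.

Lemma I_opp n (f : 'cV[R]_n -> R) : gdom f -> \I (fun v => f (- v)) = \I f.
Proof.
move=> gf.
have mf : measurable_fun setT (EFin \o f) by apply/measurable_EFinP; exact: gdom_meas.
rewrite /Rintegral; congr fine; rewrite integralE [in RHS]integralE.
congr (_ - _)%E.
  rewrite -[RHS]integralN_cV//; last exact: measurable_funepos.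
  by apply: eq_integral => v _; rewrite !funeposE.
rewrite -[RHS]integralN_cV//; last exact: measurable_funeneg.
by apply: eq_integral => v _; rewrite !funenegE.
Qed.

Lemma I_odd n (f : 'cV[R]_n -> R) : gdom f -> (forall v, f (- v) = - f v) ->
  \I f = 0.
Proof.
move=> gf fo; have := I_opp gf; under eq_Rintegral do rewrite fo.
rewrite (_ : (\int[_]_v _)%R = - \I f); first by move=> ?; lra.
rewrite -mulN1r -I_Z//; by apply: eq_I => v; rewrite mulN1r.
Qed.

Section fubini.
Context (m n : nat) (f : 'cV[R]_(m + n) -> R).
Hypothesis gf : gdom f.

Let lmn := (lebesgue_cV R m \x lebesgue_cV R n)%E.

Let mf : measurable_fun setT (EFin \o f).
Proof. by apply/measurable_EFinP; exact: gdom_meas. Qed.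

Lemma lebesgue_cVD A : measurable A ->
  lebesgue_cV R (m + n) A = image_measure lmn (@pair_cV R m n) A.
Proof.
move=> mA.
transitivity (\int[lebesgue_cV R (m + n)]_v (\1_A v : R)%:E)%E.
  by rewrite integral_indic// setIT.
transitivity (\int[image_measure lmn (@pair_cV R m n)]_v (\1_A v : R)%:E)%E; last first.
  by rewrite integral_indic// setIT.
have mi : measurable_fun setT (fun v : 'cV[R]_(m + n) => (\1_A v : R)%:E).
  by apply: ((measurable_EFinP _ (\1_A : _ -> R)).2 _); exact: measurable_indic.
rewrite integral_col_mx// [RHS]ge0_integral_pushforward//.
rewrite preimage_setT fubini_tonelli1//.
  exact: (measurableT_comp mi (@measurable_pair_cV R m n)).
by move=> p; rewrite /= lee_fin.
Qed.

Let gu : gdom (fun u => \I (fun v => f (col_mx u v))).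
Proof.
have [_ [C [c [c0 fC]]]] := gf.
split; last first.
  exists (C * \I (fun v : 'cV[R]_n => 1 * expR (- (c * sqn v)))), c; split => // u.
  have g1 := gdom_exp n 1 c0.
  apply: (le_trans (I_norm_le (gdom_col_mxr u gf))).
  rewrite -mulrA (mulrC _ (expR _)) mulrA -I_Z//; apply: I_le => [||v].
  - exact/gdom_norm/gdom_col_mxr.
  - exact: gdomZ.
  - apply: (le_trans (fC _)).
    by rewrite mul1r sqn_col_mx mulrDr opprD expRD mulrA.
have mp : measurable_fun setT ((EFin \o f) \o @pair_cV R m n).
  exact: (measurableT_comp mf (@measurable_pair_cV R m n)).
apply: measurableT_comp => //.
have -> : (fun u => \int[lebesgue_cV R n]_v (f (col_mx u v))%:E)%E =
  (fun u => (\int[lebesgue_cV R n]_v ((EFin \o f) \o @pair_cV R m n)^\+ (u, v) -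
   \int[lebesgue_cV R n]_v ((EFin \o f) \o @pair_cV R m n)^\- (u, v))%E).
  apply/funext => u; rewrite integralE.
  by congr (_ - _)%E; apply: eq_integral => v _; rewrite ?funeposE ?funenegE.
apply: emeasurable_funB.
  by apply: measurable_fun_fubini_tonelli_F => //; exact: measurable_funepos.
by apply: measurable_fun_fubini_tonelli_F => //; exact: measurable_funeneg.
Qed.

Lemma gdom_I_col_mx : gdom (fun u => \I (fun v => f (col_mx u v))).
Proof. exact: gu. Qed.

Lemma I_col_mx : \I f = \I (fun u => \I (fun v => f (col_mx u v))).
Proof.
have mp : measurable_fun setT ((EFin \o f) \o @pair_cV R m n).
  exact: (measurableT_comp mf (@measurable_pair_cV R m n)).
have ip : lmn.-integrable setT ((EFin \o f) \o @pair_cV R m n).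
  apply/integrableP; split => //.
  have /integrableP[_] := gdom_integrable gf.
  rewrite (eq_measure_integral (image_measure lmn (@pair_cV R m n))); last first.
    by move=> A mA _; exact: lebesgue_cVD.
  rewrite ge0_integral_pushforward//; last exact: measurableT_comp.
apply: EFin_inj; rewrite EFin_I// (EFin_I gu).
rewrite (eq_measure_integral (image_measure lmn (@pair_cV R m n))); last first.
  by move=> A mA _; exact: lebesgue_cVD.
rewrite [LHS]integral_pushforward// preimage_setT.
rewrite -[LHS]integral12_prod_meas1//; apply: eq_integral => u _.
by rewrite EFin_I//; exact: gdom_col_mxr.
Qed.

End fubini.

End integral_decay.
Notation "'\I' f" := (\int[lebesgue_cV _ _]_v f v) (at level 10) : ring_scope.

(** * The standard Gaussian *)

Section standard_gaussian.
Context (R : realType).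

Definition stdg n (z : 'cV[R]_n) : R :=
  (Num.sqrt ((2 * pi) ^+ n))^-1 * expR (- (2^-1 * sqn z)).

Lemma stdg_ge0 n (z : 'cV[R]_n) : 0 <= stdg z.
Proof. by rewrite mulr_ge0 ?invr_ge0 ?sqrtr_ge0 ?expR_ge0. Qed.

Lemma gdom_stdg n : gdom (@stdg n).
Proof. by apply: gdom_exp; rewrite invr_gt0. Qed.

Lemma sqrtrX (x : R) n : 0 <= x -> Num.sqrt (x ^+ n) = Num.sqrt x ^+ n.
Proof.
move=> x0; elim: n => [|n IH]; first by rewrite !expr0 sqrtr1.
by rewrite !exprS sqrtrM// IH.
Qed.

Lemma tau_gt0 : 0 < 2 * pi :> R.
Proof. by rewrite mulr_gt0// pi_gt0. Qed.

Lemma I_exp_sqn n (c : R) : 0 < c ->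
  \I (fun v : 'cV[R]_n => expR (- (c * sqn v))) =
  ((Num.sqrt c)^-1 * Num.sqrt pi) ^+ n.
Proof. by move=> c0; rewrite /Rintegral integral_exp_sqn. Qed.

Lemma gdom_expR n (c : R) : 0 < c -> gdom (fun v : 'cV[R]_n => expR (- (c * sqn v))).
Proof.
by move=> c0; have := gdom_exp n 1 c0; under eq_fun do rewrite mul1r.
Qed.

Lemma I_stdg n : \I (@stdg n) = 1.
Proof.
have h0 : 0 < 2^-1 :> R by rewrite invr_gt0.
rewrite /stdg I_Z; last exact: gdom_expR.
rewrite I_exp_sqn// sqrtrX; last exact: ltW tau_gt0.
rewrite sqrtrM// sqrtrV// invrK -exprVn -exprMn mulVf ?expr1n//.
by rewrite mulf_neq0// ?gt_eqF// sqrtr_gt0// pi_gt0.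
Qed.

Lemma stdg_col_mx m n (u : 'cV[R]_m) (v : 'cV[R]_n) :
  stdg (col_mx u v) = stdg u * stdg v.
Proof.
rewrite /stdg sqn_col_mx.
have -> : - (2^-1 * (sqn u + sqn v)) = - (2^-1 * sqn u) + - (2^-1 * sqn v) by ring.
rewrite expRD exprD sqrtrM; last first.
  by rewrite exprn_ge0// ltW// tau_gt0.
by rewrite invfM; ring.
Qed.

Lemma stdgN n (z : 'cV[R]_n) : stdg (- z) = stdg z.
Proof. by rewrite /stdg sqnN. Qed.

(** Comparing the Gaussian weights of two scales through
    [1 - exp (- t) <= t] brackets the second moment, whatever the sign of the
    exponent; letting the scale tend to 1 pins it down. *)
Lemma I_sqn_gauss1 :
  \I (fun v : 'cV[R]_1 => sqn v * expR (- (2^-1 * sqn v))) = Num.sqrt (2 * pi).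
Proof.
set J := \I _; set k := Num.sqrt _.
have h0 : 0 < 2^-1 :> R by rewrite invr_gt0.
have k0 : 0 < k by rewrite sqrtr_gt0 tau_gt0.
have gJ : gdom (fun v : 'cV[R]_1 => sqn v * expR (- (2^-1 * sqn v))).
  apply: (gdomM_weight (A := 1)); [exact: measurable_sqn| |exact: gdom_expR].
  by move=> v; rewrite mul1r ger0_norm ?sqn_ge0// lerDr.
have Is s : 0 < s -> \I (fun v : 'cV[R]_1 => expR (- (s ^- 2 / 2 * sqn v))) = s * k.
  move=> s0; rewrite I_exp_sqn ?divr_gt0 ?invr_gt0 ?exprn_gt0// expr1.
  have s20 : 0 <= s ^- 2 by rewrite invr_ge0 exprn_ge0// ltW.
  rewrite /k sqrtrM// sqrtrM// !sqrtrV ?exprn_ge0 ?(ltW s0)// sqrtr_sqr.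
  by rewrite ger0_norm ?(ltW s0)// invfM !invrK mulrA.
have key s : 0 < s -> (1 - s) * k <= (s ^- 2 - 1) / 2 * J.
  move=> s0; have -> : (1 - s) * k = 1 * k - s * k by ring.
  rewrite -(Is 1)// -(Is s)// expr1n invr1 !mul1r.
  have c0 : 0 < s ^- 2 / 2 by rewrite divr_gt0 ?invr_gt0 ?exprn_gt0.
  rewrite -I_B; try exact: gdom_expR.
  rewrite -I_Z//; apply: I_le => [||v].
  - by apply: gdomB; exact: gdom_expR.
  - exact: gdomZ.
  - set t := (s ^- 2 - 1) / 2 * sqn v.
    have -> : - (s ^- 2 / 2 * sqn v) = - (2^-1 * sqn v) + - t by rewrite /t; field; rewrite gt_eqF.
    rewrite expRD; set e := expR (- (2^-1 * sqn v)).
    have -> : (s ^- 2 - 1) / 2 * (sqn v * e) = t * e by rewrite /t; ring.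
    have -> : e - e * expR (- t) = (1 - expR (- t)) * e by ring.
    by rewrite ler_wpM2r ?expR_ge0//; have := expR_ge1Dx (- t); lra.
apply/eqP; rewrite eq_le; apply/andP; split.
  apply/ler_addgt0Pr => e e0.
  pose d := Num.min 1 (e / (3 * k)).
  have d0 : 0 < d by rewrite lt_min ltr01/= divr_gt0// mulr_gt0.
  have d1 : d <= 1 by rewrite ge_min lexx.
  have de : 3 * k * d <= e.
    by rewrite mulrC -ler_pdivlMr ?mulr_gt0// ge_min lexx orbT.
  have s0 : 0 < 1 + d by lra.
  have := key _ s0.
  have -> : ((1 + d) ^- 2 - 1) / 2 * J = - (d * (2 + d) / (2 * (1 + d) ^+ 2) * J).
    by field; rewrite gt_eqF.
  rewrite (_ : (1 - (1 + d)) * k = - (d * k)); last by ring.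
  rewrite lerN2 => H.
  have {}H : (2 + d) * J <= 2 * (1 + d) ^+ 2 * k.
    have E : d * (2 + d) / (2 * (1 + d) ^+ 2) * J =
       d / (2 * (1 + d) ^+ 2) * ((2 + d) * J) by field; rewrite gt_eqF.
    rewrite E in H.
    have dp : 0 < d / (2 * (1 + d) ^+ 2) by rewrite divr_gt0// mulr_gt0// exprn_gt0.
    rewrite -(ler_pM2l dp); apply: le_trans H _.
    by rewrite le_eqVlt; apply/orP; left; apply/eqP; field; rewrite gt_eqF.
  have : (2 + d) * J <= (2 + d) * (k + e).
    apply: le_trans H _.
    have : d * (3 * k * d) <= d * e by rewrite ler_wpM2l// ltW.
    have : 0 <= k * d * (1 - d) by rewrite !mulr_ge0 ?subr_ge0// ltW.
    by nra.
  by rewrite ler_pM2l//; lra.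
apply/ler_addgt0Pr => e e0.
pose d := Num.min 2^-1 (e / (2 * k)).
have d0 : 0 < d by rewrite lt_min h0/= divr_gt0// mulr_gt0.
have d1 : d <= 2^-1 by rewrite ge_min lexx.
have de : 2 * k * d <= e.
  by rewrite mulrC -ler_pdivlMr ?mulr_gt0// ge_min lexx orbT.
have s0 : 0 < 1 - d by lra.
have := key _ s0.
have -> : ((1 - d) ^- 2 - 1) / 2 * J = d * (2 - d) / (2 * (1 - d) ^+ 2) * J.
  by field; rewrite gt_eqF.
rewrite (_ : (1 - (1 - d)) * k = d * k); last by ring.
move=> H.
have {}H : 2 * (1 - d) ^+ 2 * k <= (2 - d) * J.
  have E : d * (2 - d) / (2 * (1 - d) ^+ 2) * J =
     d / (2 * (1 - d) ^+ 2) * ((2 - d) * J) by field; rewrite gt_eqF.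
  rewrite E in H.
  have dp : 0 < d / (2 * (1 - d) ^+ 2) by rewrite divr_gt0// mulr_gt0// exprn_gt0.
  rewrite -(ler_pM2l dp); apply: le_trans H.
  by rewrite le_eqVlt; apply/orP; left; apply/eqP; field; rewrite gt_eqF.
have : (2 - d) * k <= (2 - d) * (J + e).
  rewrite mulrDr; apply: le_trans (lerD H (lexx _)).
  have : (2 - d) * (2 * k * d) <= (2 - d) * e by rewrite ler_wpM2l//; lra.
  have : 0 <= k * d * (1 - d) by rewrite mulr_ge0 ?mulr_ge0 ?(ltW s0) ?(ltW k0) ?(ltW d0).
  by nra.
by rewrite ler_pM2l//; lra.
Qed.

Lemma I_stdg1_sqr : \I (fun u : 'cV[R]_1 => u ord0 ord0 * u ord0 ord0 * stdg u) = 1.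
Proof.
have k0 : Num.sqrt (2 * pi) != 0 :> R by rewrite gt_eqF// sqrtr_gt0 tau_gt0.
rewrite (eq_I (g := fun u => (Num.sqrt (2 * pi))^-1 *
    (sqn u * expR (- (2^-1 * sqn u))))).
  rewrite I_Z ?I_sqn_gauss1 ?mulVf//.
  apply: (gdomM_weight (A := 1)); [exact: measurable_sqn| |].
    by move=> v; rewrite mul1r ger0_norm ?sqn_ge0// lerDr.
  by apply: gdom_expR; rewrite invr_gt0.
move=> u; rewrite /stdg expr1 {2}/sqn big_ord1 -expr2; ring.
Qed.

Lemma gdom_stdg_coord n i : gdom (fun z : 'cV[R]_n => z i ord0 * stdg z).
Proof. exact/gdomM_coord/gdom_stdg. Qed.

Lemma gdom_stdg_coord2 n i j :
  gdom (fun z : 'cV[R]_n => z i ord0 * z j ord0 * stdg z).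
Proof.
under eq_fun do rewrite -mulrA.
exact/gdomM_coord/gdom_stdg_coord.
Qed.

Lemma I_stdg_coord n i : \I (fun z : 'cV[R]_n => z i ord0 * stdg z) = 0.
Proof.
apply: I_odd => [|v]; first exact: gdom_stdg_coord.
by rewrite stdgN mxE mulNr.
Qed.

Lemma I_stdg_coord2 n i j :
  \I (fun z : 'cV[R]_n => z i ord0 * z j ord0 * stdg z) = (i == j)%:R.
Proof.
elim: n i j => [[]//|n IH] i j.
have Eu (u : 'cV[R]_1) (v : 'cV[R]_n) (k : 'I_1) :
    (col_mx u v : 'cV_n.+1) (lshift n k : 'I_(1 + n)) ord0 = u k ord0 := col_mxEu u v k ord0.
have Ed (u : 'cV[R]_1) (v : 'cV[R]_n) (k : 'I_n) :
    (col_mx u v : 'cV_n.+1) (rshift 1 k : 'I_(1 + n)) ord0 = v k ord0 := col_mxEd u v k ord0.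
rewrite (@I_col_mx R 1 n); last exact: gdom_stdg_coord2.
case: (@split_ordP 1 n i) => i' -> ; case: (@split_ordP 1 n j) => j' ->.
- rewrite !ord1 eqxx mulr1n -[RHS]I_stdg1_sqr; apply: eq_I => u.
  under eq_Rintegral do rewrite Eu (@stdg_col_mx 1 n) mulrA.
  rewrite I_Z; last exact: gdom_stdg.
  by rewrite I_stdg mulr1.
- rewrite (eq_I (g := fun=> 0)).
    by rewrite I_0 (_ : (_ == _) = false)//; apply/negbTE/eqP => /(congr1 val); rewrite /= (ord1 i').
  move=> u.
  under eq_Rintegral => v _.
    rewrite Eu Ed (@stdg_col_mx 1 n)
      (_ : _ * _ = (u i' ord0 * stdg u) * (v j' ord0 * stdg v)); last by ring.
    over.
  by rewrite I_Z ?I_stdg_coord ?mulr0//; exact: gdom_stdg_coord.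
- rewrite (eq_I (g := fun=> 0)).
    by rewrite I_0 (_ : (_ == _) = false)//; apply/negbTE/eqP => /(congr1 val); rewrite /= (ord1 j').
  move=> u.
  under eq_Rintegral => v _.
    rewrite Eu Ed (@stdg_col_mx 1 n)
      (_ : _ * _ = (u j' ord0 * stdg u) * (v i' ord0 * stdg v)); last by ring.
    over.
  by rewrite I_Z ?I_stdg_coord ?mulr0//; exact: gdom_stdg_coord.
- rewrite (eq_I (g := fun u => (i' == j')%:R * stdg u)).
    rewrite I_Z ?I_stdg ?mulr1; last exact: gdom_stdg.
    by rewrite (inj_eq (@rshift_inj 1 n)).
  move=> u.
  under eq_Rintegral => v _.
    rewrite !Ed (@stdg_col_mx 1 n)
      (_ : _ * _ = stdg u * (v i' ord0 * v j' ord0 * stdg v)); last by ring.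
    over.
  by rewrite I_Z ?IH 1?mulrC//; exact: gdom_stdg_coord2.
Qed.

End standard_gaussian.

(** * Gaussian densities, uniformly in their parameters *)

Section gauss_pdf_theory.
Context (R : realType).

Lemma gauss_pdfE n (S : 'M[R]_n) v : posdefmx S -> gauss_pdf S v =
  (Num.sqrt ((2 * pi) ^+ n * \det S))^-1 * expR (- (2^-1 * qform (invmx S) v)).
Proof. by move=> pS; rewrite /gauss_pdf wnorm_sqr. Qed.

Lemma gauss_pdf_ge0 n (S : 'M[R]_n) v : 0 <= gauss_pdf S v.
Proof. by rewrite mulr_ge0 ?invr_ge0 ?sqrtr_ge0 ?expR_ge0. Qed.

Lemma measurable_gauss_pdf n (S : 'M[R]_n) : posdefmx S ->
  measurable_fun setT (gauss_pdf S).
Proof.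
move=> pS; rewrite (_ : gauss_pdf S = fun v =>
  (Num.sqrt ((2 * pi) ^+ n * \det S))^-1 * expR (- (2^-1 * qform (invmx S) v))).
  apply: measurable_funM => //; apply: measurableT_comp => //.
  apply: measurableT_comp => //; apply: measurable_funM => //.
  exact: measurable_qform.
by apply/funext => v; rewrite gauss_pdfE.
Qed.

Section uniform_estimates.
Context (n : nat) (lam M : R).
Hypotheses (lam0 : 0 < lam) (M0 : 0 < M).

(** The lower bound of the inverse form divided by 8: a factor 2 is the one in the
    exponent, another is lost in moving the mean to the origin, and the last one
    is kept for absorbing a quadratic weight. *)
Definition decay : R := lam / (1 + n%:R * n%:R * M ^+ 2) / 8.

Lemma decay_gt0 : 0 < decay.
Proof.
by rewrite !divr_gt0// ltr_pwDl// mulr_ge0 ?sqr_ge0 ?mulr_ge0.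
Qed.

(** A bound on the normalising constants of the class, by the Leibniz formula for
    the determinant of the inverse. *)
Definition peak : R := Num.sqrt ((n`!)%:R * lam^-1 ^+ n).

Lemma peak_gt0 : 0 < peak.
Proof.
by rewrite sqrtr_gt0 mulr_gt0 ?ltr0n ?fact_gt0// exprn_gt0// invr_gt0.
Qed.

Lemma tau_ge1 : 1 <= 2 * pi :> R.
Proof. by have := pi_ge2 R; lra. Qed.

Lemma gauss_const_le (S : 'M[R]_n) : elliptic lam M S ->
  (Num.sqrt ((2 * pi) ^+ n * \det S))^-1 <= peak.
Proof.
move=> eS; have d0 := posdef_det_gt0 (elliptic_posdef lam0 eS).
have H := elliptic_det_ge lam0 eS.
have c0 : 0 < (n`!)%:R * lam^-1 ^+ n :> R.
  by rewrite mulr_gt0 ?ltr0n ?fact_gt0// exprn_gt0// invr_gt0.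
rewrite -[leRHS]invrK lef_pV2 ?posrE ?invr_gt0 ?sqrtr_gt0//; last first.
  by rewrite mulr_gt0// exprn_gt0// tau_gt0.
rewrite /peak -sqrtrV ?(ltW c0)// ler_sqrt; last first.
  by rewrite ltW// mulr_gt0// exprn_gt0// tau_gt0.
apply: (le_trans H); rewrite ler_peMl ?(ltW d0)//.
by rewrite exprn_ege1// tau_ge1.
Qed.

Lemma gauss_exponent_ge (S : 'M[R]_n) a x : elliptic lam M S ->
  2 * decay * sqn x - 4 * decay * sqn a <= 2^-1 * qform (invmx S) (x - a).
Proof.
move=> eS; have := qform_invmx_ge lam0 (x - a) eS.
have := sqnD_le (x - a) a; rewrite subrK.
have -> : lam / (1 + n%:R * n%:R * M ^+ 2) = 8 * decay.
  by rewrite /decay [RHS]mulrC divfK// pnatr_eq0.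
have d0 := decay_gt0.
move=> H1 H2.
have : decay * sqn x <= decay * (2 * sqn (x - a) + 2 * sqn a).
  by rewrite ler_wpM2l// ltW.
lra.
Qed.

Lemma gauss_pdf_ub (S : 'M[R]_n) a x : elliptic lam M S ->
  gauss_pdf S (x - a) <=
  peak * expR (4 * decay * sqn a) * expR (- (2 * decay * sqn x)).
Proof.
move=> eS; rewrite gauss_pdfE; last exact: elliptic_posdef eS.
rewrite -mulrA -expRD ler_pM ?expR_ge0 ?gauss_const_le//.
by rewrite ler_expR; have := gauss_exponent_ge a x eS; lra.
Qed.

Lemma gauss_pdf_le_peak (S : 'M[R]_n) x : elliptic lam M S ->
  gauss_pdf S x <= peak.
Proof.
move=> eS; rewrite gauss_pdfE; last exact: elliptic_posdef eS.
rewrite -[leRHS]mulr1 ler_pM ?expR_ge0 ?gauss_const_le//.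
rewrite expR_le1 oppr_le0; have := gauss_exponent_ge 0 x eS.
rewrite subr0 (_ : sqn 0 = 0); last by apply/eqP; rewrite sqn_eq0.
have : 0 <= 2 * decay * sqn x by rewrite mulr_ge0 ?sqn_ge0// mulr_ge0// ltW// decay_gt0.
by lra.
Qed.

Lemma gauss_pdf_lb : exists c b : R, [/\ 0 < c, 0 < b &
  forall (S : 'M[R]_n) x, elliptic lam M S -> c * expR (- (b * sqn x)) <= gauss_pdf S x].
Proof.
pose k := (1 + lam^-1 ^+ 2) / 2.
have k0 : 0 < k by rewrite divr_gt0// ltr_pwDl// sqr_ge0.
have t0 : 0 < (2 * pi) ^+ n :> R by rewrite exprn_gt0// tau_gt0.
have nM : 0 < (n`!)%:R * M ^+ n :> R.
  by rewrite mulr_gt0 ?exprn_gt0// ltr0n fact_gt0.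
exists (Num.sqrt ((2 * pi) ^+ n * ((n`!)%:R * M ^+ n)))^-1, (2^-1 * k); split.
- by rewrite invr_gt0 sqrtr_gt0 mulr_gt0.
- by rewrite mulr_gt0// invr_gt0.
move=> S x eS; rewrite gauss_pdfE; last exact: elliptic_posdef eS.
have d0 := posdef_det_gt0 (elliptic_posdef lam0 eS).
apply: ler_pM; rewrite ?expR_ge0//.
  rewrite lef_pV2 ?posrE ?sqrtr_gt0; last 2 first.
  - exact: mulr_gt0.
  - exact: mulr_gt0.
  rewrite ler_sqrt ?ler_pM2l//; last by rewrite ltW// mulr_gt0.
  have [_ _ SM] := eS; apply: le_trans (det_le SM); exact: ler_norm.
rewrite ler_expR lerN2 -mulrA ler_pM2l ?invr_gt0//.
exact: (qform_invmx_le lam0 x eS).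
Qed.

Lemma expR_diff_le (x y : R) :
  `|expR (- x) - expR (- y)| <= `|x - y| * (expR (- x) + expR (- y)).
Proof.
wlog xy : x y / x <= y.
  move=> H; have [/H//|/ltW/H] := leP x y.
  by rewrite distrC (distrC y) (addrC (expR (- y))).
rewrite ger0_norm ?subr_ge0 ?ler_expR ?lerN2// ler0_norm ?subr_le0// opprB.
have -> : expR (- y) = expR (- x) * expR (- (y - x)) by rewrite -expRD; congr expR; ring.
have f1 := expR_ge1Dx (- (y - x)); have e0 := expR_gt0 (- x).
have f0 := expR_gt0 (- (y - x)).
move: f1 e0 f0; set e := expR (- x); set f := expR (- (y - x)) => f1 e0 f0.
have d0 : 0 <= y - x by rewrite subr_ge0.
have h : (1 - f) * e <= (y - x) * e by rewrite ler_wpM2r ?(ltW e0)//; lra.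
have m : 0 <= (y - x) * (e * f) by rewrite mulr_ge0// mulr_ge0// ltW.
have -> : (y - x) * (e + e * f) = (y - x) * e + (y - x) * (e * f) by ring.
by have -> : e - e * f = (1 - f) * e; [ring|lra].
Qed.

Lemma qform_shift_lip (S : 'M[R]_n) x a1 a2 (r e : R) : elliptic lam M S -> 0 <= e ->
  sqn a1 <= r -> sqn a2 <= r -> (forall i, `|a1 i ord0 - a2 i ord0| <= e) ->
  `|qform (invmx S) (x - a1) - qform (invmx S) (x - a2)| <=
  e * (n%:R + lam^-1 ^+ 2 * (8 * sqn x + 8 * r)).
Proof.
move=> eS e0 r1 r2 a12; have [ST _ _] := eS.
have TT : (invmx S)^T = invmx S by rewrite trmx_inv ST.
set T := invmx S in TT *.
set w := T *m (2 *: x - (a1 + a2)).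
have -> : qform T (x - a1) - qform T (x - a2) = dotv (a2 - a1) w.
  rewrite /w; have -> : 2 *: x - (a1 + a2) = (x - a1) + (x - a2).
    by apply/colP => i; rewrite !mxE; ring.
  have -> : a2 - a1 = (x - a1) - (x - a2) by apply/colP => i; rewrite !mxE; ring.
  rewrite mulmxDr dotvDr !(dotvBl (x - a1) (x - a2)) !qformE.
  by rewrite (dotv_mulmx (x - a1) T (x - a2)) TT (dotvC _ (x - a2)); ring.
have sw : sqn w <= lam^-1 ^+ 2 * (8 * sqn x + 8 * r).
  apply: (le_trans (sqn_invmx_le lam0 _ eS)); apply: ler_wpM2l; first exact: sqr_ge0.
  apply: (le_trans (sqnB_le _ _)); rewrite sqnZ.
  have := sqnD_le a1 a2; move: r1 r2.
  by move: (sqn a1) (sqn a2) (sqn (a1 + a2)) (sqn x) => ? ? ? ? ? ? ?; lra.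
apply: (@le_trans _ _ (e * (n%:R + sqn w))); last by rewrite ler_wpM2l// lerD2l.
rewrite /dotv; apply: (le_trans (ler_norm_sum _ _ _)).
have -> : e * (n%:R + sqn w) = \sum_(i < n) e * (1 + w i ord0 ^+ 2).
  by rewrite -mulr_sumr big_split/= sumr_const card_ord.
apply: ler_sum => i _; rewrite normrM ler_pM//.
  by rewrite !mxE distrC a12.
rewrite ler_norml; apply/andP; split.
  by have := sqr_ge0 (w i ord0 + 1); nra.
by have := sqr_ge0 (w i ord0 - 1); nra.
Qed.

Lemma gauss_const_lip : exists2 C : R, 0 <= C & forall (S1 S2 : 'M[R]_n) (e : R),
  elliptic lam M S1 -> elliptic lam M S2 ->
  (forall i j, `|S1 i j - S2 i j| <= e) ->
  `|(Num.sqrt ((2 * pi) ^+ n * \det S1))^-1 -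
    (Num.sqrt ((2 * pi) ^+ n * \det S2))^-1| <= C * e.
Proof.
have t0 : 0 < (2 * pi) ^+ n :> R by rewrite exprn_gt0// tau_gt0.
pose c := (2 * pi) ^+ n * ((n`!)%:R * lam^-1 ^+ n)^-1.
have c0 : 0 < c.
  by rewrite mulr_gt0// invr_gt0 mulr_gt0 ?ltr0n ?fact_gt0// exprn_gt0// invr_gt0.
pose L := (n`!)%:R * (n%:R * (M + 1) ^+ n).
have L0 : 0 <= L by rewrite !mulr_ge0// exprn_ge0// addr_ge0// ltW.
exists ((Num.sqrt c ^+ 3)^-1 * ((2 * pi) ^+ n * L)).
  by rewrite mulr_ge0 ?invr_ge0 ?exprn_ge0 ?sqrtr_ge0// mulr_ge0// ltW.
move=> S1 S2 e e1 e2 S12.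
have cd (S : 'M[R]_n) : elliptic lam M S -> c <= (2 * pi) ^+ n * \det S.
  by move=> eS; rewrite /c ler_pM2l//; exact: elliptic_det_ge lam0 eS.
apply: (le_trans (isqrt_lip c0 (cd _ e1) (cd _ e2))).
rewrite -mulrA ler_wpM2l ?invr_ge0 ?exprn_ge0 ?sqrtr_ge0//.
rewrite -mulrBr normrM gtr0_norm// -mulrA ler_pM2l//.
have [_ _ M1] := e1; have [_ _ M2] := e2.
apply: det_lip => //; first by rewrite lerDr ltW.
  by move=> i j; apply: (le_trans (M1 i j)); rewrite lerDl.
by move=> i j; apply: (le_trans (M2 i j)); rewrite lerDl.
Qed.

(** The derivatives of a Gaussian density with respect to its parameters grow
    quadratically; half of the rate [2 * decay] of the density absorbs that. *)
Lemma gauss_pdf_lip (r : R) : 0 <= r -> exists2 L : R, 0 <= L & forall (S1 S2 : 'M[R]_n) a1 a2 (e : R),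
  elliptic lam M S1 -> elliptic lam M S2 -> 0 <= e ->
  sqn a1 <= r -> sqn a2 <= r ->
  (forall i j, `|S1 i j - S2 i j| <= e) ->
  (forall i, `|a1 i ord0 - a2 i ord0| <= e) ->
  forall x, `|gauss_pdf S1 (x - a1) - gauss_pdf S2 (x - a2)| <=
    L * e * expR (- (decay * sqn x)).
Proof.
move=> r0; have [C C0 HC] := gauss_const_lip.
have dc0 := decay_gt0; have p0 := peak_gt0.
have d4 : 0 <= 4 * decay by rewrite mulr_ge0// ltW.
have d2 : 0 < 2 * decay by rewrite mulr_gt0.
have d22 : 0 <= 1 + 2 / (2 * decay) by rewrite addr_ge0// divr_ge0// ltW.
pose K := expR (4 * decay * r).
pose l2 := lam^-1 ^+ 2; have l20 : 0 <= l2 by exact: sqr_ge0.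
pose D := n%:R * l2 * (1 + r) + n%:R + l2 * (8 + 8 * r).
have r8 : 0 <= 8 + 8 * r by rewrite addr_ge0// mulr_ge0.
have D0 : 0 <= D.
  apply: addr_ge0; last exact: mulr_ge0.
  by apply: addr_ge0 => //; apply: mulr_ge0; [exact: mulr_ge0|exact: addr_ge0].
have K0 : 0 < K by exact: expR_gt0.
exists (C * K + peak * (D * (2 * K) * (1 + 2 / (2 * decay)))).
  apply: addr_ge0; first by rewrite mulr_ge0// ltW.
  apply: mulr_ge0; first exact: ltW.
  by apply: mulr_ge0 => //; apply: mulr_ge0 => //; rewrite mulr_ge0// ltW.
move=> S1 S2 a1 a2 e e1 e2 e0 r1 r2 S12 a12 x.
rewrite !gauss_pdfE; [|exact: elliptic_posdef e2|exact: elliptic_posdef e1].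
have sx := sqn_ge0 x; set t := sqn x in sx *.
pose E := expR (- (2 * decay * t)).
have E0 : 0 < E by exact: expR_gt0.
have EK (S : 'M[R]_n) a : elliptic lam M S -> sqn a <= r ->
    expR (- (2^-1 * qform (invmx S) (x - a))) <= K * E.
  move=> eS ar; rewrite /K /E -expRD ler_expR.
  have := gauss_exponent_ge a x eS; rewrite -/t.
  have : 4 * decay * sqn a <= 4 * decay * r by rewrite ler_wpM2l.
  by lra.
have EE : E <= expR (- (decay * t)).
  by rewrite ler_expR lerN2 ler_wpM2r//; lra.
have EW : (1 + t) * E <= (1 + 2 / (2 * decay)) * expR (- (decay * t)).
  have := expR_weight_le d2 sx; rewrite -/E.
  by rewrite (_ : 2 * decay / 2 = decay)//; field.
have qd : `|2^-1 * qform (invmx S1) (x - a1) - 2^-1 * qform (invmx S2) (x - a2)| <=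
    e * (D * (1 + t)).
  have h1 := qform_invmx_lip lam0 (x - a1) e0 e1 e2 S12.
  have h2 := qform_shift_lip x e2 e0 r1 r2 a12.
  have h3 : sqn (x - a1) <= 2 * t + 2 * r.
    by apply: (le_trans (sqnB_le _ _)); rewrite lerD2l; lra.
  rewrite -mulrBr normrM (gtr0_norm (_ : 0 < 2^-1)) ?invr_gt0//.
  have h4 : e * (n%:R * l2 * sqn (x - a1)) <= e * (n%:R * l2 * (2 * t + 2 * r)).
    by rewrite ler_wpM2l// ler_wpM2l// mulr_ge0.
  have h5 : e * (n%:R * l2 * (2 * t + 2 * r)) +
     e * (n%:R + l2 * (8 * t + 8 * r)) <= 2 * (e * (D * (1 + t))).
    rewrite -mulrDr (mulrCA 2) ler_wpM2l//.
    have n0 : 0 <= n%:R :> R by [].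
    have m0 := mulr_ge0 r0 sx; have m4 := mulr_ge0 n0 l20.
    have m1 := mulr_ge0 m4 m0; have m2 := mulr_ge0 l20 m0.
    have m3 := mulr_ge0 n0 sx; have m5 := mulr_ge0 l20 sx.
    have m6 := mulr_ge0 l20 r0.
    have -> : 2 * (D * (1 + t)) = n%:R * l2 * (2 * t + 2 * r) +
      (n%:R + l2 * (8 * t + 8 * r)) + (2 * (n%:R * l2) + 2 * (n%:R * l2 * (r * t)) + n%:R
      + 2 * (n%:R * t) + 16 * l2 + 8 * (l2 * t) + 8 * (l2 * r) + 16 * (l2 * (r * t))).
      by rewrite /D; ring.
    by rewrite lerDl; lra.
  rewrite -/l2 in h1 h2; rewrite -/t in h2.
  have := ler_distD (qform (invmx S2) (x - a1)) (qform (invmx S1) (x - a1))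
    (qform (invmx S2) (x - a2)).
  by lra.
set q1 := 2^-1 * _ in qd *; set q2 := 2^-1 * _ in qd *.
set k1 := (Num.sqrt _)^-1; set k2 := (Num.sqrt _)^-1.
have -> : k1 * expR (- q1) - k2 * expR (- q2) =
  (k1 - k2) * expR (- q1) + k2 * (expR (- q1) - expR (- q2)) by ring.
apply: (le_trans (ler_normD _ _)); rewrite !normrM (ger0_norm (expR_ge0 _)).
have k20 : 0 <= k2 by rewrite invr_ge0 sqrtr_ge0.
rewrite (ger0_norm k20) mulrDl mulrDl; apply: lerD.
  have h1 : `|k1 - k2| * expR (- q1) <= (C * e) * (K * E).
    by apply: ler_pM; rewrite ?expR_ge0 ?HC ?EK.
  apply: (le_trans h1).
  have -> : C * e * (K * E) = C * K * e * E by ring.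
  by rewrite ler_wpM2l// !mulr_ge0// ltW.
have h2 : expR (- q1) + expR (- q2) <= 2 * K * E.
  by have := EK _ _ e1 r1; have := EK _ _ e2 r2; rewrite -/q1 -/q2; lra.
apply: (@le_trans _ _ (peak * (e * (D * (1 + t)) * (2 * K * E)))).
  apply: ler_pM => //; first exact: gauss_const_le.
  by apply: (le_trans (expR_diff_le _ _)); apply: ler_pM.
have -> : peak * (e * (D * (1 + t)) * (2 * K * E)) =
  (peak * e * D * (2 * K)) * ((1 + t) * E) by ring.
have -> : peak * (D * (2 * K) * (1 + 2 / (2 * decay))) * e * expR (- (decay * t)) =
  (peak * e * D * (2 * K)) * ((1 + 2 / (2 * decay)) * expR (- (decay * t))) by ring.
by rewrite ler_wpM2l// !mulr_ge0// ltW.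
Qed.

End uniform_estimates.

Lemma gdom_affine n (B : 'M[R]_n) a (f : 'cV[R]_n -> R) : B \in unitmx ->
  gdom f -> gdom (fun v => f (affine_mx a B v)).
Proof.
move=> uB [mf [C [c [c0 fC]]]].
have gf : gdom (fun v => f (v - (- a))) by apply: gdom_shift; split => //; exists C, c.
move: gf => [mf' [D [d [d0 fD]]]].
have [N N0 BN] := mx_entry_bound (invmx B).
set k := 1 + n%:R * n%:R * N ^+ 2.
have k0 : 0 < k by rewrite ltr_pwDl// mulr_ge0 ?sqr_ge0 ?mulr_ge0.
split; first exact: (measurableT_comp mf (@measurable_affine_mx _ _ a B)).
exists D, (d / k); split=> [|v]; first by rewrite divr_gt0.
have := fD (B *m v); rewrite opprK (addrC (B *m v)) => /le_trans; apply.
have D0 : 0 <= D.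
  by have := le_trans (normr_ge0 _) (fD 0); rewrite pmulr_lge0// expR_gt0.
rewrite ler_wpM2l// ler_expR lerN2 -mulrA ler_wpM2l ?(ltW d0)//.
rewrite mulrC ler_pdivrMr//; have := sqn_mulmx (B *m v) BN; rewrite mulKmx//.
move=> /le_trans; apply; rewrite mulrC ler_wpM2l ?sqn_ge0// /k lerDr//.
Qed.

Section moments.
Context (n : nat) (S : 'M[R]_n).
Hypothesis pS : posdefmx S.
Let B := sqrtmx S.

Lemma gauss_pdf_sqrt z : gauss_pdf S (B *m z) = (\det B)^-1 * stdg z.
Proof.
have pB := posdef_sqrtmx pS.
rewrite /gauss_pdf /stdg /wnorm mulKmx ?sqrtmx_unit// enorm_sqr.
rewrite (det_sqrtmx pS) sqrtrM; last by rewrite exprn_ge0// ltW// tau_gt0.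
rewrite sqrtr_sqr ger0_norm ?(ltW (posdef_det_gt0 pB))//.
by rewrite invfM -mulrA mulrCA.
Qed.

Lemma gdom_gauss_pdf a : gdom (fun v => gauss_pdf S (v - a)).
Proof.
have [lam [M [l0 M0 eS]]] := posdef_elliptic pS.
apply: gdom_shift; split; first exact: measurable_gauss_pdf.
exists (peak n lam * expR (4 * decay n lam M * sqn (0 : 'cV[R]_n))), (2 * decay n lam M).
split; first by rewrite mulr_gt0// decay_gt0.
move=> v; rewrite ger0_norm ?gauss_pdf_ge0//.
by have := gauss_pdf_ub l0 0 v eS; rewrite subr0.
Qed.

(** Substituting [v = a + B *m z], where [B] is the square root of [S], reduces
    Gaussian integrals to the standard ones. *)
Lemma I_gauss (h : 'cV[R]_n -> R) a : gdom (fun v => h v * gauss_pdf S (v - a)) ->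
  \I (fun v => h v * gauss_pdf S (v - a)) = \I (fun z => h (a + B *m z) * stdg z).
Proof.
move=> gh; have pB := posdef_sqrtmx pS; have d0 := posdef_det_gt0 pB.
have H := I_affine a pB gh.
have -> : \I (fun v => h v * gauss_pdf S (v - a)) =
   \det B * ((\det B)^-1 * \I (fun v => h v * gauss_pdf S (v - a))).
  by rewrite mulrA mulfV ?mul1r// gt_eqF.
rewrite -H -I_Z; last exact: (gdom_affine a (sqrtmx_unit pS) gh).
apply: eq_I => z; rewrite /affine_mx (addrC a) addrK gauss_pdf_sqrt mulrCA.
by rewrite (mulrA (\det B)) mulfV ?mul1r// gt_eqF.
Qed.

Lemma gdom_gauss_weight (h : 'cV[R]_n -> R) A a : measurable_fun setT h ->
  (forall v, `|h v| <= A * (1 + sqn v)) ->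
  gdom (fun v => h v * gauss_pdf S (v - a)).
Proof. by move=> mh hA; apply: (gdomM_weight mh hA); exact: gdom_gauss_pdf. Qed.

Lemma gdom_gauss_coord2 (a : 'cV[R]_n) i j :
  gdom (fun v : 'cV[R]_n => v i ord0 * v j ord0 * gauss_pdf S (v - a)).
Proof.
apply: (gdom_gauss_weight (A := 1)).
  by apply: measurable_funM; exact: measurable_coord.
move=> v; rewrite mul1r ler_norml.
have hi := sqr_coord_le v i; have hj := sqr_coord_le v j.
have := sqr_ge0 (v i ord0 + v j ord0); have := sqr_ge0 (v i ord0 - v j ord0).
by move=> ? ?; apply/andP; split; lra.
Qed.

Lemma I_gauss_pdf a : \I (fun v => gauss_pdf S (v - a)) = 1.
Proof.
have := I_gauss (h := fun=> 1) (a := a).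
have -> : (fun v => 1 * gauss_pdf S (v - a)) = (fun v => gauss_pdf S (v - a)).
  by apply/funext => v; rewrite mul1r.
move=> ->; last exact: gdom_gauss_pdf.
by rewrite -[RHS](I_stdg R n); apply: eq_I => z; rewrite mul1r.
Qed.

Lemma gauss_stdg_coord (z : 'cV[R]_n) i :
  (B *m z) i ord0 * stdg z = \sum_k B i k * (z k ord0 * stdg z).
Proof. by rewrite mxE mulr_suml; apply: eq_bigr => k _; rewrite mulrA. Qed.

Let gcoord i : gdom (fun z : 'cV[R]_n => (B *m z) i ord0 * stdg z).
Proof.
rewrite (_ : (fun z => _) = fun z : 'cV[R]_n => \sum_k B i k * (z k ord0 * stdg z)); last first.
  by apply/funext => z; exact: gauss_stdg_coord.
by apply: gdom_sum => k; apply/gdomZ/gdom_stdg_coord.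
Qed.

Let icoord i : \I (fun z : 'cV[R]_n => (B *m z) i ord0 * stdg z) = 0.
Proof.
rewrite (eq_I (fun z => gauss_stdg_coord z i)) I_sum; last first.
  by move=> k; apply/gdomZ/gdom_stdg_coord.
rewrite big1// => k _; rewrite I_Z; last exact: gdom_stdg_coord.
by rewrite I_stdg_coord mulr0.
Qed.

Lemma I_gauss_coord (a : 'cV[R]_n) i : \I (fun v : 'cV[R]_n => v i ord0 * gauss_pdf S (v - a)) = a i ord0.
Proof.
rewrite I_gauss; last exact/gdomM_coord/gdom_gauss_pdf.
rewrite (eq_I (g := fun z => a i ord0 * stdg z + (B *m z) i ord0 * stdg z)).
  rewrite I_D; [|exact/gdomZ/gdom_stdg|exact: gcoord].
  rewrite I_Z ?icoord ?I_stdg; last exact: gdom_stdg.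
  by rewrite addr0 mulr1.
by move=> z; rewrite [(a + _) _ _]mxE mulrDl.
Qed.

Lemma sum_delta (I : finType) (i : I) (F : I -> R) :
  \sum_j F j * (i == j)%:R = F i.
Proof.
rewrite (bigD1 i)//= eqxx mulr1 big1 ?addr0// => j /negbTE ji.
by rewrite eq_sym ji mulr0.
Qed.

Lemma I_gauss_coord2 (a : 'cV[R]_n) i j :
  \I (fun v : 'cV[R]_n => v i ord0 * v j ord0 * gauss_pdf S (v - a)) =
  S i j + a i ord0 * a j ord0.
Proof.
rewrite I_gauss; last exact: gdom_gauss_coord2.
have E (z : 'cV[R]_n) : (B *m z) i ord0 * (B *m z) j ord0 * stdg z =
    \sum_k \sum_l (B i k * B j l) * (z k ord0 * z l ord0 * stdg z).
  rewrite [(B *m z) i ord0]mxE [(B *m z) j ord0]mxE !mulr_suml.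
  apply: eq_bigr => k _; rewrite mulr_sumr mulr_suml; apply: eq_bigr => l _.
  by ring.
have g2 k l : gdom (fun z : 'cV[R]_n =>
    (B i k * B j l) * (z k ord0 * z l ord0 * stdg z)).
  by apply/gdomZ/gdom_stdg_coord2.
have g1 k : gdom (fun z : 'cV[R]_n =>
    \sum_l (B i k * B j l) * (z k ord0 * z l ord0 * stdg z)).
  by apply: gdom_sum => l.
have gE : gdom (fun z : 'cV[R]_n => (B *m z) i ord0 * (B *m z) j ord0 * stdg z).
  rewrite (_ : (fun z => _) = fun z : 'cV[R]_n =>
    \sum_k \sum_l (B i k * B j l) * (z k ord0 * z l ord0 * stdg z)).
    exact: gdom_sum.
  exact/funext.
have iE : \I (fun z : 'cV[R]_n => (B *m z) i ord0 * (B *m z) j ord0 * stdg z) = S i j.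
  rewrite (eq_I E) I_sum//.
  transitivity (\sum_k \sum_l (B i k * B j l) * (k == l)%:R).
    apply: eq_bigr => k _; rewrite I_sum//; apply: eq_bigr => l _.
    by rewrite I_Z ?I_stdg_coord2//; exact: gdom_stdg_coord2.
  under eq_bigr do rewrite sum_delta.
  rewrite -{1}(sqrtmxP pS).2 mxE; apply: eq_bigr => k _; congr (_ * _).
  by rewrite -[in RHS](sqrtmx_tr pS) mxE.
rewrite (eq_I (g := fun z => (a i ord0 * a j ord0) * stdg z +
  ((a i ord0 * ((B *m z) j ord0 * stdg z) + a j ord0 * ((B *m z) i ord0 * stdg z)) +
  (B *m z) i ord0 * (B *m z) j ord0 * stdg z))).
  have ga k : gdom (fun z : 'cV[R]_n => a k ord0 * ((B *m z) j ord0 * stdg z)).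
    exact/gdomZ/gcoord.
  have gs := gdom_stdg R n.
  have gci := gcoord i; have gcj := gcoord j.
  rewrite I_D; [|exact: gdomZ|by apply: gdomD => //; apply: gdomD; exact: gdomZ].
  rewrite I_D; [|by apply: gdomD; exact: gdomZ|by []].
  rewrite I_D; [|exact: gdomZ|exact: gdomZ].
  by rewrite (I_Z _ gs) (I_Z _ gcj) (I_Z _ gci) !icoord I_stdg iE; ring.
by move=> z; rewrite ![(a + _) _ _]mxE; ring.
Qed.

(** The normal law is defined as an image of the standard one; the change of
    variables gives it back its density. *)
Lemma normal_measureE a A : measurable A ->
  normal_measure a S A =
  (\int[lebesgue_cV R n]_(v in A) (gauss_pdf S (v - a))%:E)%E.
Proof.
move=> mA; have pB := posdef_sqrtmx pS; have d0 := posdef_det_gt0 pB.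
have sE : std_gauss R n = density_measure (lebesgue_cV R n) (@stdg R n).
  by rewrite /std_gauss; congr density_measure; apply/funext => v; rewrite /stdg enorm_sqr.
have mpre : measurable (affine_mx a B @^-1` A).
  by rewrite -[X in measurable X]setTI; exact: measurable_affine_mx.
have -> : normal_measure a S A =
    density_measure (lebesgue_cV R n) (@stdg R n) (affine_mx a B @^-1` A).
  by rewrite /normal_measure sE.
rewrite /density_measure asboolT; last first.
  by split; [exact: gdom_meas (gdom_stdg R n)|exact: stdg_ge0].
pose f v := ((\det B * gauss_pdf S (v - a))%:E * (\1_A v)%:E)%E.
have mf : measurable_fun setT f.
  apply: emeasurable_funM.
    by apply: ((measurable_EFinP _ _).2 _); exact: gdom_meas (gdomZ _ (gdom_gauss_pdf a)).
  by apply: ((measurable_EFinP _ (\1_A : _ -> R)).2 _); exact: measurable_indic.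
have f0 v : (0 <= f v)%E.
  apply: mule_ge0; rewrite lee_fin; last by rewrite indicE ler0n.
  exact: mulr_ge0 (ltW d0) (gauss_pdf_ge0 _ _).
have := integral_affine a pB mf f0.
have -> : (\int[lebesgue_cV R n]_v f (affine_mx a B v) =
    \int[lebesgue_cV R n]_(v in affine_mx a B @^-1` A) (stdg v)%:E)%E.
  rewrite [RHS]integral_mkcond; apply: eq_integral => z _.
  rewrite epatch_indic/= /f /affine_mx (addrC a) addrK gauss_pdf_sqrt.
  rewrite mulrA mulfV; last by rewrite gt_eqF.
  rewrite mul1r; congr (_ * _)%E.
  by rewrite !indicE addrC.
move=> ->; rewrite [in RHS]integral_mkcond -(ge0_integralZl _ measurableT mf (fun v _ => f0 v)).
  2: by rewrite lee_fin invr_ge0 ltW.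
apply: eq_integral => v _; rewrite epatch_indic/= /f muleA -EFinM.
rewrite mulrA mulVf; last by rewrite gt_eqF.
by rewrite mul1r.
Qed.

End moments.
End gauss_pdf_theory.

(** * Probability measures, densities and the weighted distance *)

Section probability_tools.
Context d (T : measurableType d) (R : realType).
Variable nu : {measure set T -> \bar R}.
Hypothesis nu1 : nu setT = 1%E.

(** The filters are only known to be measures; this copy of one of them carries
    the instances that its total mass entitles it to. *)
Definition as_probability (_ : nu setT = 1%E) : set T -> \bar R := nu.

HB.instance Definition _ := Measure.on (as_probability nu1).
HB.instance Definition _ :=
  Measure_isProbability.Build _ _ _ (as_probability nu1) nu1.

Lemma prob_integrable (f : T -> R) A : measurable_fun setT f ->
  (forall x, `|f x| <= A) -> nu.-integrable setT (EFin \o f).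
Proof.
move=> mf fA; apply: measurable_bounded_integrable => //; first by rewrite nu1 ltry.
by exists A; split; [rewrite num_real|move=> M AM x _ /=; apply: le_trans (fA x) (ltW AM)].
Qed.

Lemma prob_le (f : T -> R) A : measurable_fun setT f ->
  (forall x, `|f x| <= A) -> `|\int[nu]_x f x| <= A.
Proof.
move=> mf fA; have fi := prob_integrable mf fA.
have nf : measurable_fun setT (fun x => `|f x|) by exact: measurableT_comp.
have ni : nu.-integrable setT (EFin \o (fun x => `|f x|)).
  by apply: (prob_integrable (A := A)) => // x; rewrite normr_id.
have ci : nu.-integrable setT (EFin \o (fun=> A)).
  apply: (prob_integrable (A := `|A|)) => //; exact: measurable_cst.
apply: (le_trans (le_normr_Rintegral _ fi)) => //.
have -> : A = \int[nu]_x A by rewrite Rintegral_cst// nu1 mulr1.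
by apply: le_Rintegral => //.
Qed.

Lemma prob_cst (A : R) : \int[nu]_x A = A.
Proof. by rewrite Rintegral_cst// nu1 mulr1. Qed.

Lemma prob_tonelli n (f : T * 'cV[R]_n -> \bar R) :
  measurable_fun setT f -> (forall p, (0 <= f p)%E) ->
  (\int[nu \x lebesgue_cV R n]_p f p =
   \int[nu]_x \int[lebesgue_cV R n]_v f (x, v))%E.
Proof.
move=> mf f0.
exact: (fubini_tonelli1 (m1 := as_probability nu1) f mf f0).
Qed.

Lemma prob_fubini n (f : T * 'cV[R]_n -> \bar R) :
  measurable_fun setT f ->
  (\int[lebesgue_cV R n]_v \int[nu]_x `|f (x, v)| < +oo)%E ->
  (\int[lebesgue_cV R n]_v \int[nu]_x f (x, v) =
   \int[nu]_x \int[lebesgue_cV R n]_v f (x, v))%E.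
Proof.
move=> mf fy; apply/esym.
apply: (@Fubini _ _ _ _ _ (as_probability nu1) (lebesgue_cV R n) f).
by apply/integrable21ltyP.
Qed.

End probability_tools.

Section density_tools.
Context (R : realType) (n : nat).
Variable rho : 'cV[R]_n -> R.
Hypotheses (grho : gdom rho) (rho0 : forall v, 0 <= rho v).

Lemma density_measureE (A : set 'cV[R]_n) :
  density_measure (lebesgue_cV R n) rho A =
  (\int[lebesgue_cV R n]_(v in A) (rho v)%:E)%E.
Proof. by rewrite /density_measure asboolT//; split; [exact: gdom_meas|]. Qed.

Lemma density_total : density_measure (lebesgue_cV R n) rho setT = (\I rho)%:E.
Proof. by rewrite density_measureE EFin_I. Qed.

Lemma integral_density (f : 'cV[R]_n -> R) A : measurable_fun setT f ->
  (forall v, `|f v| <= A * (1 + sqn v)) ->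
  (\int[density_measure (lebesgue_cV R n) rho]_v (f v)%:E =
   (\I (fun v => f v * rho v))%:E)%E.
Proof.
move=> mf fA; have mrho := gdom_meas grho.
have mfE : measurable_fun setT (EFin \o f) by exact/measurable_EFinP.
rewrite EFin_I; last exact: gdomM_weight fA grho.
rewrite integralE [RHS]integralE !ge0_integral_density//; last 2 first.
  exact: measurable_funeneg.
  exact: measurable_funepos.
congr (_ - _)%E; apply: eq_integral => v _; rewrite ?funeposE ?funenegE.
  by rewrite maxe_pMl ?lee_fin// mul0e.
by rewrite maxe_pMl ?lee_fin// mul0e EFinM mulNe.
Qed.

Lemma Rintegral_density (f : 'cV[R]_n -> R) A : measurable_fun setT f ->
  (forall v, `|f v| <= A * (1 + sqn v)) ->
  \int[density_measure (lebesgue_cV R n) rho]_v f v = \I (fun v => f v * rho v).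
Proof. by move=> mf fA; rewrite /Rintegral (integral_density mf fA). Qed.

End density_tools.

Section weighted_distance.
Context (R : realType) (n : nat).

Lemma weightE (v : 'cV[R]_n) : weight v = 1 + sqn v.
Proof. by rewrite /weight enorm_sqr. Qed.

Lemma weight_ge1 (v : 'cV[R]_n) : 1 <= 1 + sqn v.
Proof. by rewrite lerDl sqn_ge0. Qed.

Lemma measurable_weight : measurable_fun setT (fun v : 'cV[R]_n => 1 + sqn v).
Proof. by apply: measurable_funD => //; exact: measurable_sqn. Qed.

Lemma gdom_weight (f : 'cV[R]_n -> R) : gdom f -> gdom (fun v => (1 + sqn v) * f v).
Proof.
apply: (gdomM_weight (A := 1)); first exact: measurable_weight.
by move=> v; rewrite mul1r ger0_norm// (le_trans ler01)// weight_ge1.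
Qed.

Lemma dist_g_ge0 (mu1 mu2 : {measure set 'cV[R]_n -> \bar R}) :
  (0 <= dist_g mu1 mu2)%E.
Proof.
apply: ereal_sup_ubound; exists (fun=> 0); last by rewrite !integral0 sube0 abse0.
split; first exact: measurable_cst.
by move=> v; rewrite normr0 weightE (le_trans ler01)// weight_ge1.
Qed.

Lemma dist_g_density_le (f1 f2 : 'cV[R]_n -> R) (D : R) :
  gdom f1 -> gdom f2 -> (forall v, 0 <= f1 v) -> (forall v, 0 <= f2 v) ->
  \I (fun v => (1 + sqn v) * `|f1 v - f2 v|) <= D ->
  (dist_g (density_measure (lebesgue_cV R n) f1)
          (density_measure (lebesgue_cV R n) f2) <= D%:E)%E.
Proof.
move=> g1 g2 p1 p2 fD; apply: ge_ereal_sup => _ [f [mf fw] <-].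
have fW v : `|f v| <= 1 * (1 + sqn v) by rewrite mul1r -weightE.
rewrite (integral_density g1 p1 mf fW) (integral_density g2 p2 mf fW).
rewrite -EFinB abse_EFin lee_fin; apply: le_trans fD.
have gf1 := gdomM_weight mf fW g1; have gf2 := gdomM_weight mf fW g2.
rewrite -I_B//; apply: (le_trans (I_norm_le (gdomB gf1 gf2))).
apply: I_le => [||v]; first exact/gdom_norm/gdomB.
  exact/gdom_weight/gdom_norm/gdomB.
by rewrite -mulrBr normrM ler_wpM2r// -weightE.
Qed.

(** The weighted distance of two densities is attained at the weight times the
    sign of their difference. *)
Lemma le_dist_g_density (f1 f2 : 'cV[R]_n -> R)
    (mu1 mu2 : {measure set 'cV[R]_n -> \bar R}) (D : R) :
  gdom f1 -> gdom f2 -> (forall v, 0 <= f1 v) -> (forall v, 0 <= f2 v) ->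
  (forall A, measurable A -> mu1 A = density_measure (lebesgue_cV R n) f1 A) ->
  (forall A, measurable A -> mu2 A = density_measure (lebesgue_cV R n) f2 A) ->
  (dist_g mu1 mu2 <= D%:E)%E ->
  \I (fun v => (1 + sqn v) * `|f1 v - f2 v|) <= D.
Proof.
move=> g1 g2 p1 p2 m1 m2 mD.
pose f v := (1 + sqn v) * (if f1 v - f2 v < 0 then -1 else 1).
have mf : measurable_fun setT f.
  apply: measurable_funM; first exact: measurable_weight.
  apply: measurable_fun_ifT => //.
    by apply: measurable_fun_ltr => //; apply: measurable_funB; exact: gdom_meas.
have fW v : `|f v| <= 1 * (1 + sqn v).
  rewrite /f normrM mul1r ger0_norm; last by rewrite (le_trans ler01)// weight_ge1.
  by case: ifP; rewrite ?normrN normr1 mulr1.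
have gf1 := gdomM_weight mf fW g1; have gf2 := gdomM_weight mf fW g2.
have -> : \I (fun v => (1 + sqn v) * `|f1 v - f2 v|) =
    \I (fun v => f v * f1 v) - \I (fun v => f v * f2 v).
  rewrite -I_B//; apply: eq_I => v; rewrite -mulrBr /f -mulrA; congr (_ * _).
  by case: ltP => h; [rewrite ltr0_norm// mulN1r|rewrite ger0_norm// mul1r].
rewrite -lee_fin; apply: le_trans mD.
apply: (@le_trans _ _ (`|\int[mu1]_v (f v)%:E - \int[mu2]_v (f v)%:E|%E)); last first.
  apply: ereal_sup_ubound; exists f => //; split => // v.
  by rewrite weightE -[leRHS]mul1r.
rewrite (eq_measure_integral (density_measure (lebesgue_cV R n) f1)); last first.
  by move=> A mA _; exact: m1.
rewrite (eq_measure_integral (density_measure (lebesgue_cV R n) f2)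
  (m1 := mu2)); last by move=> A mA _; exact: m2.
rewrite (integral_density g1 p1 mf fW) (integral_density g2 p2 mf fW).
by rewrite -EFinB abse_EFin lee_fin ler_norm.
Qed.

Definition normalized (f : 'cV[R]_n -> R) v : R := f v / \I f.

Lemma gdom_normalized f : gdom f -> gdom (normalized f).
Proof. by move=> gf; rewrite /normalized; under eq_fun do rewrite mulrC; exact: gdomZ. Qed.

Lemma I_normalized f : gdom f -> 0 < \I f -> \I (normalized f) = 1.
Proof.
move=> gf f0; rewrite /normalized; under eq_I do rewrite mulrC.
by rewrite I_Z// mulVf// gt_eqF.
Qed.

(** Normalising two nearby functions whose masses are bounded below yields
    nearby densities. *)
Lemma normalized_lip (f1 f2 : 'cV[R]_n -> R) (z M D : R) : 0 < z ->
  gdom f1 -> gdom f2 -> (forall v, 0 <= f2 v) ->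
  z <= \I f1 -> z <= \I f2 -> \I (fun v => (1 + sqn v) * f2 v) <= M ->
  \I (fun v => (1 + sqn v) * `|f1 v - f2 v|) <= D ->
  \I (fun v => (1 + sqn v) * `|normalized f1 v - normalized f2 v|) <=
  (z^-1 + z^-1 ^+ 2 * M) * D.
Proof.
move=> z0 g1 g2 p2 z1 z2 fM fD; rewrite /normalized.
set Z1 := \I f1 in z1 *; set Z2 := \I f2 in z2 *.
have Z10 : 0 < Z1 by exact: lt_le_trans z1.
have Z20 : 0 < Z2 by exact: lt_le_trans z2.
have gW : gdom (fun v => (1 + sqn v) * `|f1 v - f2 v|).
  exact/gdom_weight/gdom_norm/gdomB.
have D0 : 0 <= D.
  apply: le_trans fD; apply: I_ge0 => v.
  by rewrite mulr_ge0// (le_trans ler01)// weight_ge1.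
have ZD : `|Z1 - Z2| <= D.
  rewrite -I_B//; apply: (le_trans (I_norm_le (gdomB g1 g2))).
  apply: le_trans fD; apply: I_le => [||v] //; first exact/gdom_norm/gdomB.
  by rewrite ler_peMl// weight_ge1.
have gd1 : gdom (fun v => f1 v / Z1) by under eq_fun do rewrite mulrC; exact: gdomZ.
have gd2 : gdom (fun v => f2 v / Z2) by under eq_fun do rewrite mulrC; exact: gdomZ.
apply: (@le_trans _ _ (\I (fun v => z^-1 * ((1 + sqn v) * `|f1 v - f2 v|) +
    (z^-1 ^+ 2 * D) * ((1 + sqn v) * f2 v)))).
  apply: I_le => [||v].
  - exact/gdom_weight/gdom_norm/gdomB.
  - by apply: gdomD; apply: gdomZ => //; exact: gdom_weight.
  have w0 : 0 <= 1 + sqn v by rewrite (le_trans ler01)// weight_ge1.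
  rewrite -[leRHS](_ : (1 + sqn v) * (z^-1 * `|f1 v - f2 v| + z^-1 ^+ 2 * D * f2 v) = _);
    last by ring.
  rewrite ler_wpM2l//.
  have -> : f1 v / Z1 - f2 v / Z2 = Z1^-1 * (f1 v - f2 v) +
      Z1^-1 * Z2^-1 * (Z2 - Z1) * f2 v.
    by field; rewrite !gt_eqF.
  have i1 : Z1^-1 <= z^-1 by rewrite lef_pV2.
  have i2 : Z2^-1 <= z^-1 by rewrite lef_pV2.
  have i10 : 0 <= Z1^-1 by rewrite invr_ge0 ltW.
  have i20 : 0 <= Z2^-1 by rewrite invr_ge0 ltW.
  apply: (le_trans (ler_normD _ _)); apply: lerD.
    by rewrite normrM (ger0_norm i10) ler_wpM2r.
  rewrite !normrM (ger0_norm i10) (ger0_norm i20) (ger0_norm (p2 v)) ler_wpM2r//.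
  rewrite expr2; apply: ler_pM => //; first exact: mulr_ge0.
    exact: ler_pM.
  by rewrite distrC.
rewrite I_D; [|exact: gdomZ|exact/gdomZ/gdom_weight].
rewrite I_Z// I_Z; last exact: gdom_weight.
rewrite mulrDl; apply: lerD; first by rewrite ler_wpM2l// invr_ge0 ltW.
by rewrite -[leRHS]mulrA (mulrC M) [leRHS]mulrA ler_wpM2l// mulr_ge0// sqr_ge0.
Qed.

End weighted_distance.

(** * Continuous densities *)

Section continuity.
Context (R : realType).

Lemma continuous_mxP (T : topologicalType) m n (f : T -> 'M[R]_(m, n)) :
  (forall i j, continuous (fun x => f x i j)) -> continuous f.
Proof.
move=> cf x; apply/cvg_ballP => e e0.
have H (i : 'I_m) (j : 'I_n) : \forall y \near x, ball (f x i j) e (f y i j).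
  by have /cvg_ballP/(_ _ e0) := cf i j x.
have /filter_forall H2 : forall i : 'I_m, \forall y \near x,
    forall j, ball (f x i j) e (f y i j).
  by move=> i; apply: filter_forall; exact: H.
by apply: filterS H2 => y Hy; split => // i j; exact: Hy.
Qed.

Lemma continuous_usubmx m n : continuous (@usubmx R m n 1).
Proof.
apply: continuous_mxP => i j.
by under eq_fun do rewrite mxE; exact: coord_continuous.
Qed.

Lemma continuous_dsubmx m n : continuous (@dsubmx R m n 1).
Proof.
apply: continuous_mxP => i j.
by under eq_fun do rewrite mxE; exact: coord_continuous.
Qed.

Lemma locally_lip_continuous n (f : 'cV[R]_n -> R) (L : R) : 0 <= L ->
  (forall u v : 'cV[R]_n, (forall i, `|u i ord0 - v i ord0| <= 1) -> forall e : R,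
    (forall i, `|u i ord0 - v i ord0| <= e) -> 0 <= e -> `|f u - f v| <= L * e) ->
  continuous f.
Proof.
move=> L0 fL u.
apply/(@cvgrPdist_le _ _ _ (nbhs u) (nbhs_filter u)) => e e0.
pose r := Num.min 1 (e / (L + 1)).
have r0 : 0 < r by rewrite lt_min ltr01 divr_gt0// ltr_wpDl.
near=> v.
have bv : ball u r v by near: v; apply: nbhsx_ballx.
have uv i : `|u i ord0 - v i ord0| <= r by case: bv => _ /(_ i ord0)/ltW.
apply: (@le_trans _ _ (L * r)).
  apply: (fL u v _ r uv (ltW r0)) => i.
  by apply: (le_trans (uv i)); rewrite ge_min lexx.
apply: (@le_trans _ _ (L * (e / (L + 1)))).
  by rewrite ler_wpM2l// ge_min lexx orbT.
rewrite mulrCA ler_piMr ?(ltW e0)// ler_pdivrMr ?mul1r ?lerDl// ltr_wpDl//.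
Unshelve. all: by end_near. Qed.

Lemma gauss_pdf_shift_lip n (S : 'M[R]_n) (r : R) : posdefmx S -> 0 <= r ->
  exists2 L : R, 0 <= L & forall a u v : 'cV[R]_n, sqn a <= r ->
    (forall i, `|u i ord0 - v i ord0| <= 1) -> forall e : R,
    (forall i, `|u i ord0 - v i ord0| <= e) -> 0 <= e ->
    `|gauss_pdf S (u - a) - gauss_pdf S (v - a)| <= L * e.
Proof.
move=> pS r0; have [lam [M [l0 M0 eS]]] := posdef_elliptic pS.
have r1 : 0 <= 2 * r + 2 * n%:R by rewrite addr_ge0// mulr_ge0.
have [L L0 HL] := gauss_pdf_lip n l0 M0 r1.
exists L => // a u v ar uv1 e uve e0.
have -> : v - a = u - (a + (u - v)).
  by apply/colP => i; rewrite !mxE; ring.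
have sr : sqn (u - v) <= n%:R.
  rewrite -[X in X%:R](card_ord n) -sumr_const; apply: ler_sum => i _.
  by rewrite -real_normK ?num_real// exprn_ile1// !mxE.
apply: (le_trans (HL S S a (a + (u - v)) e _ _ _ _ _ _ _ u)) => //.
- by have := ler0n R n; lra.
- by apply: (le_trans (sqnD_le _ _)); lra.
- by move=> i j; rewrite subrr normr0.
- move=> i; rewrite !mxE.
  by rewrite (_ : a i ord0 - (a i ord0 + (u i ord0 - v i ord0)) =
    - (u i ord0 - v i ord0)) ?normrN//; ring.
rewrite ler_piMr ?mulr_ge0// expR_le1 oppr_le0 mulr_ge0 ?sqn_ge0//.
by rewrite ltW// decay_gt0.
Qed.

Lemma continuous_gauss_pdf n (S : 'M[R]_n) : posdefmx S -> continuous (gauss_pdf S).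
Proof.
move=> pS; have [L L0 HL] := gauss_pdf_shift_lip pS (lexx 0).
apply: (locally_lip_continuous L0) => u v uv1 e uve e0.
have := HL 0 u v _ uv1 e uve e0; rewrite !subr0; apply.
by rewrite le_eqVlt sqn_eq0 eqxx.
Qed.

Lemma lebesgue_cV_ball n (v : 'cV[R]_n) (r : R) : 0 < r ->
  lebesgue_cV R n (ball v r) = ((2 * r) ^+ n)%:E.
Proof.
move=> r0; pose A (i : 'I_n) : set (measurableTypeR R) := ball (v i ord0 : R) r.
have -> : ball v r = [set w | forall i, A i (w i ord0)].
  apply/seteqP; split => [w [_ bw] i|w Aw]; first exact: bw.
  by split => // i j; rewrite (ord1 j); exact: Aw.
rewrite lebesgue_cV_box; last first.
  by move=> i; apply: open_measurable; exact: ball_open.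
under eq_bigr do rewrite [lebesgue_measure _]lebesgue_measure_ball ?(ltW r0)//.
rewrite prodEFin prodr_const card_ord; congr (_ ^+ _)%:E; by rewrite mulr_natl.
Qed.

Lemma measurable_ball_cV n (v : 'cV[R]_n) (r : R) : measurable (ball v r).
Proof. by apply: sub_sigma_algebra; exact: ball_open. Qed.

(** Two continuous densities of the same measure agree: where one exceeded the
    other, it would do so by a margin on a ball of positive finite volume. *)
Lemma continuous_density_le n (p q : 'cV[R]_n -> R) :
  continuous p -> continuous q -> (forall v, 0 <= p v) -> (forall v, 0 <= q v) ->
  (forall A, measurable A -> (\int[lebesgue_cV R n]_(v in A) (p v)%:E =
    \int[lebesgue_cV R n]_(v in A) (q v)%:E)%E) ->
  forall v, p v <= q v.
Proof.
move=> cp cq p0 q0 pq v0; rewrite leNgt; apply/negP => qp.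
pose e := (p v0 - q v0) / 3.
have e0 : 0 < e by rewrite divr_gt0// subr_gt0.
have : \forall v \near v0, q v + e <= p v /\ q v <= q v0 + e.
  have /(@cvgrPdist_le _ _ _ (nbhs v0) (nbhs_filter v0))/(_ _ e0) np := cp v0.
  have /(@cvgrPdist_le _ _ _ (nbhs v0) (nbhs_filter v0))/(_ _ e0) nq := cq v0.
  near=> v.
  have h1 : `|p v0 - p v| <= e by near: v.
  have h2 : `|q v0 - q v| <= e by near: v.
  move: h1 h2; rewrite !ler_norml => /andP[h1 h2] /andP[h3 h4].
  by rewrite /e in h1 h2 h3 h4 *; split; lra.
move=> /nbhs_ballP[r /= r0 rB].
have mB := measurable_ball_cV v0 r.
have mq : measurable_fun setT q by exact: continuous_measurable_cV.
have mp : measurable_fun setT p by exact: continuous_measurable_cV.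
have V0 : 0 < (2 * r) ^+ n by rewrite exprn_gt0// mulr_gt0.
have vB := lebesgue_cV_ball v0 r0.
have := pq _ mB; apply/eqP; rewrite gt_eqF//.
have qfin : (\int[lebesgue_cV R n]_(v in ball v0 r) (q v)%:E < +oo)%E.
  apply: (@le_lt_trans _ _ (\int[lebesgue_cV R n]_(v in ball v0 r) (cst (q v0 + e)%:E) v)%E).
    apply: ge0_le_integral => //.
    - by move=> v _; rewrite lee_fin.
    - by apply/measurable_EFinP/measurable_funTS.
    - by move=> v /rB[_]; rewrite lee_fin.
  by rewrite integral_cst// [X in (_ * X)%E]vB -EFinM ltry.
have : (\int[lebesgue_cV R n]_(v in ball v0 r) (q v)%:E + (e * (2 * r) ^+ n)%:E <=
    \int[lebesgue_cV R n]_(v in ball v0 r) (p v)%:E)%E.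
  have -> : (e * (2 * r) ^+ n)%:E =
      (\int[lebesgue_cV R n]_(v in ball v0 r) (cst e%:E) v)%E.
    by rewrite integral_cst// [X in (_ * X)%E]vB.
  rewrite -ge0_integralD//; last 3 first.
  - by move=> v _; rewrite lee_fin.
  - by apply/measurable_EFinP/measurable_funTS.
  - by move=> v _; rewrite lee_fin ltW.
  apply: ge0_le_integral => //.
  - by move=> v _; rewrite -EFinD lee_fin addr_ge0// ltW.
  - apply: emeasurable_funD => //; apply/measurable_EFinP/measurable_funTS => //.
  - by apply/measurable_EFinP/measurable_funTS.
  - by move=> v /rB[h _]; rewrite -EFinD lee_fin.
apply: lt_le_trans; rewrite lteDl; first by rewrite lte_fin mulr_gt0.
by rewrite ge0_fin_numE//; apply: integral_ge0 => v _; rewrite lee_fin.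
Unshelve. all: by end_near. Qed.

Lemma continuous_densityE n (mu : {measure set 'cV[R]_n -> \bar R})
    (p : 'cV[R]_n -> R) :
  continuous p -> (forall v, 0 <= p v) ->
  (forall A, measurable A ->
    mu A = (\int[lebesgue_cV R n]_(v in A) (p v)%:E)%E) ->
  continuous_density mu = p.
Proof.
move=> cp p0 mup; rewrite /continuous_density.
case: xgetP => [q _ [cq q0 muq]|/(_ p)]; last by case.
apply/funext => v; apply/eqP; rewrite eq_le.
have pq A : measurable A -> (\int[lebesgue_cV R n]_(v in A) (p v)%:E =
    \int[lebesgue_cV R n]_(v in A) (q v)%:E)%E.
  by move=> mA; rewrite -mup// muq.
by apply/andP; split; apply: continuous_density_le => // A mA; rewrite pq.
Qed.

End continuity.

(** * The prediction step *)

Section quadratic_moment.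
Context (R : realType) (n : nat).

Lemma dotv_sqr_sum (s v : 'cV[R]_n) (t : R) : (dotv s v - t) ^+ 2 =
  \sum_i \sum_j (s i ord0 * s j ord0) * (v i ord0 * v j ord0) +
  \sum_i (- (2 * t * s i ord0)) * v i ord0 + t ^+ 2.
Proof.
have -> : \sum_i (- (2 * t * s i ord0)) * v i ord0 = - (2 * t) * dotv s v.
  by rewrite mulr_sumr; apply: eq_bigr => i _; ring.
have -> : \sum_i \sum_j (s i ord0 * s j ord0) * (v i ord0 * v j ord0) = dotv s v ^+ 2.
  rewrite expr2 {1}/dotv mulr_suml; apply: eq_bigr => i _.
  by rewrite mulr_sumr; apply: eq_bigr => j _; ring.
ring.
Qed.

Lemma dotv_sqr_le (s v : 'cV[R]_n) t :
  (dotv s v - t) ^+ 2 <= (2 * sqn s + 2 * t ^+ 2) * (1 + sqn v).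
Proof.
have h := dotv_CS s v; have s0 := sqn_ge0 s; have v0 := sqn_ge0 v.
have := sqr_ge0 (dotv s v + t); have := mulr_ge0 (sqr_ge0 t) v0.
by have := mulr_ge0 s0 v0; nra.
Qed.

Lemma measurable_dotv_sqr (s : 'cV[R]_n) t :
  measurable_fun setT (fun v => (dotv s v - t) ^+ 2).
Proof.
apply: measurable_funX; apply: measurable_funB => //.
by apply: measurable_sum => i; apply: measurable_funM => //; exact: measurable_coord.
Qed.

Lemma gdomM_quad (s : 'cV[R]_n) t f : gdom f ->
  gdom (fun v => (dotv s v - t) ^+ 2 * f v).
Proof.
apply: gdomM_weight; first exact: measurable_dotv_sqr.
by move=> v; rewrite ger0_norm ?sqr_ge0//; exact: dotv_sqr_le.
Qed.

Lemma gdom_coord2 (f : 'cV[R]_n -> R) i j : gdom f ->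
  gdom (fun v => v i ord0 * v j ord0 * f v).
Proof.
apply: (gdomM_weight (A := 1)).
  by apply: measurable_funM; exact: measurable_coord.
by move=> v; rewrite mul1r coord2_le_weight.
Qed.

(** Expanding the square: the only integrals left are the first two moments. *)
Lemma I_quad (f : 'cV[R]_n -> R) (s : 'cV[R]_n) t : gdom f ->
  \I (fun v => (dotv s v - t) ^+ 2 * f v) =
  \sum_i \sum_j (s i ord0 * s j ord0) * \I (fun v : 'cV[R]_n => v i ord0 * v j ord0 * f v) +
  \sum_i (- (2 * t * s i ord0)) * \I (fun v : 'cV[R]_n => v i ord0 * f v) + t ^+ 2 * \I f.
Proof.
move=> gf.
have g2 i j := gdom_coord2 i j gf; have g1 i := gdomM_coord i gf.
rewrite (eq_I (g := fun v : 'cV[R]_n =>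
  (\sum_i \sum_j (s i ord0 * s j ord0) * (v i ord0 * v j ord0 * f v) +
  \sum_i (- (2 * t * s i ord0)) * (v i ord0 * f v)) + t ^+ 2 * f v)); last first.
  move=> v; rewrite dotv_sqr_sum !mulrDl; congr (_ + _ + _); rewrite mulr_suml.
    apply: eq_bigr => i _; rewrite mulr_suml; apply: eq_bigr => j _.
    by rewrite !mulrA.
  by apply: eq_bigr => i _; rewrite mulrA.
have gs2 : gdom (fun v : 'cV[R]_n =>
    \sum_i \sum_j (s i ord0 * s j ord0) * (v i ord0 * v j ord0 * f v)).
  by apply: gdom_sum => i; apply: gdom_sum => j; exact: gdomZ.
have gs1 : gdom (fun v : 'cV[R]_n => \sum_i (- (2 * t * s i ord0)) * (v i ord0 * f v)).
  by apply: gdom_sum => i; exact: gdomZ.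
rewrite I_D; [|exact: gdomD|exact: gdomZ].
rewrite I_D// I_Z//; congr (_ + _ + _).
  rewrite I_sum; last by move=> i; apply: gdom_sum => j; exact: gdomZ.
  apply: eq_bigr => i _; rewrite I_sum; last by move=> j; exact: gdomZ.
  by apply: eq_bigr => j _; rewrite I_Z.
rewrite I_sum; last by move=> i; exact: gdomZ.
by apply: eq_bigr => i _; rewrite I_Z.
Qed.

Lemma I_gauss_quad (S : 'M[R]_n) s a t : posdefmx S ->
  \I (fun v => (dotv s v - t) ^+ 2 * gauss_pdf S (v - a)) =
  qform S s + (dotv s a - t) ^+ 2.
Proof.
move=> pS; rewrite (I_quad _ _ (gdom_gauss_pdf pS a)) I_gauss_pdf// mulr1.
rewrite dotv_sqr_sum addrA addrA; congr (_ + _); congr (_ + _); last first.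
  by apply: eq_bigr => i _; rewrite I_gauss_coord.
rewrite qformE /dotv -big_split/=; apply: eq_bigr => i _.
rewrite mxE mulr_sumr -big_split/=; apply: eq_bigr => j _.
by rewrite I_gauss_coord2//; ring.
Qed.

End quadratic_moment.

(** Fubini for the two parts of a signed integrand. *)
Lemma measurable_I_param d (T : measurableType d) (R : realType) n
    (f : T * 'cV[R]_n -> R) :
  measurable_fun setT f -> measurable_fun setT (fun x => \I (fun v => f (x, v))).
Proof.
move=> mf; have mfE : measurable_fun setT (EFin \o f) by exact/measurable_EFinP.
apply: measurableT_comp => //.
have -> : (fun x => \int[lebesgue_cV R n]_v (f (x, v))%:E)%E =
  (fun x => (\int[lebesgue_cV R n]_v (EFin \o f)^\+ (x, v) -
   \int[lebesgue_cV R n]_v (EFin \o f)^\- (x, v))%E).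
  apply/funext => u; rewrite integralE.
  by congr (_ - _)%E; apply: eq_integral => v _; rewrite ?funeposE ?funenegE.
apply: emeasurable_funB.
  by apply: measurable_fun_fubini_tonelli_F => //; exact: measurable_funepos.
by apply: measurable_fun_fubini_tonelli_F => //; exact: measurable_funeneg.
Qed.

(** The weighted mass of the envelope shared by all predictions: a Lipschitz
    constant that is chosen before the drift. *)
Definition predict_const (R : realType) d (lam M k : R) : R :=
  \I (fun u : 'cV[R]_d => (1 + sqn u) *
    (peak d lam * expR (4 * decay d lam M * k) * expR (- (2 * decay d lam M * sqn u)))).

Lemma predict_const_ge0 (R : realType) d (lam M k : R) : 0 < lam ->
  0 <= predict_const d lam M k.
Proof.
move=> lam0; apply: I_ge0 => u; apply: mulr_ge0; first by rewrite addr_ge0// sqn_ge0.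
by apply: mulr_ge0; rewrite ?expR_ge0//; apply: mulr_ge0; rewrite ?expR_ge0// ltW// peak_gt0.
Qed.

Section prediction.
Context (R : realType) (d : nat).

(** What the prediction step guarantees about its density, uniformly in the
    measure it starts from; the last clause bounds the covariance from below. *)
Definition prediction_density (C c sig : R) (p : 'cV[R]_d -> R) :=
  [/\ continuous p, forall u, 0 <= p u,
      forall u, p u <= C * expR (- (c * sqn u)), \I p = 1 &
      forall s t, sig * sqn s <= \I (fun u => (dotv s u - t) ^+ 2 * p u)].

Lemma gdom_prediction C c sig p : 0 < c -> prediction_density C c sig p -> gdom p.
Proof.
move=> c0 [cp p0 pC _ _]; split; first exact: continuous_measurable_cV.
by exists C, c; split => // u; rewrite ger0_norm.
Qed.

Context (Psi : 'cV[R]_d -> 'cV[R]_d) (Sigma : 'M[R]_d) (lam M k : R).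
Hypotheses (lam0 : 0 < lam) (k0 : 0 <= k).
Hypothesis eS : elliptic lam M Sigma.
Hypothesis mPsi : measurable_fun setT Psi.
Hypothesis kPsi : forall v, sqn (Psi v) <= k.

Let pS : posdefmx Sigma := elliptic_posdef lam0 eS.

Definition predict (nu : {measure set 'cV[R]_d -> \bar R}) u : R :=
  \int[nu]_v gauss_pdf Sigma (u - Psi v).

Let mg u : measurable_fun setT (fun v => gauss_pdf Sigma (u - Psi v)).
Proof.
apply: (measurableT_comp (measurable_gauss_pdf pS)).
apply: measurable_addmx; first exact: measurable_cst.
exact: measurable_oppmx.
Qed.

Let bg u v : `|gauss_pdf Sigma (u - Psi v)| <= peak d lam * expR (4 * decay d lam M * k)
  * expR (- (2 * decay d lam M * sqn u)).
Proof.
rewrite ger0_norm ?gauss_pdf_ge0//; apply: (le_trans (gauss_pdf_ub lam0 _ _ eS)).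
rewrite ler_wpM2r ?expR_ge0// ler_wpM2l; [by []|exact: ltW (peak_gt0 _ lam0)|].
rewrite ler_expR ler_wpM2l//.
by have := decay_gt0 d M lam0; lra.
Qed.

Let measurable_kernel (F : 'cV[R]_d -> R) : measurable_fun setT F ->
  measurable_fun setT (fun x : 'cV[R]_d * 'cV[R]_d =>
    F x.2 * gauss_pdf Sigma (x.2 - Psi x.1)).
Proof.
move=> mF; apply: measurable_funM.
  exact: (measurableT_comp mF measurable_snd).
apply: (measurableT_comp (measurable_gauss_pdf pS)).
apply: measurable_addmx; first exact: measurable_snd.
by apply: measurable_oppmx; exact: (measurableT_comp mPsi measurable_fst).
Qed.

Section one_measure.
Variable nu : {measure set 'cV[R]_d -> \bar R}.
Hypothesis nu1 : nu setT = 1%E.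

Lemma predict_ge0 u : 0 <= predict nu u.
Proof. by apply: Rintegral_ge0 => v _; exact: gauss_pdf_ge0. Qed.

Lemma predict_le u : predict nu u <=
  peak d lam * expR (4 * decay d lam M * k) * expR (- (2 * decay d lam M * sqn u)).
Proof. by apply: le_trans (ler_norm _) _; exact: (prob_le nu1 (mg u) (bg u)). Qed.

Lemma continuous_predict : continuous (predict nu).
Proof.
have [L L0 HL] := gauss_pdf_shift_lip pS k0.
apply: (locally_lip_continuous L0) => u v uv1 e uve e0.
rewrite -RintegralB//; try exact: prob_integrable nu1 _ _ (mg _) (bg _).
apply: (prob_le nu1); first exact: measurable_funB.
by move=> w; exact: HL.
Qed.

Lemma gdom_predict : gdom (predict nu).
Proof.
split; first exact: (continuous_measurable_cV continuous_predict).
exists (peak d lam * expR (4 * decay d lam M * k)), (2 * decay d lam M).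
split; first by rewrite mulr_gt0// decay_gt0.
by move=> u; rewrite ger0_norm ?predict_ge0// predict_le.
Qed.

Lemma op_PE : op_P Psi Sigma nu = density_measure (lebesgue_cV R d) (predict nu).
Proof.
rewrite /op_P; congr density_measure; apply/funext => u.
rewrite /predict; set c := (Num.sqrt _)^-1.
rewrite -RintegralZl//.
have c0 : 0 < c.
  rewrite invr_gt0 sqrtr_gt0 mulr_gt0 ?posdef_det_gt0//.
  by rewrite exprn_gt0// tau_gt0.
have -> : (fun v => expR (- (2^-1 * wnorm Sigma (u - Psi v) ^+ 2))) =
    (fun v => c^-1 * gauss_pdf Sigma (u - Psi v)).
  by apply/funext => v; rewrite /gauss_pdf -/c mulrA mulVf ?mul1r// gt_eqF.
apply: (prob_integrable nu1
  (A := c^-1 * (peak d lam * expR (4 * decay d lam M * k) * expR (- (2 * decay d lam M * sqn u))))).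
  exact: measurable_funM.
by move=> v; rewrite normrM ger0_norm ?invr_ge0 ?(ltW c0)// ler_wpM2l// invr_ge0 ltW.
Qed.

(** Fubini, justified by the Gaussian envelope. *)
Lemma I_predict (F : 'cV[R]_d -> R) A : measurable_fun setT F ->
  (forall u, `|F u| <= A * (1 + sqn u)) ->
  \I (fun u => F u * predict nu u) =
  \int[nu]_v (\I (fun u => F u * gauss_pdf Sigma (u - Psi v))).
Proof.
move=> mF FA.
pose f (x : 'cV[R]_d * 'cV[R]_d) := (F x.2 * gauss_pdf Sigma (x.2 - Psi x.1))%:E.
have mf : measurable_fun setT f.
  by apply: ((measurable_EFinP _ _).2 _); exact: measurable_kernel.
have gF : gdom (fun u => F u * predict nu u) by apply: gdomM_weight FA gdom_predict.
have inner u : (\int[nu]_v f (v, u) = (F u * predict nu u)%:E)%E.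
  rewrite /predict -RintegralZl//; last exact: prob_integrable nu1 _ _ (mg _) (bg _).
  rewrite /Rintegral fineK//; apply: integrable_fin_num => //.
  apply: (prob_integrable nu1 (A := `|F u| * (peak d lam * expR (4 * decay d lam M * k)
    * expR (- (2 * decay d lam M * sqn u))))); first exact: measurable_funM.
  by move=> v; rewrite normrM ler_wpM2l.
have inner_abs u : (\int[nu]_v `|f (v, u)| = (`|F u * predict nu u|)%:E)%E.
  rewrite normrM (ger0_norm (predict_ge0 u)) /predict -RintegralZl//; last first.
    exact: prob_integrable nu1 _ _ (mg _) (bg _).
  rewrite /Rintegral fineK//; last first.
    apply: integrable_fin_num => //.
    apply: (prob_integrable nu1 (A := `|F u| * (peak d lam * expR (4 * decay d lam M * k)
      * expR (- (2 * decay d lam M * sqn u))))); first exact: measurable_funM.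
    by move=> v; rewrite normrM normr_id ler_wpM2l.
  apply: eq_integral => v _; rewrite /f abse_EFin normrM.
  by rewrite (ger0_norm (gauss_pdf_ge0 _ _)).
have fin : (\int[lebesgue_cV R d]_u \int[nu]_v `|f (v, u)| < +oo)%E.
  rewrite (eq_integral (fun u => (`|F u * predict nu u|)%:E)).
    by rewrite -EFin_I ?ltry//; exact: gdom_norm.
  by move=> u _; exact: inner_abs.
have H : ((\I (fun u => F u * predict nu u))%:E =
    \int[nu]_v \int[lebesgue_cV R d]_u f (v, u))%E.
  rewrite -(prob_fubini nu1 mf fin) EFin_I//.
  by apply: eq_integral => u _; rewrite inner.
have -> : \I (fun u => F u * predict nu u) = fine ((\I (fun u => F u * predict nu u))%:E).
  by [].
rewrite H /Rintegral; congr fine; apply: eq_integral => v _.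
by rewrite /f /= EFin_I//; exact: (gdomM_weight mF FA (gdom_gauss_pdf pS _)).
Qed.

Lemma I_predict1 : \I (predict nu) = 1.
Proof.
have := @I_predict (fun=> 1) 1 (measurable_cst _).
rewrite (_ : (fun u => 1 * predict nu u) = predict nu); last first.
  by apply/funext => u; rewrite mul1r.
move=> ->; last by move=> u; rewrite normr1 mul1r weight_ge1.
rewrite -[RHS](prob_cst nu1); apply: eq_Rintegral => v _.
by rewrite -[RHS](I_gauss_pdf pS (Psi v)); apply: eq_I => u; rewrite mul1r.
Qed.

(** The bounded drift only shifts the Gaussian noise, which gives the envelope, and
    the covariance of the noise is a lower bound for that of the prediction. *)
Lemma predict_density : prediction_density
  (peak d lam * expR (4 * decay d lam M * k)) (2 * decay d lam M) lam (predict nu).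
Proof.
split; [exact: continuous_predict|exact: predict_ge0|exact: predict_le|exact: I_predict1|].
move=> s t.
have dB u : `|(dotv s u - t) ^+ 2| <= (2 * sqn s + 2 * t ^+ 2) * (1 + sqn u).
  by rewrite ger0_norm ?sqr_ge0//; exact: dotv_sqr_le.
rewrite (I_predict (measurable_dotv_sqr s t) dB).
under eq_Rintegral do rewrite I_gauss_quad//.
have [_ Sl _] := eS.
have m2 : measurable_fun setT (fun v => qform Sigma s + (dotv s (Psi v) - t) ^+ 2).
  apply: measurable_funD => //.
  exact: (measurableT_comp (measurable_dotv_sqr s t) mPsi).
rewrite -[leLHS](prob_cst nu1); apply: le_Rintegral => //.
- by apply: (prob_integrable nu1 (A := `|lam * sqn s|)).
- apply: (prob_integrable nu1
    (A := qform Sigma s + (2 * sqn s + 2 * t ^+ 2) * (1 + k))) => // v.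
  have q0 : 0 <= qform Sigma s.
    by apply: le_trans (Sl s); rewrite mulr_ge0 ?sqn_ge0// ltW.
  rewrite ger0_norm ?addr_ge0 ?sqr_ge0// lerD2l.
  apply: (le_trans (dotv_sqr_le _ _ _)); rewrite ler_wpM2l ?lerD2l//.
  by rewrite addr_ge0// mulr_ge0// ?sqn_ge0 ?sqr_ge0.
- move=> v _; apply: (le_trans (Sl s)); rewrite lerDl; exact: sqr_ge0.
Qed.

End one_measure.

(** The weight is integrated against Gaussians of bounded mean, so that a total
    variation bound before the prediction becomes a weighted one after it. *)
Lemma predict_lip (nu nu' : {measure set 'cV[R]_d -> \bar R}) (e : R) :
  nu setT = 1%E -> nu' setT = 1%E ->
  (forall (f : 'cV[R]_d -> R) A, measurable_fun setT f -> (forall v, `|f v| <= A) ->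
    `|\int[nu]_v f v - \int[nu']_v f v| <= A * e) ->
  \I (fun u => (1 + sqn u) * `|predict nu u - predict nu' u|) <=
  predict_const d lam M k * e.
Proof.
pose Cp := peak d lam * expR (4 * decay d lam M * k).
have dc0 : 0 < 2 * decay d lam M by rewrite mulr_gt0// decay_gt0.
have gE := gdom_weight (gdom_exp d Cp dc0).
move=> n1 n1' tv.
have g := gdom_predict n1; have g' := gdom_predict n1'.
pose F u := (1 + sqn u) * (if predict nu u - predict nu' u < 0 then -1 else 1).
have mF : measurable_fun setT F.
  apply: measurable_funM; first exact: measurable_weight.
  apply: measurable_fun_ifT => //.
  by apply: measurable_fun_ltr => //; apply: measurable_funB; exact: gdom_meas.
have FW u : `|F u| <= 1 * (1 + sqn u).
  rewrite /F normrM mul1r ger0_norm; last by rewrite (le_trans ler01)// weight_ge1.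
  by case: ifP; rewrite ?normrN normr1 mulr1.
have -> : \I (fun u => (1 + sqn u) * `|predict nu u - predict nu' u|) =
    \I (fun u => F u * predict nu u) - \I (fun u => F u * predict nu' u).
  rewrite -I_B; [|exact: gdomM_weight FW g|exact: gdomM_weight FW g'].
  apply: eq_I => u; rewrite -mulrBr /F -mulrA; congr (_ * _).
  by case: ltP => h; [rewrite ltr0_norm// mulN1r|rewrite ger0_norm// mul1r].
rewrite (I_predict n1 mF FW) (I_predict n1' mF FW).
apply: le_trans (ler_norm _) _; apply: tv => [|v].
  apply: (measurable_I_param (f := fun x => F x.2 * gauss_pdf Sigma (x.2 - Psi x.1))).
  exact: measurable_kernel.
have gv := gdom_gauss_pdf pS (Psi v).
apply: (le_trans (I_norm_le (gdomM_weight mF FW gv))).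
apply: I_le => [||u] //; first exact/gdom_norm/(gdomM_weight mF FW gv).
rewrite normrM; apply: ler_pM => //.
by rewrite -[leRHS]mul1r.
Qed.

End prediction.

(** * The joint law of state and observation *)

Section moments_of_density.
Context (R : realType) (n : nat) (rho : 'cV[R]_n -> R).
Hypotheses (grho : gdom rho) (rho0 : forall v, 0 <= rho v) (rho1 : \I rho = 1).

Definition dmean : 'cV[R]_n := \col_i \I (fun v : 'cV[R]_n => v i ord0 * rho v).

Definition dcov : 'M[R]_n := \matrix_(i, j)
  (\I (fun v : 'cV[R]_n => v i ord0 * v j ord0 * rho v) - dmean i ord0 * dmean j ord0).

Lemma dcov_tr : dcov^T = dcov.
Proof.
apply/matrixP => i j; rewrite !mxE; congr (_ - _); last by rewrite mulrC.
by apply: eq_I => v; rewrite (mulrC (v j ord0)).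
Qed.

Lemma qform_dcov s : qform dcov s =
  \I (fun v => (dotv s v - dotv s dmean) ^+ 2 * rho v).
Proof.
rewrite I_quad// rho1 mulr1; set t := dotv s dmean.
have tE : t = dotv s dmean by []; clearbody t.
have -> : \sum_i (- (2 * t * s i ord0)) * \I (fun v : 'cV[R]_n => v i ord0 * rho v) =
    - (2 * t ^+ 2).
  transitivity (- (2 * t) * dotv s dmean); last by rewrite -tE; ring.
  by rewrite /dotv mulr_sumr; apply: eq_bigr => i _; rewrite mxE; ring.
have -> : \sum_i \sum_j s i ord0 * s j ord0 *
    \I (fun v : 'cV[R]_n => v i ord0 * v j ord0 * rho v) = qform dcov s + t ^+ 2.
  transitivity (qform dcov s + dotv s dmean * dotv s dmean); last by rewrite -tE expr2.
  rewrite qformE {2}/dotv mulr_suml {1}/dotv -big_split/=; apply: eq_bigr => i _.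
  rewrite mxE mulr_sumr /dotv mulr_sumr -big_split/=; apply: eq_bigr => j _.
  by rewrite [dcov i j]mxE; ring.
ring.
Qed.

Variable mu : {measure set 'cV[R]_n -> \bar R}.
Hypothesis muE : forall A, measurable A ->
  mu A = density_measure (lebesgue_cV R n) rho A.

Lemma Rintegral_of_density (f : 'cV[R]_n -> R) A : measurable_fun setT f ->
  (forall v, `|f v| <= A * (1 + sqn v)) ->
  \int[mu]_v f v = \I (fun v => f v * rho v).
Proof.
move=> mf fA; rewrite -(Rintegral_density grho rho0 mf fA) /Rintegral.
by congr fine; apply: eq_measure_integral => A' mA' _; exact: muE.
Qed.

Lemma mean_density : mean mu = dmean.
Proof.
apply/colP => i; rewrite !mxE.
apply: (Rintegral_of_density (A := 1)); first exact: measurable_coord.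
by move=> v; rewrite mul1r coord_le_weight.
Qed.

Lemma covariance_density : covariance_mx mu = dcov.
Proof.
apply/matrixP => i j; rewrite mxE mean_density [RHS]mxE.
set a := dmean i ord0; set b := dmean j ord0.
have ga k : gdom (fun v : 'cV[R]_n => v k ord0 * rho v) by exact: gdomM_coord.
have gij := gdom_coord2 i j grho.
have mc k : measurable_fun setT (fun v : 'cV[R]_n => v k ord0) by exact: measurable_coord.
have wi (v : 'cV[R]_n) k := coord_le_weight v k.
rewrite (Rintegral_of_density (A := 1 + `|b| + `|a| + `|a * b|)).
- rewrite (eq_I (g := fun v : 'cV[R]_n => (v i ord0 * v j ord0 * rho v +
     ((- b) * (v i ord0 * rho v) + (- a) * (v j ord0 * rho v))) + (a * b) * rho v)).
    rewrite I_D; [|by apply: gdomD => //; apply: gdomD; exact: gdomZ|exact: gdomZ].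
    rewrite I_D; [|by []|by apply: gdomD; exact: gdomZ].
    rewrite I_D; [|exact: gdomZ|exact: gdomZ].
    rewrite (I_Z _ (ga i)) (I_Z _ (ga j)) (I_Z _ grho) rho1.
    rewrite (_ : \I (fun v : 'cV[R]_n => v i ord0 * rho v) = a); last by rewrite /a mxE.
    rewrite (_ : \I (fun v : 'cV[R]_n => v j ord0 * rho v) = b); last by rewrite /b mxE.
    by ring.
  by move=> v; ring.
- by apply: measurable_funM; apply: measurable_funB.
move=> v; have -> : (v i ord0 - a) * (v j ord0 - b) =
   v i ord0 * v j ord0 - b * v i ord0 - a * v j ord0 + a * b by ring.
have hij := coord2_le_weight v i j.
apply: (le_trans (ler_normD _ _)); rewrite mulrDl; apply: lerD; last first.
  by rewrite ler_peMr// weight_ge1.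
apply: (le_trans (ler_normB _ _)); rewrite mulrDl; apply: lerD; last first.
  by rewrite normrM ler_wpM2l.
apply: (le_trans (ler_normB _ _)); rewrite mulrDl mul1r; apply: lerD => //.
by rewrite normrM ler_wpM2l.
Qed.

End moments_of_density.

Section joint_density.
Context (R : realType) (d K : nat).

Definition joint (Gamma : 'M[R]_K) (h : 'cV[R]_d -> 'cV[R]_K) (p : 'cV[R]_d -> R)
    (v : 'cV[R]_(d + K)) : R :=
  p (usubmx v) * gauss_pdf Gamma (dsubmx v - h (usubmx v)).

Lemma jointE Gamma h p u y :
  joint Gamma h p (col_mx u y) = p u * gauss_pdf Gamma (y - h u).
Proof. by rewrite /joint col_mxKu col_mxKd. Qed.

Lemma joint_ge0 Gamma h p v : (forall u, 0 <= p u) -> 0 <= joint Gamma h p v.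
Proof. by move=> p0; rewrite mulr_ge0// gauss_pdf_ge0. Qed.

Context (C c sig lam M kh : R).
Hypotheses (c0 : 0 < c) (sig0 : 0 < sig) (lam0 : 0 < lam) (kh0 : 0 <= kh).

Let CJ := C * (peak K lam * expR (4 * decay K lam M * kh)).
Let cJ := Num.min c (2 * decay K lam M).

Let cJ0 : 0 < cJ.
Proof. by rewrite lt_min c0/= mulr_gt0// decay_gt0. Qed.

Section one_model.
Variables (Gamma : 'M[R]_K) (h : 'cV[R]_d -> 'cV[R]_K) (p : 'cV[R]_d -> R).
Hypotheses (eG : elliptic lam M Gamma) (ch : continuous h).
Hypotheses (hh : forall u, sqn (h u) <= kh) (pp : prediction_density C c sig p).

Let pG : posdefmx Gamma := elliptic_posdef lam0 eG.
Let p0 u : 0 <= p u. Proof. by case: pp. Qed.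
Let gp : gdom p := gdom_prediction c0 pp.
Let p1 : \I p = 1. Proof. by case: pp. Qed.

Lemma measurable_obs : measurable_fun setT h.
Proof.
apply: measurable_fun_mxP => i j.
have cij : continuous ((fun M : 'cV[R]_K => M i j) \o h).
  by move=> u; apply: continuous_comp; [exact: ch|exact: coord_continuous].
exact: continuous_measurable_cV cij.
Qed.

Lemma continuous_joint : continuous (joint Gamma h p).
Proof.
have [cp _ _ _ _] := pp; have cg := continuous_gauss_pdf pG.
move=> v; apply: (@continuousM _ _ (p \o usubmx)
  (gauss_pdf Gamma \o (fun v => dsubmx v - h (usubmx v)))).
  by apply: continuous_comp; [exact: continuous_usubmx|exact: cp].
apply: continuous_comp; last exact: cg.
apply: continuousB; first exact: continuous_dsubmx.
by apply: continuous_comp; [exact: continuous_usubmx|exact: ch].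
Qed.

Lemma joint_le v : joint Gamma h p v <= CJ * expR (- (cJ * sqn v)).
Proof.
have [_ _ pC _ _] := pp.
rewrite -(vsubmxK v) jointE; set u := usubmx v; set y := dsubmx v.
have gy : gauss_pdf Gamma (y - h u) <=
    peak K lam * expR (4 * decay K lam M * kh) * expR (- (2 * decay K lam M * sqn y)).
  apply: (le_trans (gauss_pdf_ub lam0 _ _ eG)).
  rewrite ler_wpM2r ?expR_ge0// ler_wpM2l//; first exact: ltW (peak_gt0 _ lam0).
  rewrite ler_expR ler_wpM2l//.
  by have := decay_gt0 K M lam0; lra.
apply: (le_trans (ler_pM (p0 u) (gauss_pdf_ge0 _ _) (pC u) gy)).
rewrite sqn_col_mx; set eu := expR (- (c * sqn u)).
set ey := expR (- (2 * decay K lam M * sqn y)).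
have -> : C * eu * (peak K lam * expR (4 * decay K lam M * kh) * ey) = CJ * (eu * ey).
  by rewrite /CJ; ring.
have C0 : 0 <= CJ.
  have := le_trans (p0 0) (pC 0); rewrite pmulr_lge0 ?expR_gt0// => C0.
  by rewrite /CJ mulr_ge0// mulr_ge0 ?expR_ge0// ltW// peak_gt0.
rewrite ler_wpM2l// /eu /ey -expRD ler_expR.
have h1 : cJ * sqn u <= c * sqn u by rewrite ler_wpM2r ?sqn_ge0// ge_min lexx.
have h2 : cJ * sqn y <= 2 * decay K lam M * sqn y.
  by rewrite ler_wpM2r ?sqn_ge0// ge_min lexx orbT.
by rewrite mulrDr; lra.
Qed.

Lemma gdom_joint : gdom (joint Gamma h p).
Proof.
split; first exact: (continuous_measurable_cV continuous_joint).
exists CJ, cJ; split => // v; rewrite ger0_norm ?joint_le//.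
exact: joint_ge0.
Qed.

Lemma I_joint (F : 'cV[R]_(d + K) -> R) A : measurable_fun setT F ->
  (forall v, `|F v| <= A * (1 + sqn v)) ->
  \I (fun v => F v * joint Gamma h p v) =
  \I (fun u => p u * \I (fun y => F (col_mx u y) * gauss_pdf Gamma (y - h u))).
Proof.
move=> mF FA; rewrite I_col_mx; last exact: gdomM_weight FA gdom_joint.
apply: eq_I => u; rewrite -I_Z.
  by apply: eq_I => y; rewrite jointE; ring.
apply: (gdomM_weight (A := `|A| * (1 + sqn u))); last exact: gdom_gauss_pdf.
  by apply: (measurableT_comp mF); apply: measurable_col_mx.
move=> y; apply: (le_trans (FA _)); rewrite sqn_col_mx.
have su := sqn_ge0 u; have sy := sqn_ge0 y.
have := ler_norm A; have : 0 <= sqn u * sqn y by rewrite mulr_ge0.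
have w0 : 0 <= 1 + (sqn u + sqn y) by rewrite addr_ge0// addr_ge0.
move=> m H; apply: (le_trans (ler_wpM2r w0 H)); rewrite -mulrA ler_wpM2l//.
by lra.
Qed.

Lemma I_joint1 : \I (joint Gamma h p) = 1.
Proof.
have := @I_joint (fun=> 1) 1 (measurable_cst _).
have -> : (fun v => 1 * joint Gamma h p v) = joint Gamma h p.
  by apply/funext => v; rewrite mul1r.
move=> ->; last by move=> v; rewrite normr1 mul1r weight_ge1.
rewrite -[RHS]p1; apply: eq_I => u.
rewrite -[RHS]mulr1; congr (_ * _).
by rewrite -[RHS](I_gauss_pdf pG (h u)); apply: eq_I => y; rewrite mul1r.
Qed.

Let quad_mean_weight s1 s2 t u : (dotv s1 u + dotv s2 (h u) - t) ^+ 2 <=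
  (2 * (2 * sqn s1 + 2 * t ^+ 2) + 2 * (sqn s2 * kh)) * (1 + sqn u).
Proof.
have h1 := dotv_sqr_le s1 u t; have h2 := dotv_CS s2 (h u).
have h3 : sqn s2 * sqn (h u) <= sqn s2 * kh by rewrite ler_wpM2l// sqn_ge0.
have h4 := sqr_ge0 (dotv s1 u - t - dotv s2 (h u)).
have h5 : 0 <= sqn s2 * kh * sqn u.
  by rewrite mulr_ge0 ?sqn_ge0//; apply: le_trans h3; rewrite mulr_ge0// sqn_ge0.
by nra.
Qed.

Lemma gdom_quad_mean s1 s2 t :
  gdom (fun u => (dotv s1 u + dotv s2 (h u) - t) ^+ 2 * p u).
Proof.
apply: (gdomM_weight (A := 2 * (2 * sqn s1 + 2 * t ^+ 2) + 2 * (sqn s2 * kh))) gp.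
  apply: measurable_funX; apply: measurable_funB => //.
  apply: measurable_funD; apply: measurable_sum => i; apply: measurable_funM => //.
    exact: measurable_coord.
  exact: measurable_mx_coord measurable_obs.
by move=> u; rewrite ger0_norm ?sqr_ge0.
Qed.

(** The noise is independent of the state: integrating it out first adds its own
    covariance and replaces the observation by [h u]. *)
Lemma I_joint_quad s1 s2 t :
  \I (fun v => (dotv (col_mx s1 s2) v - t) ^+ 2 * joint Gamma h p v) =
  qform Gamma s2 + \I (fun u => (dotv s1 u + dotv s2 (h u) - t) ^+ 2 * p u).
Proof.
set s := col_mx s1 s2.
rewrite (I_joint (measurable_dotv_sqr s t) (A := 2 * sqn s + 2 * t ^+ 2)); last first.
  by move=> v; rewrite ger0_norm ?sqr_ge0//; exact: dotv_sqr_le.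
have inner u : \I (fun y => (dotv s (col_mx u y) - t) ^+ 2 * gauss_pdf Gamma (y - h u)) =
    qform Gamma s2 + (dotv s1 u + dotv s2 (h u) - t) ^+ 2.
  rewrite (eq_I (g := fun y => (dotv s2 y - (t - dotv s1 u)) ^+ 2 *
    gauss_pdf Gamma (y - h u))).
    by rewrite I_gauss_quad//; congr (_ + _ ^+ 2); ring.
  move=> y; congr (_ ^+ 2 * _); rewrite /s /dotv big_split_ord/=.
  under eq_bigr do rewrite !col_mxEu.
  under [X in _ + X - _]eq_bigr do rewrite !col_mxEd.
  by ring.
rewrite (eq_I (g := fun u => qform Gamma s2 * p u +
  (dotv s1 u + dotv s2 (h u) - t) ^+ 2 * p u)); last first.
  by move=> u; rewrite inner mulrC mulrDl.
by rewrite (I_D (gdomZ _ gp) (gdom_quad_mean s1 s2 t)) I_Z// p1 mulr1.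
Qed.

Lemma op_QE A : measurable A ->
  op_Q h Gamma (density_measure (lebesgue_cV R d) p) A =
  (\int[lebesgue_cV R (d + K)]_(v in A) (joint Gamma h p v)%:E)%E.
Proof.
move=> mA; set mu := density_measure (lebesgue_cV R d) p.
have mu1 : mu setT = 1%E by rewrite [LHS](density_total gp p0) p1.
pose phi (x : 'cV[R]_d * 'cV[R]_K) := gauss_pdf Gamma (x.2 - h x.1).
have mphi : measurable_fun setT phi.
  apply: (measurableT_comp (measurable_gauss_pdf pG)).
  apply: measurable_addmx; first exact: measurable_snd.
  apply: measurable_oppmx; exact: (measurableT_comp measurable_obs measurable_fst).
have -> : op_Q h Gamma mu A =
    density_measure (mu \x lebesgue_cV R K)%E phi (@pair_cV R d K @^-1` A) by [].
rewrite /density_measure asboolT; last by split => // x; exact: gauss_pdf_ge0.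
pose g (x : 'cV[R]_d * 'cV[R]_K) : \bar R := ((phi x)%:E * (\1_A (pair_cV x))%:E)%E.
have mg : measurable_fun setT g.
  apply: emeasurable_funM; first by apply: ((measurable_EFinP _ _).2 _).
  apply: ((measurable_EFinP _ (\1_A \o @pair_cV R d K : _ -> R)).2 _).
  exact: (measurableT_comp (measurable_indic mA) (@measurable_pair_cV R d K)).
have g0 x : (0 <= g x)%E.
  by apply: mule_ge0; rewrite lee_fin; [exact: gauss_pdf_ge0|rewrite indicE ler0n].
transitivity (\int[mu \x lebesgue_cV R K]_x g x)%E.
  rewrite integral_mkcond; apply: eq_integral => x _.
  by rewrite epatch_indic/= /g; congr (_ * _)%E; rewrite !indicE.
rewrite (prob_tonelli mu1 mg g0).
have mG : measurable_fun setT (fun u => \int[lebesgue_cV R K]_y g (u, y))%E.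
  exact: (measurable_fun_fubini_tonelli_F g mg g0).
rewrite ge0_integral_density//; [|exact: gdom_meas|by move=> u; exact: integral_ge0].
rewrite [RHS]integral_mkcond integral_col_mx.
- apply: eq_integral => u _; rewrite muleC -ge0_integralZl//.
  + apply: eq_integral => y _; rewrite epatch_indic/= jointE /g muleA -EFinM.
    by rewrite !indicE.
  + by apply: measurableT_comp => //; exact: measurable_pair1.
  + by rewrite lee_fin p0.
- rewrite epatch_indic; apply: emeasurable_funM.
    by apply: ((measurable_EFinP _ _).2 _); exact: gdom_meas gdom_joint.
  by apply: ((measurable_EFinP _ (\1_A : _ -> R)).2 _); exact: measurable_indic.
- move=> v; rewrite epatch_indic/=; apply: mule_ge0; rewrite lee_fin.
    exact: joint_ge0.
  by rewrite indicE ler0n.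
Qed.

End one_model.

(** The noise bounds the covariance from below in the directions of the
    observation, the prediction in those of the state. The two are coupled
    through [h]; as it is bounded, keeping only a small fraction [eps] of the
    contribution of the state lets half of the noise absorb the coupling. The
    upper bounds come from the Gaussian envelope of the joint density. *)
Lemma joint_elliptic : exists lam' M' r : R, [/\ 0 < lam', 0 < M', 0 <= r &
  forall Gamma h p, elliptic lam M Gamma -> continuous h ->
    (forall u, sqn (h u) <= kh) -> prediction_density C c sig p ->
    elliptic lam' M' (dcov (joint Gamma h p)) /\ sqn (dmean (joint Gamma h p)) <= r].
Proof.
pose eps := lam / (lam + 2 * kh).
have den0 : 0 < lam + 2 * kh by rewrite ltr_wpDr// mulr_ge0.
have eps0 : 0 < eps by rewrite divr_gt0.
have eps1 : eps <= 1 by rewrite ler_pdivrMr// mul1r lerDl mulr_ge0.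
have epskh : eps * kh <= lam / 2.
  rewrite /eps mulrAC ler_pdivrMr//.
  have : 0 <= lam * lam by rewrite mulr_ge0// ltW.
  by lra.
pose Mw := \I (fun v : 'cV[R]_(d + K) => (1 + sqn v) * (CJ * expR (- (cJ * sqn v)))).
exists (Num.min (lam / 2) (eps / 2 * sig)), (1 + (`|Mw| + Mw ^+ 2)), ((d + K)%:R * Mw ^+ 2).
split.
- by rewrite lt_min divr_gt0//= mulr_gt0// divr_gt0.
- by rewrite ltr_wpDr// addr_ge0// sqr_ge0.
- by rewrite mulr_ge0// sqr_ge0.
move=> Gamma h p eG ch hh pp.
have gJ := gdom_joint eG ch hh pp.
have J0 v : 0 <= joint Gamma h p v by apply: joint_ge0; case: pp.
have J1 := I_joint1 eG ch hh pp.
have gw := gdom_weight (gdom_exp (d + K) CJ cJ0).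
have IW (f : 'cV[R]_(d + K) -> R) : measurable_fun setT f ->
    (forall v, `|f v| <= 1 + sqn v) -> `|\I (fun v => f v * joint Gamma h p v)| <= Mw.
  move=> mf fW; have gf : gdom (fun v => f v * joint Gamma h p v).
    by apply: (gdomM_weight (A := 1)) gJ => // v; rewrite mul1r.
  apply: (le_trans (I_norm_le gf)); apply: I_le => [||v] //; first exact: gdom_norm.
  rewrite normrM (ger0_norm (J0 v)); apply: ler_pM => //.
  exact: joint_le eG hh pp v.
have mB i : `|dmean (joint Gamma h p) i ord0| <= Mw.
  by rewrite mxE; apply: IW => [|v]; [exact: measurable_coord|exact: coord_le_weight].
have Mw0 : 0 <= Mw.
  apply: (le_trans (normr_ge0 _) (IW (fun=> 0) (measurable_cst _) _)) => v.
  by rewrite normr0 addr_ge0// sqn_ge0.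
split; [split|].
- exact: dcov_tr.
- move=> s; rewrite (qform_dcov gJ J1); set t := dotv s _.
  set s1 := usubmx s; set s2 := dsubmx s.
  have sE : s = col_mx s1 s2 by rewrite vsubmxK.
  have -> : \I (fun v => (dotv s v - t) ^+ 2 * joint Gamma h p v) =
      \I (fun v => (dotv (col_mx s1 s2) v - t) ^+ 2 * joint Gamma h p v).
    by apply: eq_I => v; rewrite -sE.
  rewrite (I_joint_quad eG ch hh pp).
  have gp := gdom_prediction c0 pp; have [_ p0 _ p1 psig] := pp.
  have gm := gdom_quad_mean ch hh pp s1 s2 t.
  have -> : qform Gamma s2 + \I (fun u => (dotv s1 u + dotv s2 (h u) - t) ^+ 2 * p u) =
      \I (fun u => qform Gamma s2 * p u + (dotv s1 u + dotv s2 (h u) - t) ^+ 2 * p u).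
    by rewrite (I_D (gdomZ _ gp) gm) I_Z// p1 mulr1.
  have [_ Gl _] := eG.
  have gq := gdomM_quad s1 t gp.
  have glow : gdom (fun u => (lam / 2 * sqn s2) * p u +
      (eps / 2) * ((dotv s1 u - t) ^+ 2 * p u)) by apply: gdomD; exact: gdomZ.
  apply: (@le_trans _ _ (\I (fun u => (lam / 2 * sqn s2) * p u +
      (eps / 2) * ((dotv s1 u - t) ^+ 2 * p u)))).
    rewrite I_D; [|exact: gdomZ|exact: gdomZ].
    rewrite I_Z// I_Z// p1 mulr1.
    rewrite {1}sE sqn_col_mx mulrDr addrC; apply: lerD.
      by rewrite ler_wpM2r ?sqn_ge0// ge_min lexx.
    apply: (@le_trans _ _ (eps / 2 * (sig * sqn s1))).
      by rewrite mulrA ler_wpM2r ?sqn_ge0// ge_min lexx orbT.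
    by rewrite ler_wpM2l// divr_ge0// ltW.
  apply: I_le => // [|u].
    by apply: gdomD gm; exact: gdomZ.
  rewrite [X in _ + X <= _]mulrA -mulrDl -mulrDl ler_wpM2r//.
  have h1 := Gl s2; have h2 := dotv_CS s2 (h u).
  have h3 : sqn s2 * sqn (h u) <= sqn s2 * kh by rewrite ler_wpM2l// sqn_ge0.
  set a := dotv s1 u - t; set b := dotv s2 (h u) in h2 *.
  have -> : dotv s1 u + b - t = a + b by rewrite /a; ring.
  have h4 : eps * (a ^+ 2 / 2 - b ^+ 2) <= (a + b) ^+ 2.
    have h5 := sqr_ge0 (a + 2 * b); have h6 := sqr_ge0 (a + b).
    have [h7|h7] := leP 0 (a ^+ 2 / 2 - b ^+ 2).
      apply: (@le_trans _ _ (a ^+ 2 / 2 - b ^+ 2)); last by nra.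
      by rewrite ler_piMl.
    by apply: le_trans h6; rewrite mulr_ge0_le0// ltW.
  have h8 : eps * b ^+ 2 <= lam / 2 * sqn s2.
    apply: (@le_trans _ _ (eps * (sqn s2 * kh))).
      by rewrite ler_wpM2l ?(ltW eps0)//; lra.
    by rewrite mulrCA mulrC ler_wpM2r// sqn_ge0.
  by rewrite mulrBr in h4; lra.
- move=> i j; rewrite mxE; apply: (le_trans (ler_normB _ _)).
  apply: (@le_trans _ _ (Mw + Mw * Mw)).
    apply: lerD; last by rewrite normrM ler_pM.
    apply: IW; first by apply: measurable_funM; exact: measurable_coord.
    by move=> v; exact: coord2_le_weight.
  by rewrite (ger0_norm Mw0) expr2; lra.
rewrite -[X in X%:R * _](card_ord (d + K)) mulr_natl -sumr_const.
apply: ler_sum => i _; rewrite -[leLHS]real_normK ?num_real//.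
by rewrite !expr2 ler_pM.
Qed.

End joint_density.

(** * Stability of the Gaussian analysis *)

Section gaussian_slices.
Context (R : realType) (d K : nat) (lam M r ky : R).
Hypotheses (lam0 : 0 < lam) (M0 : 0 < M) (r0 : 0 <= r).

(** The unnormalised conditional density, given the observation [y], of a
    Gaussian vector. *)
Definition gslice (S : 'M[R]_(d + K)) (m : 'cV[R]_(d + K)) (y : 'cV[R]_K)
  (u : 'cV[R]_d) : R := gauss_pdf S (col_mx u y - m).

Lemma gslice_ge0 S m y u : 0 <= gslice S m y u.
Proof. exact: gauss_pdf_ge0. Qed.

Lemma gdom_gslice S m y : posdefmx S -> gdom (gslice S m y).
Proof.
by move=> pS; have := gdom_col_mxl y (gdom_gauss_pdf pS m).
Qed.

Lemma gslice_lb : exists2 z : R, 0 < z & forall S m y,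
  elliptic lam M S -> sqn m <= r -> sqn y <= ky -> z <= \I (gslice S m y).
Proof.
have [c [b [c0 b0 H]]] := gauss_pdf_lb (d + K) lam0 M0.
have b2 : 0 < 2 * b by rewrite mulr_gt0.
have k0 : 0 < c * expR (- (b * (2 * ky + 2 * r))) by rewrite mulr_gt0// expR_gt0.
exists (c * expR (- (b * (2 * ky + 2 * r))) *
    \I (fun u : 'cV[R]_d => expR (- (2 * b * sqn u)))).
  rewrite mulr_gt0// I_exp_sqn// exprn_gt0// mulr_gt0 ?invr_gt0 ?sqrtr_gt0//.
  exact: pi_gt0.
move=> S m y eS mr yk; rewrite -I_Z; last exact: gdom_expR.
apply: I_le => [||u].
- by apply: gdomZ; exact: gdom_expR.
- exact: gdom_gslice (elliptic_posdef lam0 eS).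
apply: le_trans (H S _ eS); rewrite -mulrA ler_pM2l// -expRD ler_expR.
have := sqnB_le (col_mx u y) m; rewrite sqn_col_mx => h.
have : b * sqn (col_mx u y - m) <= b * (2 * (sqn u + ky) + 2 * r).
  by rewrite ler_pM2l//; lra.
lra.
Qed.

Lemma gslice_ub : exists B : R, forall S m y,
  elliptic lam M S -> sqn m <= r ->
  \I (fun u => (1 + sqn u) * gslice S m y u) <= B.
Proof.
pose k := decay (d + K) lam M.
have k0 : 0 < 2 * k by rewrite mulr_gt0// decay_gt0.
pose A := peak (d + K) lam * expR (4 * k * r).
exists (\I (fun u : 'cV[R]_d => (1 + sqn u) * (A * expR (- (2 * k * sqn u))))).
move=> S m y eS mr; apply: I_le => [||u].
- exact/gdom_weight/(gdom_gslice _ _ (elliptic_posdef lam0 eS)).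
- exact/gdom_weight/gdom_exp.
rewrite ler_wpM2l; [by []|by rewrite addr_ge0// sqn_ge0|].
apply: (le_trans (gauss_pdf_ub lam0 _ _ eS)).
apply: ler_pM; rewrite ?expR_ge0//.
- by rewrite mulr_ge0 ?expR_ge0// ltW// peak_gt0.
- rewrite ler_pM2l ?peak_gt0// ler_expR ler_wpM2l//.
  by have := decay_gt0 (d + K) M lam0; lra.
rewrite ler_expR lerN2 sqn_col_mx ler_pM2l// lerDl; exact: sqn_ge0.
Qed.

Lemma gslice_lip : exists2 L : R, 0 <= L & forall S1 S2 m1 m2 y (e : R),
  elliptic lam M S1 -> elliptic lam M S2 -> 0 <= e ->
  sqn m1 <= r -> sqn m2 <= r ->
  (forall i j, `|S1 i j - S2 i j| <= e) ->
  (forall i, `|m1 i ord0 - m2 i ord0| <= e) ->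
  \I (fun u => (1 + sqn u) * `|gslice S1 m1 y u - gslice S2 m2 y u|) <= L * e.
Proof.
have [L L0 HL] := gauss_pdf_lip (d + K) lam0 M0 r0.
have k0 := decay_gt0 (d + K) M lam0; set k := decay _ _ _ in HL k0.
have gE : gdom (fun u : 'cV[R]_d => (1 + sqn u) * expR (- (k * sqn u))).
  exact/gdom_weight/gdom_expR.
exists (L * \I (fun u : 'cV[R]_d => (1 + sqn u) * expR (- (k * sqn u)))).
  rewrite mulr_ge0//; apply: I_ge0 => u.
  by rewrite mulr_ge0 ?expR_ge0// addr_ge0// sqn_ge0.
move=> S1 S2 m1 m2 y e e1 e2 e0 r1 r2 S12 m12.
rewrite mulrAC -I_Z//; apply: I_le => [||u]; last 1 first.
- have w0 : 0 <= 1 + sqn u by rewrite addr_ge0// sqn_ge0.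
  rewrite mulrCA; apply: ler_wpM2l => //.
  apply: (le_trans (HL _ _ _ _ e e1 e2 e0 r1 r2 S12 m12 (col_mx u y))).
  rewrite ler_wpM2l ?mulr_ge0// ler_expR lerN2 ler_pM2l// sqn_col_mx lerDl.
  exact: sqn_ge0.
- apply/gdom_weight/gdom_norm/gdomB.
    exact: gdom_gslice (elliptic_posdef lam0 e1).
  exact: gdom_gslice (elliptic_posdef lam0 e2).
- exact: gdomZ.
Qed.

End gaussian_slices.

Section moment_stability.
Context (R : realType) (d K : nat).
Context (C c sig lam M kh r : R).
Hypotheses (c0 : 0 < c) (lam0 : 0 < lam) (r0 : 0 <= r).

(** A prediction error propagates to the first two moments of the joint law,
    since the observation kernel has moments of the order of the weight. *)
Lemma moments_lip : exists2 L : R, 0 <= L &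
  forall (Gamma : 'M[R]_K) (h : 'cV[R]_d -> 'cV[R]_K) p p' (e : R),
  elliptic lam M Gamma -> continuous h -> (forall u, sqn (h u) <= kh) ->
  prediction_density C c sig p -> prediction_density C c sig p' ->
  sqn (dmean (joint Gamma h p)) <= r -> sqn (dmean (joint Gamma h p')) <= r ->
  \I (fun u => (1 + sqn u) * `|p u - p' u|) <= e ->
  (forall i, `|dmean (joint Gamma h p) i ord0 - dmean (joint Gamma h p') i ord0| <= L * e) /\
  (forall i j, `|dcov (joint Gamma h p) i j - dcov (joint Gamma h p') i j| <= L * e).
Proof.
pose k := decay K lam M.
have k0 : 0 < 2 * k by rewrite mulr_gt0// decay_gt0.
pose A := peak K lam * expR (4 * k * kh).
have A0 : 0 <= A by rewrite mulr_ge0 ?expR_ge0// ltW// peak_gt0.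
pose B := \I (fun y : 'cV[R]_K => (1 + sqn y) * (A * expR (- (2 * k * sqn y)))).
have gA := gdom_weight (gdom_exp K A k0).
have B0 : 0 <= B.
  apply: I_ge0 => y; apply: mulr_ge0; first by rewrite addr_ge0// sqn_ge0.
  by rewrite mulr_ge0// expR_ge0.
exists (B * (1 + 2 * (1 + r))).
  by rewrite mulr_ge0// addr_ge0// mulr_ge0// addr_ge0.
move=> Gamma h p p' e eG ch hh pp pp' mr mr' pe.
have pG := elliptic_posdef lam0 eG.
have gp := gdom_prediction c0 pp; have gp' := gdom_prediction c0 pp'.
have gpp : gdom (fun u => (1 + sqn u) * `|p u - p' u|) by exact/gdom_weight/gdom_norm/gdomB.
have e0 : 0 <= e.
  apply: le_trans pe; apply: I_ge0 => u.
  by rewrite mulr_ge0// addr_ge0// sqn_ge0.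
have key (F : 'cV[R]_(d + K) -> R) : measurable_fun setT F ->
    (forall v, `|F v| <= 1 + sqn v) ->
    `|\I (fun v => F v * joint Gamma h p v) - \I (fun v => F v * joint Gamma h p' v)| <= B * e.
  move=> mF FW; have FA v : `|F v| <= 1 * (1 + sqn v) by rewrite mul1r.
  rewrite (I_joint c0 lam0 eG ch hh pp mF FA).
  rewrite (I_joint c0 lam0 eG ch hh pp' mF FA).
  pose G u := \I (fun y => F (col_mx u y) * gauss_pdf Gamma (y - h u)).
  have gFg u : gdom (fun y => F (col_mx u y) * gauss_pdf Gamma (y - h u)).
    apply: (gdomM_weight (A := 1 + sqn u)); last exact: gdom_gauss_pdf.
      by apply: (measurableT_comp mF); apply: measurable_col_mx.
    move=> y; apply: (le_trans (FW _)); rewrite sqn_col_mx.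
    have := sqn_ge0 u; have := sqn_ge0 y; have : 0 <= sqn u * sqn y.
      by rewrite mulr_ge0// sqn_ge0.
    by lra.
  have GB u : `|G u| <= B * (1 + sqn u).
    apply: (le_trans (I_norm_le (gFg u))); rewrite mulrC -I_Z//.
    apply: I_le => [||y]; [exact: gdom_norm|exact: gdomZ|].
    rewrite normrM (ger0_norm (gauss_pdf_ge0 _ _)) mulrA.
    apply: ler_pM; rewrite ?gauss_pdf_ge0//.
      apply: (le_trans (FW _)); rewrite sqn_col_mx.
      have := sqn_ge0 u; have := sqn_ge0 y; have : 0 <= sqn u * sqn y.
        by rewrite mulr_ge0// sqn_ge0.
      by lra.
    apply: (le_trans (gauss_pdf_ub lam0 _ _ eG)); rewrite ler_wpM2r ?expR_ge0//.
    rewrite /A ler_wpM2l//; first exact: ltW (peak_gt0 _ lam0).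
    rewrite ler_expR ler_wpM2l//.
    by have := decay_gt0 K M lam0; rewrite -/k; lra.
  have gpG q : prediction_density C c sig q -> gdom (fun u => q u * G u).
    move=> qq; have gJ := gdom_joint c0 lam0 eG ch hh qq.
    have E : (fun u => \I (fun y => F (col_mx u y) * joint Gamma h q (col_mx u y))) =
        (fun u => q u * G u).
      apply/funext => u; rewrite /G -(I_Z _ (gFg u)); apply: eq_I => y.
      by rewrite jointE mulrCA.
    rewrite -E.
    exact: (gdom_I_col_mx (f := fun v => F v * joint Gamma h q v)
      (gdomM_weight mF FA gJ)).
  rewrite -I_B; [|exact: gpG|exact: gpG].
  apply: (le_trans (I_norm_le (gdomB (gpG _ pp) (gpG _ pp')))).
  apply: (@le_trans _ _ (B * \I (fun u => (1 + sqn u) * `|p u - p' u|))); last first.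
    by rewrite ler_wpM2l.
  rewrite -I_Z//; apply: I_le => [||u].
  - by apply/gdom_norm/gdomB; exact: gpG.
  - exact: gdomZ.
  by rewrite -mulrBl normrM mulrC mulrA ler_wpM2r.
have mm i : `|dmean (joint Gamma h p) i ord0 - dmean (joint Gamma h p') i ord0| <= B * e.
  rewrite !mxE; apply: key => [|v]; first exact: measurable_coord.
  exact: coord_le_weight.
have Be : 0 <= B * e by rewrite mulr_ge0.
split=> [i|i j].
  apply: (le_trans (mm i)); rewrite mulrAC ler_peMr//.
  by rewrite lerDl mulr_ge0// addr_ge0.
have m1 q : sqn (dmean (joint Gamma h q)) <= r ->
    forall i, `|dmean (joint Gamma h q) i ord0| <= 1 + r.
  by move=> qr l; apply: (le_trans (coord_le_weight _ _)); rewrite lerD2l.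
rewrite [dcov (joint Gamma h p) i j]mxE [dcov (joint Gamma h p') i j]mxE.
set a := dmean _ i ord0; set b := dmean _ j ord0.
set a' := dmean (joint Gamma h p') i ord0; set b' := dmean (joint Gamma h p') j ord0.
have aB : `|a| <= 1 + r by exact: m1.
have bB : `|b'| <= 1 + r by exact: m1.
have ab X Y : `|X - Y| <= B * e ->
    `|X - a * b - (Y - a' * b')| <= B * (1 + 2 * (1 + r)) * e.
  move=> XY.
  have -> : X - a * b - (Y - a' * b') = (X - Y) - (a * (b - b') + (a - a') * b') by ring.
  apply: (le_trans (ler_normB _ _)).
  have -> : B * (1 + 2 * (1 + r)) * e =
    B * e + ((1 + r) * (B * e) + (B * e) * (1 + r)) by ring.
  apply: lerD => //; apply: (le_trans (ler_normD _ _)).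
  by apply: lerD; rewrite normrM ler_pM// mm.
apply: ab; apply: (key (fun v => v i ord0 * v j ord0)).
  by apply: measurable_funM; exact: measurable_coord.
by move=> v; exact: coord2_le_weight.
Qed.

End moment_stability.

Section gaussian_analysis_stability.
Context (R : realType) (d K : nat) (C c sig lam M kh ky : R).
Hypotheses (c0 : 0 < c) (sig0 : 0 < sig) (lam0 : 0 < lam) (kh0 : 0 <= kh).

(** The unnormalised density of the Gaussian analysis: condition, on the
    observation, the Gaussian with the moments of the joint law. *)
Definition gauss_joint (Gamma : 'M[R]_K) h (p : 'cV[R]_d -> R) y :=
  gslice (dcov (joint Gamma h p)) (dmean (joint Gamma h p)) y.

(** The prediction error passes to the moments of the joint law, from these to the
    conditioned Gaussian density, and through the normalisation. *)
Lemma gauss_analysis_lip : exists2 L : R, 0 <= L &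
  forall Gamma h (p p' : 'cV[R]_d -> R) y (e : R),
  elliptic lam M Gamma -> continuous h -> (forall u, sqn (h u) <= kh) ->
  prediction_density C c sig p -> prediction_density C c sig p' -> sqn y <= ky ->
  \I (fun u => (1 + sqn u) * `|p u - p' u|) <= e ->
  \I (fun u => (1 + sqn u) * `|normalized (gauss_joint Gamma h p y) u -
                               normalized (gauss_joint Gamma h p' y) u|) <= L * e.
Proof.
have [l [m [r [l0 m0 r0 HE]]]] := joint_elliptic d K C M c0 sig0 lam0 kh0.
have [L1 L10 H1] := moments_lip d K C sig M kh c0 lam0 r0.
have [L2 L20 H2] := gslice_lip d K l0 m0 r0.
have [z z0 Hz] := gslice_lb d K r ky l0 m0.
have [B HB] := gslice_ub d K m r l0.
exists ((z^-1 + z^-1 ^+ 2 * `|B|) * (L2 * L1)).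
  by rewrite mulr_ge0 ?mulr_ge0// addr_ge0 ?invr_ge0 ?(ltW z0)// mulr_ge0// sqr_ge0.
move=> Gamma h p p' y e eG ch hh pp pp' yk pe.
have [eC mr] := HE _ _ _ eG ch hh pp; have [eC' mr'] := HE _ _ _ eG ch hh pp'.
have [Hm Hc] := H1 _ _ _ _ _ eG ch hh pp pp' mr mr' pe.
have e0 : 0 <= e.
  apply: le_trans pe; apply: I_ge0 => u.
  by rewrite mulr_ge0// addr_ge0// sqn_ge0.
rewrite -mulrA; apply: (normalized_lip z0).
- exact: gdom_gslice (elliptic_posdef l0 eC).
- exact: gdom_gslice (elliptic_posdef l0 eC').
- by move=> u; exact: gslice_ge0.
- exact: Hz.
- exact: Hz.
- exact: le_trans (HB _ _ _ eC' mr') (ler_norm _).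
- by rewrite -mulrA; apply: H2 => //; rewrite mulr_ge0.
Qed.

End gaussian_analysis_stability.

(** * Clipped test functions *)

Section clipping.
Context (R : realType).

Definition clip (r t : R) : R := if t < - r then - r else if r < t then r else t.

Lemma clipN r t : 0 <= r -> clip r (- t) = - clip r t.
Proof.
rewrite /clip => r0; case: (ltP t (- r)) => h1; case: (ltP r t) => h2;
 case: (ltP (- t) (- r)) => h3; case: (ltP r (- t)) => h4; lra.
Qed.

Lemma clip_le r t : 0 <= r -> `|clip r t| <= r.
Proof.
move=> r0; rewrite ler_norml /clip.
by case: (ltP t (- r)) => h1; case: (ltP r t) => h2; lra.
Qed.

(** Near the origin, shifts up to [r / 2] are not affected by the clipping; far out
    the right-hand side is negative and monotonicity is enough. *)
Lemma clip_shift r t s : 0 < r -> 0 <= s ->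
  2 * Num.min s (r / 2) * (1 - 4 / r ^+ 2 * t ^+ 2) <= clip r (t + s) - clip r (t - s).
Proof.
move=> r0 s0; set e := Num.min s (r / 2).
have e0 : 0 <= e by rewrite le_min s0 divr_ge0// ltW.
have es : e <= s by rewrite ge_min lexx.
have er : e <= r / 2 by rewrite ge_min lexx orbT.
have k0 : 0 < 4 / r ^+ 2 by rewrite divr_gt0// exprn_gt0.
have mono : 0 <= clip r (t + s) - clip r (t - s).
  rewrite /clip.
  by case: (ltP (t + s) (- r)) => h1; case: (ltP r (t + s)) => h2;
   case: (ltP (t - s) (- r)) => h3; case: (ltP r (t - s)) => h4; lra.
have [tr|tr] := leP (t ^+ 2) ((r / 2) ^+ 2); last first.
  apply: le_trans mono; apply: mulr_ge0_le0; first by rewrite mulr_ge0.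
  rewrite subr_le0 -(ler_pM2l (x := r ^+ 2)) ?exprn_gt0// mulr1 mulrA.
  have -> : r ^+ 2 * (4 / r ^+ 2) = 4 by field; rewrite gt_eqF.
  by rewrite expr2; nra.
apply: (@le_trans _ _ (2 * e)).
  rewrite ler_piMr//; first by rewrite mulr_ge0.
  by rewrite gerBl mulr_ge0 ?sqr_ge0// ltW.
have t1 : - (r / 2) <= t by rewrite !expr2 in tr; nra.
have t2 : t <= r / 2 by rewrite !expr2 in tr; nra.
rewrite /clip.
by case: (ltP (t + s) (- r)) => h1; case: (ltP r (t + s)) => h2;
   case: (ltP (t - s) (- r)) => h3; case: (ltP r (t - s)) => h4; lra.
Qed.

Lemma measurable_clip d (T : measurableType d) r (f : T -> R) :
  measurable_fun setT f -> measurable_fun setT (fun x => clip r (f x)).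
Proof.
move=> mf; rewrite /clip; apply: measurable_fun_ifT => //.
  by apply: measurable_fun_ltr => //; exact: measurable_cst.
apply: measurable_fun_ifT => //.
by apply: measurable_fun_ltr => //; exact: measurable_cst.
Qed.

Section gaussian_clipping.
Context (n : nat) (S : 'M[R]_n) (r : R) (i : 'I_n).
Hypotheses (pS : posdefmx S) (r0 : 0 < r) (Sr : 8 * S i i <= r ^+ 2).

Let B := sqrtmx S.
Let mX a : measurable_fun setT (fun z : 'cV[R]_n => a + (B *m z) i ord0).
Proof.
by apply: measurable_funD => //; apply: measurable_mx_coord; exact: measurable_mulmx.
Qed.

Let gclip a : gdom (fun z : 'cV[R]_n => clip r (a + (B *m z) i ord0) * stdg z).
Proof.
apply: (gdomM_bounded (A := r)) (gdom_stdg R n); first exact: measurable_clip.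
by move=> z; exact: clip_le (ltW r0).
Qed.

Let clip_odd a : \I (fun z : 'cV[R]_n => clip r (- a + (B *m z) i ord0) * stdg z) =
  - \I (fun z : 'cV[R]_n => clip r (a + (B *m z) i ord0) * stdg z).
Proof.
rewrite -(I_opp (gclip (- a))).
transitivity (\I (fun z : 'cV[R]_n => - 1 * (clip r (a + (B *m z) i ord0) * stdg z)));
  last by rewrite (I_Z _ (gclip a)) mulN1r.
by apply: eq_I => z; rewrite stdgN mulmxN mxE -opprD clipN ?ltW// mulNr mul1r mulNr.
Qed.

Let clip_ge s : 0 <= s ->
  Num.min s (r / 2) / 2 <= \I (fun z : 'cV[R]_n => clip r (s + (B *m z) i ord0) * stdg z).
Proof.
move=> s0; set X := \I _; set e := Num.min _ _.
have e0 : 0 <= e by rewrite le_min s0 divr_ge0// ltW.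
have gq : gdom (fun v : 'cV[R]_n => v i ord0 * v i ord0 * gauss_pdf S (v - 0)).
  by apply: gdom_coord2; exact: gdom_gauss_pdf.
have q2 : \I (fun z : 'cV[R]_n => (B *m z) i ord0 ^+ 2 * stdg z) = S i i.
  have := I_gauss_coord2 pS 0 i i; rewrite (I_gauss pS gq) mxE mulr0 addr0 => <-.
  by apply: eq_I => z; rewrite add0r expr2.
have gz : gdom (fun z : 'cV[R]_n => (B *m z) i ord0 ^+ 2 * stdg z).
  have [M M0 BM] := mx_entry_bound B.
  apply: (gdomM_weight (A := n%:R * n%:R * M ^+ 2)) (gdom_stdg R n).
    by apply: measurable_funX; apply: measurable_mx_coord; exact: measurable_mulmx.
  move=> z; rewrite ger0_norm ?sqr_ge0//; apply: (le_trans (sqr_coord_le _ _)).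
  apply: (le_trans (sqn_mulmx _ BM)); rewrite ler_wpM2l ?lerDr//.
  by apply: mulr_ge0; rewrite ?sqr_ge0 ?mulr_ge0.
have XX : 2 * X = \I (fun z : 'cV[R]_n =>
    clip r (s + (B *m z) i ord0) * stdg z - clip r (- s + (B *m z) i ord0) * stdg z).
  by rewrite (I_B (gclip _) (gclip _)) clip_odd -/X; ring.
have low : \I (fun z : 'cV[R]_n => 2 * e * stdg z +
      (- (2 * e * (4 / r ^+ 2))) * ((B *m z) i ord0 ^+ 2 * stdg z)) <= 2 * X.
  rewrite XX; apply: I_le => [||z].
  - by apply: gdomD; apply: gdomZ => //; exact: gdom_stdg.
  - by apply: gdomB; exact: gclip.
  have := @clip_shift r ((B *m z) i ord0) s r0 s0; rewrite -/e.
  rewrite (addrC s) (addrC (- s)) => /(ler_wpM2r (stdg_ge0 z)).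
  by rewrite mulrBl; apply: le_trans; rewrite le_eqVlt; apply/orP; left; apply/eqP; ring.
rewrite I_D in low; [|exact/gdomZ/gdom_stdg|exact: gdomZ].
rewrite (I_Z _ (gdom_stdg R n)) (I_Z _ gz) q2 I_stdg mulr1 in low.
have : e * (4 / r ^+ 2 * S i i) <= e * (1 / 2).
  rewrite ler_wpM2l// -(ler_pM2l (x := r ^+ 2)) ?exprn_gt0//.
  have -> : r ^+ 2 * (4 / r ^+ 2 * S i i) = 4 * S i i by field; rewrite gt_eqF.
  have half (x t : R) : 8 * x <= t -> 4 * x <= t * (1 / 2) by lra.
  exact: half.
set W := 4 / r ^+ 2 * S i i => H.
have : 2 * e - 2 * (e * W) <= 2 * X.
  by apply: le_trans low; rewrite le_eqVlt /W; apply/orP; left; apply/eqP; ring.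
by move: H; set Y := e * W; lra.
Qed.

(** A bounded function detects a displacement of the mean: as the Gaussian is
    symmetric, its expectation is half the expected separation of the values
    shifted in opposite directions, and by Chebyshev's argument the quadratic
    error term costs at most half of it. *)
Lemma gauss_clip_ge (a b : 'cV[R]_n) :
  Num.min `|b i ord0 - a i ord0| (r / 2) / 2 <=
  `|\I (fun y : 'cV[R]_n => clip r (y i ord0 - a i ord0) * gauss_pdf S (y - b))|.
Proof.
have mc : measurable_fun setT (fun y : 'cV[R]_n => clip r (y i ord0 - a i ord0)).
  by apply: measurable_clip; apply: measurable_funB => //; exact: measurable_coord.
have gc : gdom (fun y : 'cV[R]_n => clip r (y i ord0 - a i ord0) * gauss_pdf S (y - b)).
  apply: (gdomM_bounded (A := r)) (gdom_gauss_pdf pS b) => // y.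
  exact: clip_le (ltW r0).
rewrite (I_gauss pS gc); set s := b i ord0 - a i ord0.
have -> : \I (fun z : 'cV[R]_n => clip r ((b + sqrtmx S *m z) i ord0 - a i ord0) * stdg z) =
    \I (fun z : 'cV[R]_n => clip r (s + (B *m z) i ord0) * stdg z).
  by apply: eq_I => z; rewrite mxE /s addrAC.
have [s0|s0] := leP 0 s.
  by rewrite (ger0_norm s0); apply: le_trans (ler_norm _); exact: clip_ge.
rewrite (ltr0_norm s0) -{2}(opprK s) clip_odd normrN.
by apply: le_trans (ler_norm _); apply: clip_ge; rewrite oppr_ge0 ltW.
Qed.

End gaussian_clipping.

Lemma gauss_clip0 n (S : 'M[R]_n) r i (a : 'cV[R]_n) : posdefmx S -> 0 <= r ->
  \I (fun y : 'cV[R]_n => clip r (y i ord0 - a i ord0) * gauss_pdf S (y - a)) = 0.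
Proof.
move=> pS r0.
have mc b : measurable_fun setT (fun y : 'cV[R]_n => clip r (y i ord0 - b)).
  by apply: measurable_clip; apply: measurable_funB => //; exact: measurable_coord.
rewrite (I_gauss pS); last first.
  by apply: (gdomM_bounded (A := r)) (gdom_gauss_pdf pS a) => // y; exact: clip_le.
have mB : measurable_fun setT (fun z : 'cV[R]_n =>
    clip r ((a + sqrtmx S *m z) i ord0 - a i ord0)).
  apply: (measurableT_comp (mc (a i ord0))); apply: measurable_addmx => //.
  exact: measurable_mulmx.
apply: I_odd => [|z].
  by apply: (gdomM_bounded (A := r)) (gdom_stdg R n) => // z; exact: clip_le.
rewrite stdgN -mulNr -clipN// mulmxN; congr (clip _ _ * _).
by rewrite !mxE; ring.
Qed.

End clipping.

(** * Conditioning a Gaussian vector *)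

Section conditioning.
Context (R : realType).

Lemma gauss_pdf_block m n (A : 'M[R]_m) (B : 'M[R]_(n, m)) (D : 'M[R]_n) u v :
  posdefmx A -> posdefmx (block_mx A B^T B D) ->
  gauss_pdf (block_mx A B^T B D) (col_mx u v) =
  gauss_pdf A u * gauss_pdf (schur A B D) (v - (B *m invmx A) *m u).
Proof.
move=> pA pS; have pD := schur_posdef pA pS.
rewrite !gauss_pdfE// qform_invmx_block// det_block_schur//.
set a := qform (invmx A) u; set b := qform _ _.
have -> : - (2^-1 * (a + b)) = - (2^-1 * a) + - (2^-1 * b) by ring.
rewrite expRD.
have t0 := tau_gt0 R.
have dA := posdef_det_gt0 pA; have dD := posdef_det_gt0 pD.
have -> : (2 * pi) ^+ (m + n) * (\det A * \det (schur A B D)) =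
   ((2 * pi) ^+ m * \det A) * ((2 * pi) ^+ n * \det (schur A B D)) :> R.
  by rewrite exprD; ring.
rewrite sqrtrM; last by rewrite mulr_ge0 ?ltW// exprn_gt0.
by rewrite invfM; ring.
Qed.

Context (d K : nat).
Implicit Types (S : 'M[R]_(d + K)) (m : 'cV[R]_(d + K)).

(** Mean and covariance of the second block of a Gaussian vector, conditionally
    on the first. *)
Definition reg_mean S m u : 'cV[R]_K :=
  dsubmx m + (dlsubmx S *m invmx (ulsubmx S)) *m (u - usubmx m).

Definition reg_cov S : 'M[R]_K := schur (ulsubmx S) (dlsubmx S) (drsubmx S).

Lemma block_of_sym S : S^T = S ->
  S = block_mx (ulsubmx S) (dlsubmx S)^T (dlsubmx S) (drsubmx S).
Proof. by move=> ST; rewrite trmx_dlsub ST submxK. Qed.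

Lemma reg_cov_posdef S : posdefmx S -> posdefmx (reg_cov S).
Proof.
move=> pS; have pA := posdef_ulsubmx pS; apply: schur_posdef => //.
by rewrite -block_of_sym//; case: pS.
Qed.

Lemma gauss_pdf_reg S m u y : posdefmx S -> gauss_pdf S (col_mx u y - m) =
  gauss_pdf (ulsubmx S) (u - usubmx m) * gauss_pdf (reg_cov S) (y - reg_mean S m u).
Proof.
move=> pS; have pA := posdef_ulsubmx pS; have [ST _] := pS.
have pB : posdefmx (block_mx (ulsubmx S) (dlsubmx S)^T (dlsubmx S) (drsubmx S)).
  by rewrite -block_of_sym.
have vE : col_mx u y - m = col_mx (u - usubmx m) (y - dsubmx m).
  by rewrite -{1}(vsubmxK m) opp_col_mx add_col_mx.
have -> : gauss_pdf S (col_mx u y - m) =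
    gauss_pdf (block_mx (ulsubmx S) (dlsubmx S)^T (dlsubmx S) (drsubmx S))
      (col_mx (u - usubmx m) (y - dsubmx m)) by rewrite -(block_of_sym ST) vE.
rewrite (gauss_pdf_block _ _ pA pB) /reg_mean opprD addrA.
by [].
Qed.

Lemma elliptic_ulsubmx lam M S : elliptic lam M S -> elliptic lam M (ulsubmx S).
Proof.
move=> [ST Sl SM]; split=> [|v|i j].
- by rewrite trmx_ulsub ST.
- have := Sl (col_mx v 0); rewrite sqn_col_mx.
  have -> : qform S (col_mx v 0) = qform (ulsubmx S) v.
    transitivity (qform (block_mx (ulsubmx S) (dlsubmx S)^T (dlsubmx S) (drsubmx S))
      (col_mx v 0)); first by rewrite -(block_of_sym ST).
    rewrite /qform tr_col_mx mul_row_block mul_row_col trmx0 !mul0mx !mulmx0.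
    by rewrite !addr0.
  have -> : sqn (0 : 'cV[R]_K) = 0 by rewrite /sqn big1// => i _; rewrite mxE expr0n.
  by rewrite addr0.
- by rewrite 2!mxE; exact: SM.
Qed.

Lemma reg_mean_le lam M r : 0 < lam -> exists2 k : R, 0 <= k & forall S m u,
  elliptic lam M S -> sqn m <= r -> sqn (reg_mean S m u) <= k * (1 + sqn u).
Proof.
move=> lam0; pose g := K%:R * d%:R * M ^+ 2 * lam^-1 ^+ 2.
have g0 : 0 <= g by apply: mulr_ge0; rewrite ?sqr_ge0//; apply: mulr_ge0; rewrite ?sqr_ge0// mulr_ge0.
exists (2 * `|r| + 2 * g * (2 + 2 * `|r|)).
  have r0 := normr_ge0 r.
  have : 0 <= g * `|r| by exact: mulr_ge0.
  by lra.
move=> S m u eS mr; have [_ _ SM] := eS; have eA := elliptic_ulsubmx eS.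
have mE : sqn m = sqn (usubmx m) + sqn (dsubmx m) by rewrite -{1}(vsubmxK m) sqn_col_mx.
have h0 := sqn_ge0 (usubmx m); have h1 := sqn_ge0 (dsubmx m); have h2 := ler_norm r.
have h3 := sqnB_le u (usubmx m).
apply: (le_trans (sqnD_le _ _)); rewrite -mulmxA.
have hB : sqn (dlsubmx S *m (invmx (ulsubmx S) *m (u - usubmx m))) <=
    g * sqn (u - usubmx m).
  apply: (le_trans (sqn_mulmx (M := M) _ _)).
    by move=> i j; rewrite 2!mxE; exact: SM.
  have -> : g * sqn (u - usubmx m) =
    (K%:R * d%:R * M ^+ 2) * (lam^-1 ^+ 2 * sqn (u - usubmx m)) by rewrite /g; ring.
  apply: ler_wpM2l; last exact: sqn_invmx_le eA.
  by apply: mulr_ge0; rewrite ?sqr_ge0// mulr_ge0.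
have h4 : g * sqn (u - usubmx m) <= g * (2 * sqn u + 2 * `|r|).
  by rewrite ler_wpM2l//; lra.
have u0 := sqn_ge0 u; have r0 := normr_ge0 r.
have h5 : 0 <= g * `|r| * sqn u by rewrite mulr_ge0// mulr_ge0.
have h6 : 0 <= `|r| * sqn u by rewrite mulr_ge0.
have h7 : 0 <= g * sqn u by rewrite mulr_ge0.
have h8 : 0 <= g * `|r| by rewrite mulr_ge0.
have h9 : 2 * sqn (dsubmx m) + 2 * sqn (dlsubmx S *m (invmx (ulsubmx S) *m (u - usubmx m)))
   <= 2 * `|r| + 2 * (g * (2 * sqn u + 2 * `|r|)) by lra.
by apply: (le_trans h9); lra.
Qed.

(** The form is evaluated at the residual of the regression on the first block. *)
Lemma qform_reg_cov S s : posdefmx S -> qform (reg_cov S) s =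
  qform S (col_mx (- ((dlsubmx S *m invmx (ulsubmx S))^T *m s)) s).
Proof.
move=> pS; have pA := posdef_ulsubmx pS; have [ST _] := pS.
transitivity (qform (block_mx (ulsubmx S) (dlsubmx S)^T (dlsubmx S) (drsubmx S))
  (col_mx (- ((dlsubmx S *m invmx (ulsubmx S))^T *m s)) s)); last first.
  by rewrite -(block_of_sym ST).
have q0 : qform (ulsubmx S) 0 = 0.
  by rewrite qformE /dotv big1// => i _; rewrite mxE mul0r.
by rewrite (qform_block _ _ pA) addNr q0 add0r.
Qed.

(** The form is nonnegative at the sum and at the difference of two vectors of the
    standard basis. *)
Lemma psd_entry_le n (N : 'M[R]_n) i j : N^T = N -> (forall s, 0 <= qform N s) ->
  `|N i j| <= (N i i + N j j) / 2.
Proof.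
move=> NT Np.
have q (a : R) : qform N (delta_mx i 0 + a *: delta_mx j 0) =
    N i i + a ^+ 2 * N j j + 2 * a * N i j.
  have dl (k l : 'I_n) : dotv (delta_mx k 0) (N *m (delta_mx l 0 : 'cV[R]_n)) = N k l.
    rewrite -colE /dotv (bigD1 k)//= !mxE !eqxx/= mul1r big1 ?addr0// => x xk.
    by rewrite !mxE (negbTE xk) mul0r.
  have sji : N j i = N i j by rewrite -{1}NT mxE.
  rewrite qformE mulmxDr -scalemxAr dotvDr !dotvDl !dotvZl.
  rewrite ![dotv _ (a *: _)]dotvC !dotvZl ![dotv (N *m _) _]dotvC !dl sji.
  by ring.
have := Np (delta_mx i 0 + 1 *: delta_mx j 0); have := Np (delta_mx i 0 + (-1) *: delta_mx j 0).
rewrite !q => h1 h2; rewrite ler_norml; apply/andP; split; lra.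
Qed.

Lemma reg_cov_diag_le S i : posdefmx S -> reg_cov S i i <= S (rshift d i) (rshift d i).
Proof.
move=> pS; have pA := posdef_ulsubmx pS.
rewrite /reg_cov /schur mxE [drsubmx S i i]mxE [X in X + _]mxE gerDl mxE oppr_le0.
have -> : (dlsubmx S *m invmx (ulsubmx S) *m (dlsubmx S)^T) i i =
   dotv (row i (dlsubmx S))^T (invmx (ulsubmx S) *m (row i (dlsubmx S))^T).
  rewrite -mulmxA mxE /dotv; apply: eq_bigr => k _; rewrite !mxE; congr (_ * _).
  by apply: eq_bigr => l _; rewrite !mxE.
rewrite -qformE; have [_ [lam [M [lam0 M0 eA]]]] := (I, posdef_elliptic pA).
apply: le_trans (qform_invmx_ge lam0 _ eA); apply: mulr_ge0; last exact: sqn_ge0.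
rewrite divr_ge0 ?(ltW lam0)// addr_ge0//.
by apply: mulr_ge0; rewrite ?sqr_ge0// mulr_ge0.
Qed.

End conditioning.

(** * Comparing two Gaussian observation kernels *)

Section gaussian_kernels.
Context (R : realType) (d K : nat).
Variables (Gamma N : 'M[R]_K) (h a : 'cV[R]_d -> 'cV[R]_K) (p q : 'cV[R]_d -> R).
Variables (f g : 'cV[R]_(d + K) -> R).
Hypotheses (pG : posdefmx Gamma) (pN : posdefmx N).
Hypothesis q0 : forall u, 0 <= q u.
Hypotheses (gf : gdom f) (gg : gdom g).
Hypothesis fE : forall u y, f (col_mx u y) = p u * gauss_pdf Gamma (y - h u).
Hypothesis gE : forall u y, g (col_mx u y) = q u * gauss_pdf N (y - a u).

(** Every error at the state [u] is measured by this quantity, whose integral over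
    [u] is the weighted distance of the two joint densities. *)
Definition slice_dist u : R :=
  \I (fun y => (1 + sqn (col_mx u y)) * `|f (col_mx u y) - g (col_mx u y)|).

Local Notation F := slice_dist.

Let gWD : gdom (fun v => (1 + sqn v) * `|f v - g v|) :=
  gdom_weight (gdom_norm (gdomB gf gg)).

Lemma gdom_slice_dist : gdom F. Proof. exact: (gdom_I_col_mx gWD). Qed.

Lemma I_slice_dist : \I F = \I (fun v => (1 + sqn v) * `|f v - g v|).
Proof. by rewrite (I_col_mx gWD). Qed.

Lemma slice_dist_ge0 u : 0 <= F u.
Proof. by apply: I_ge0 => y; rewrite mulr_ge0// addr_ge0// sqn_ge0. Qed.

(** All comparisons of the two kernels at a state are instances of this one; only
    the test function changes. *)
Lemma slice_test u (psi : 'cV[R]_K -> R) k x z : measurable_fun setT psi ->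
  (forall y, `|psi y| <= k * (1 + sqn (col_mx u y))) ->
  \I (fun y => psi y * gauss_pdf Gamma (y - h u)) = x ->
  \I (fun y => psi y * gauss_pdf N (y - a u)) = z ->
  `|p u * x - q u * z| <= k * F u.
Proof.
move=> mpsi kpsi <- <-.

have W y : `|psi y| <= `|k| * (1 + sqn u) * (1 + sqn y).
  apply: (le_trans (kpsi y)).
  have u0 := sqn_ge0 u; have y0 := sqn_ge0 y.
  rewrite sqn_col_mx -mulrA; apply: ler_pM => //; last first.
  - by have : 0 <= sqn u * sqn y by [exact: mulr_ge0]; lra.
  - exact: ler_norm.
  - by rewrite !addr_ge0.
  have := le_trans (normr_ge0 _) (kpsi 0); rewrite pmulr_lge0//.
  by rewrite ltr_wpDr// sqn_ge0.
have g1 := gdom_gauss_weight pG (h u) mpsi W.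
have g2 := gdom_gauss_weight pN (a u) mpsi W.
rewrite -(I_Z _ g1) -(I_Z _ g2) -(I_B (gdomZ _ g1) (gdomZ _ g2)).
apply: (le_trans (I_norm_le (gdomB (gdomZ _ g1) (gdomZ _ g2)))).
have gs : gdom (fun y => (1 + sqn (col_mx u y)) * `|f (col_mx u y) - g (col_mx u y)|).
  exact: (gdom_col_mxr u gWD).
rewrite -(I_Z _ gs); apply: I_le => [||y].
- by apply/gdom_norm/gdomB; exact: gdomZ.
- exact: gdomZ.
rewrite mulrCA (mulrCA (q u)) -mulrBr -fE -gE normrM mulrA.
by rewrite ler_wpM2r.
Qed.

Lemma slice_mass u : (1 + sqn u) * `|p u - q u| <= F u.
Proof.
have w0 : 0 <= 1 + sqn u by rewrite addr_ge0// sqn_ge0.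
have one (S : 'M[R]_K) b : posdefmx S -> \I (fun y => (1 + sqn u) * gauss_pdf S (y - b)) = 1 + sqn u.
  by move=> pS; rewrite (I_Z _ (gdom_gauss_pdf pS b)) (I_gauss_pdf pS) mulr1.
have kb (y : 'cV[R]_K) : `|1 + sqn u| <= 1 * (1 + sqn (col_mx u y)).
  by rewrite (ger0_norm w0) mul1r sqn_col_mx (addrA 1) lerDl sqn_ge0.
have := slice_test (measurable_cst _) kb (one Gamma (h u) pG) (one N (a u) pN).
by rewrite -mulrBl normrM (ger0_norm w0) mul1r mulrC.
Qed.

Context (kap kh : R) (kap0 : 0 <= kap).

(** The test function is the error of the mean times a residual that the second
    kernel averages to zero, so that the first kernel returns the square. *)
Lemma slice_mean_sqr u i : sqn (h u) <= kh -> sqn (a u) <= kap * (1 + sqn u) ->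
  (h u i ord0 - a u i ord0) ^+ 2 * p u <=
  (1 + 2 * kap + kh) * F u.
Proof.
move=> hu au; set D1 := a u i ord0 - h u i ord0.
have mpsi : measurable_fun setT (fun y : 'cV[R]_K => D1 * (a u i ord0 - y i ord0)).
  by apply: measurable_funM => //; apply: measurable_funB => //; exact: measurable_coord.
have lin S' b : posdefmx S' ->
   \I (fun y : 'cV[R]_K => D1 * (a u i ord0 - y i ord0) * gauss_pdf S' (y - b)) =
   D1 * (a u i ord0 - b i ord0).
  move=> pS'; have g0 := gdom_gauss_pdf pS' b; have g1 := gdomM_coord i g0.
  rewrite (eq_I (g := fun y : 'cV[R]_K => (D1 * a u i ord0) * gauss_pdf S' (y - b) -
    D1 * (y i ord0 * gauss_pdf S' (y - b)))); last by move=> y; ring.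
  rewrite (I_B (gdomZ _ g0) (gdomZ _ g1)) (I_Z _ g0) (I_Z _ g1).
  by rewrite I_gauss_pdf// I_gauss_coord//; ring.
have kb (y : 'cV[R]_K) : `|D1 * (a u i ord0 - y i ord0)| <=
    (1 + 2 * kap + kh) * (1 + sqn (col_mx u y)).
  rewrite sqn_col_mx.
  have h1 := sqr_coord_le (h u) i; have h2 := sqr_coord_le (a u) i.
  have h3 := sqr_coord_le y i; have u0 := sqn_ge0 u; have y0 := sqn_ge0 y.
  have := sqn_ge0 (h u) => hu0.
  have h4 : 0 <= kap * sqn y by rewrite mulr_ge0.
  have h5 : 0 <= kh * (sqn u + sqn y) by rewrite mulr_ge0 ?addr_ge0//; lra.
  have h6 : (a u i ord0) ^+ 2 <= kap * (1 + sqn u) by exact: le_trans au.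
  set A := a u i ord0 in h6 *; set B := h u i ord0 in h1 *; set Y := y i ord0 in h3 *.
  have -> : D1 = A - B by [].
  have e1 := sqr_ge0 (A + Y); have e2 := sqr_ge0 (A + B).
  have e3 := sqr_ge0 ((A - B) + (A - Y)); have e4 := sqr_ge0 ((A - B) - (A - Y)).
  have : `|(A - B) * (A - Y)| <= 2 * A ^+ 2 + B ^+ 2 + Y ^+ 2.
    by rewrite ler_norml; apply/andP; split; nra.
  move=> e5; apply: (le_trans e5).
  have -> : (1 + 2 * kap + kh) * (1 + (sqn u + sqn y)) =
    1 + sqn u + sqn y + 2 * (kap * (1 + sqn u)) + 2 * (kap * sqn y) + kh +
    kh * (sqn u + sqn y) by ring.
  by lra.
have := slice_test mpsi kb (lin _ _ pG) (lin _ _ pN).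
rewrite subrr !mulr0 subr0; apply: le_trans; apply: le_trans (ler_norm _).
by rewrite /D1 le_eqVlt; apply/orP; left; apply/eqP; ring.
Qed.

(** An affine test function already uses up the weight through its growth in the
    observation; a clipped one leaves the whole weight to the state, which is
    needed once the observation is fixed. *)
Lemma slice_clip u i R0 : 0 < R0 -> 8 * N i i <= R0 ^+ 2 ->
  (1 + sqn u) * q u * Num.min `|a u i ord0 - h u i ord0| (R0 / 2) <= 2 * R0 * F u.
Proof.
move=> R00 NR.
have w0 : 0 <= 1 + sqn u by rewrite addr_ge0// sqn_ge0.
have mc : measurable_fun setT (fun y : 'cV[R]_K => clip R0 (y i ord0 - h u i ord0)).
  by apply: measurable_clip; apply: measurable_funB => //; exact: measurable_coord.
have mpsi : measurable_fun setT
    (fun y : 'cV[R]_K => (1 + sqn u) * clip R0 (y i ord0 - h u i ord0)).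
  exact: measurable_funM.
have gc S' b : posdefmx S' ->
  gdom (fun y : 'cV[R]_K => clip R0 (y i ord0 - h u i ord0) * gauss_pdf S' (y - b)).
  move=> pS'; apply: (gdomM_bounded (A := R0)) (gdom_gauss_pdf pS' b) => // y.
  exact: clip_le (ltW R00).
have pull S' b : posdefmx S' -> \I (fun y : 'cV[R]_K =>
     (1 + sqn u) * clip R0 (y i ord0 - h u i ord0) * gauss_pdf S' (y - b)) =
   (1 + sqn u) * \I (fun y : 'cV[R]_K =>
     clip R0 (y i ord0 - h u i ord0) * gauss_pdf S' (y - b)).
  by move=> pS'; rewrite -(I_Z _ (gc _ _ pS')); apply: eq_I => y; rewrite mulrA.
have kb (y : 'cV[R]_K) : `|(1 + sqn u) * clip R0 (y i ord0 - h u i ord0)| <=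
    R0 * (1 + sqn (col_mx u y)).
  rewrite normrM (ger0_norm w0) mulrC; apply: ler_pM => //.
    exact: clip_le (ltW R00).
  by rewrite sqn_col_mx addrA lerDl sqn_ge0.
have z1 : \I (fun y : 'cV[R]_K =>
    (1 + sqn u) * clip R0 (y i ord0 - h u i ord0) * gauss_pdf Gamma (y - h u)) = 0.
  by rewrite (pull _ _ pG) (gauss_clip0 _ _ pG (ltW R00)) mulr0.
have H := slice_test mpsi kb z1 (pull _ _ pN).
have G := gauss_clip_ge pN R00 NR (h u) (a u).
have fin (X mn : R) : mn / 2 <= `|X| ->
    `|p u * 0 - q u * ((1 + sqn u) * X)| <= R0 * F u ->
    (1 + sqn u) * q u * mn <= 2 * R0 * F u.
  rewrite mulr0 sub0r normrN mulrCA mulrA !normrM (ger0_norm w0) (ger0_norm (q0 u)).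
  have qw : 0 <= (1 + sqn u) * q u by rewrite mulr_ge0.
  by move=> /(ler_wpM2l qw) G' H'; lra.
exact: fin G H.
Qed.

End gaussian_kernels.


(** A mean that is far off makes the slice distance comparable with the whole mass
    of the slice; the other means are in the range where Gaussian densities depend
    Lipschitz continuously on their parameters. *)
Lemma slice_compare (R : realType) (K : nat) (lam m kh : R) :
  0 < lam -> 0 < m -> 0 <= kh ->
  exists2 L : R, 0 <= L & forall d (Gamma N : 'M[R]_K) (h a : 'cV[R]_d -> 'cV[R]_K)
    (p q : 'cV[R]_d -> R) (f g : 'cV[R]_(d + K) -> R) (e : R) u y,
  elliptic lam m Gamma -> elliptic lam m N -> (forall u, 0 <= q u) ->
  gdom f -> gdom g ->
  (forall u y, f (col_mx u y) = p u * gauss_pdf Gamma (y - h u)) ->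
  (forall u y, g (col_mx u y) = q u * gauss_pdf N (y - a u)) ->
  0 <= e -> (forall i j, `|Gamma i j - N i j| <= e) -> sqn (h u) <= kh ->
  (1 + sqn u) * `|f (col_mx u y) - g (col_mx u y)| <=
  L * (slice_dist f g u + e * ((1 + sqn u) * q u)).
Proof.
move=> lam0 m0 kh0.
(* Clipping at [R0] is wide enough for every variance in the class. *)
pose R0 : R := 1 + 8 * m; have R00 : 0 < R0 by rewrite /R0; lra.
have mR : 8 * m <= R0 ^+ 2 by rewrite /R0 expr2; have : 0 <= m * m by [rewrite mulr_ge0// ltW]; lra.
(* [r2] bounds the means within [R0 / 2] of [h u]. *)
pose r2 := 2 * kh + 2 * (K%:R * (R0 / 2) ^+ 2).
have r20 : 0 <= r2.
  by apply: addr_ge0; apply: mulr_ge0 => //; apply: mulr_ge0; rewrite ?sqr_ge0.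
have [L1 L10 HL] := gauss_pdf_lip K lam0 m0 r20.
pose P := peak K lam; have P0 : 0 < P := peak_gt0 K lam0.
have LK0 : 0 <= L1 * (1 + K%:R * (2 * R0)).
  apply: mulr_ge0 => //; apply: addr_ge0 => //.
  by apply: mulr_ge0 => //; apply: mulr_ge0 => //; exact: ltW.
exists (5 * P + L1 * (1 + K%:R * (2 * R0))).
  by apply: addr_ge0 => //; apply: mulr_ge0 => //; exact: ltW.
move=> d Gamma N h a p q f g e u y eG eN q0 gf gg fE gE e0 NG hu.
have pG := elliptic_posdef lam0 eG; have pN := elliptic_posdef lam0 eN.
have w0 : 0 <= 1 + sqn u by rewrite addr_ge0// sqn_ge0.
have F0 := slice_dist_ge0 f g u.
have mass := slice_mass pG pN gf gg fE gE u.
have NR i : 8 * N i i <= R0 ^+ 2.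
  apply: le_trans mR; rewrite ler_pM2l//.
  by case: eN => _ _ Nm; apply: le_trans (ler_norm _) (Nm _ _).
have cl i := slice_clip pG pN q0 gf gg fE gE u R00 (NR i).
have wq0 : 0 <= (1 + sqn u) * q u by rewrite mulr_ge0.
set F := slice_dist f g u in F0 mass cl *.
rewrite fE gE; set phi1 := gauss_pdf Gamma _; set phi2 := gauss_pdf N _.
have b1 : 0 <= phi1 <= P by rewrite gauss_pdf_ge0/=; exact: (gauss_pdf_le_peak lam0 _ eG).
have b2 : 0 <= phi2 <= P by rewrite gauss_pdf_ge0/=; exact: (gauss_pdf_le_peak lam0 _ eN).
have main : (1 + sqn u) * q u * `|phi1 - phi2| <=
    4 * P * F + L1 * (1 + K%:R * (2 * R0)) * (F + e * ((1 + sqn u) * q u)).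
  (* Either some coordinate of the mean is far off, and the clipped test bounds the
     whole mass of the slice, or all of them are close and their errors enter
     linearly. *)
  have [[i Di]|small] := pselect (exists i, R0 / 2 <= `|a u i ord0 - h u i ord0|).
    have := cl i; rewrite (min_idPr Di) => h1.
    have h2 : (1 + sqn u) * q u <= 4 * F.
      rewrite -(ler_pM2r (x := R0 / 2)) ?divr_gt0//; apply: (le_trans h1).
      by rewrite le_eqVlt; apply/orP; left; apply/eqP; field.
    have h3 : `|phi1 - phi2| <= P by rewrite ler_norml; lra.
    have h4 : (1 + sqn u) * q u * `|phi1 - phi2| <= 4 * F * P by exact: ler_pM.
    have h5 : 0 <= L1 * (1 + K%:R * (2 * R0)) * (F + e * ((1 + sqn u) * q u)).
      by apply: mulr_ge0 => //; apply: addr_ge0 => //; exact: mulr_ge0.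
    by lra.
  have sm i : `|a u i ord0 - h u i ord0| < R0 / 2.
    by rewrite ltNge; apply/negP => Di; apply: small; exists i.
  have au : sqn (a u) <= r2.
    rewrite -(subrK (h u) (a u)) addrC; apply: (le_trans (sqnD_le _ _)).
    apply: lerD; first by rewrite ler_pM2l.
    rewrite ler_pM2l// -[X in X%:R * _](card_ord K) mulr_natl -sumr_const.
    apply: ler_sum => i _; rewrite -[leLHS]real_normK ?num_real// !mxE.
    by rewrite !expr2; apply: ler_pM => //; exact: ltW.
  have hu2 : sqn (h u) <= r2.
    apply: (le_trans hu); rewrite /r2.
    have : 0 <= K%:R * (R0 / 2) ^+ 2 by apply: mulr_ge0; rewrite ?sqr_ge0.
    by lra.
  pose e' := e + \sum_i `|a u i ord0 - h u i ord0|.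
  have s0 : 0 <= \sum_i `|a u i ord0 - h u i ord0| by exact: sumr_ge0.
  have e'0 : 0 <= e' by rewrite addr_ge0.
  have ij i j : `|Gamma i j - N i j| <= e' by rewrite (le_trans (NG i j))// lerDl.
  have mi i : `|h u i ord0 - a u i ord0| <= e'.
    rewrite distrC /e' (bigD1 i)//= addrCA lerDl addr_ge0//; exact: sumr_ge0.
  have phiL : `|phi1 - phi2| <= L1 * e'.
    apply: (le_trans (HL _ _ _ _ e' eG eN e'0 hu2 au ij mi y)).
    rewrite ler_piMr ?mulr_ge0// -expR0 ler_expR oppr_le0 mulr_ge0 ?sqn_ge0//.
    by rewrite ltW// decay_gt0.
  have wqe : (1 + sqn u) * q u * e' <= e * ((1 + sqn u) * q u) + K%:R * (2 * R0) * F.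
    rewrite /e' mulrDr mulrC lerD2l mulr_sumr -mulrA -[X in X%:R * _](card_ord K).
    rewrite mulr_natl -sumr_const; apply: ler_sum => i _.
    by have := cl i; rewrite (min_idPl (ltW (sm i))).
  apply: (@le_trans _ _ (L1 * ((1 + sqn u) * q u * e'))).
    by rewrite mulrCA; apply: ler_wpM2l.
  apply: (@le_trans _ _ (L1 * (e * ((1 + sqn u) * q u) + K%:R * (2 * R0) * F))).
    exact: ler_wpM2l.
  have h1 : 0 <= L1 * F by exact: mulr_ge0.
  have h2 : 0 <= P * F by apply: mulr_ge0 => //; exact: ltW.
  have h3 : 0 <= L1 * (K%:R * (2 * R0)) * (e * ((1 + sqn u) * q u)).
    apply: mulr_ge0; last exact: mulr_ge0.
    by apply: mulr_ge0 => //; apply: mulr_ge0 => //; apply: mulr_ge0 => //; exact: ltW.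
  set Q := e * _ in h3 *; set k := K%:R * (2 * R0) in h3 *.
  have -> : 4 * P * F + L1 * (1 + k) * (F + Q) =
    L1 * (Q + k * F) + (4 * (P * F) + L1 * F + L1 * k * Q) by ring.
  by rewrite lerDl; lra.
clearbody phi1 phi2.
have -> : p u * phi1 - q u * phi2 = (p u - q u) * phi1 + q u * (phi1 - phi2) by ring.
apply: (@le_trans _ _ ((1 + sqn u) * `|p u - q u| * phi1 +
    (1 + sqn u) * q u * `|phi1 - phi2|)).
  rewrite -!mulrA -mulrDr; apply: ler_wpM2l => //; apply: (le_trans (ler_normD _ _)).
  by rewrite !normrM (ger0_norm (q0 u)) (ger0_norm (proj1 (andP b1))).
have h1 : (1 + sqn u) * `|p u - q u| * phi1 <= F * P.
  by case/andP: b1 => ? ?; apply: ler_pM => //; exact: mulr_ge0.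
have h2 : 0 <= P * (e * ((1 + sqn u) * q u)).
  by apply: mulr_ge0; [exact: ltW|exact: mulr_ge0].
by move: main h1 h2; set Q := e * _; set k := L1 * _; lra.
Qed.

(** * Consistency of the Gaussian analysis *)

Section gaussian_fit.
Context (R : realType) (d K : nat) (C c sig lam M kh l m r kap : R).
Hypotheses (c0 : 0 < c) (lam0 : 0 < lam) (l0 : 0 < l) (kap0 : 0 <= kap).
Hypothesis kap_reg : forall (S : 'M[R]_(d + K)) m' u,
  elliptic l m S -> sqn m' <= r -> sqn (reg_mean S m' u) <= kap * (1 + sqn u).
Variables (Gamma : 'M[R]_K) (h : 'cV[R]_d -> 'cV[R]_K) (p : 'cV[R]_d -> R).
Hypotheses (eG : elliptic lam M Gamma) (ch : continuous h).
Hypotheses (hh : forall u, sqn (h u) <= kh) (pp : prediction_density C c sig p).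

Local Notation S := (dcov (joint Gamma h p)).
Local Notation mm := (dmean (joint Gamma h p)).
Hypotheses (eS : elliptic l m S) (mr : sqn mm <= r).

Definition fit_density v : R := gauss_pdf S (v - mm).

Local Notation a := (reg_mean S mm).
Local Notation N := (reg_cov S).
Local Notation q := (fun u => gauss_pdf (ulsubmx S) (u - usubmx mm)).
Local Notation F := (slice_dist (joint Gamma h p) fit_density).

Let pG : posdefmx Gamma := elliptic_posdef lam0 eG.
Let pS : posdefmx S := elliptic_posdef l0 eS.
Let pN : posdefmx N := reg_cov_posdef pS.
Let p0 u : 0 <= p u. Proof. by case: pp. Qed.
Let gp : gdom p := gdom_prediction c0 pp.
Let gJ := gdom_joint c0 lam0 eG ch hh pp.
Let gfit : gdom fit_density. Proof. exact: gdom_gauss_pdf. Qed.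
Let gF : gdom F := gdom_slice_dist gJ gfit.

Lemma fitE u y : fit_density (col_mx u y) = q u * gauss_pdf N (y - a u).
Proof. exact: gauss_pdf_reg. Qed.

Let devE s u :
  let G := dlsubmx S *m invmx (ulsubmx S) in
  dotv (- (G^T *m s)) u + dotv s (h u) - dotv (col_mx (- (G^T *m s)) s) mm =
  dotv s (h u) - dotv s (a u).
Proof.
move=> G; rewrite /reg_mean -/G -{1}(vsubmxK mm).
have split_dot (s1 u1 : 'cV[R]_d) (s2 u2 : 'cV[R]_K) :
    dotv (col_mx s1 s2) (col_mx u1 u2) = dotv s1 u1 + dotv s2 u2.
  rewrite /dotv big_split_ord/=.
  by under eq_bigr do rewrite !col_mxEu; under [X in _ + X]eq_bigr do rewrite !col_mxEd.
rewrite split_dot [in RHS]dotvDr dotv_mulmx dotvBr.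
have dn (v w : 'cV[R]_d) : dotv (- v) w = - dotv v w by rewrite -scaleN1r dotvZl mulN1r.
by rewrite !dn; ring.
Qed.

Let gdev s : gdom (fun u => (dotv s (h u) - dotv s (a u)) ^+ 2 * p u).
Proof.
under eq_fun do rewrite -devE.
exact: (gdom_quad_mean c0 ch hh pp).
Qed.

(** Both sides are the variance of the residual of the regression, which the joint
    law splits into the noise and the error made on [h]. *)
Lemma qform_reg_cov_joint s : qform N s = qform Gamma s +
  \I (fun u => (dotv s (h u) - dotv s (a u)) ^+ 2 * p u).
Proof.
have J1 := I_joint1 c0 lam0 eG ch hh pp.
rewrite (qform_reg_cov _ pS) (qform_dcov gJ J1) (I_joint_quad c0 lam0 eG ch hh pp).
by congr (_ + _); apply: eq_I => u; rewrite devE.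
Qed.

Let qB s : qform (N - Gamma) s = \I (fun u => (dotv s (h u) - dotv s (a u)) ^+ 2 * p u).
Proof.
have -> : qform (N - Gamma) s = qform N s - qform Gamma s.
  by rewrite !qformE mulmxBl dotvBr.
by rewrite qform_reg_cov_joint addrAC subrr add0r.
Qed.

Let qB0 s : 0 <= qform (N - Gamma) s.
Proof. by rewrite qB; apply: I_ge0 => u; rewrite mulr_ge0 ?sqr_ge0. Qed.

(** The excess of the conditional covariance is a positive semidefinite matrix, so
    its entries are controlled by the mean square errors on its diagonal. *)
Lemma reg_cov_dist i j : `|N i j - Gamma i j| <= (1 + 2 * kap + kh) * \I F.
Proof.
have [GT _ _] := eG; have [NT _] := pN.
have diag k : (N - Gamma) k k <= (1 + 2 * kap + kh) * \I F.
  have dl (v : 'cV[R]_K) : dotv (delta_mx k 0) v = v k ord0.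
    rewrite /dotv (bigD1 k)//= !mxE !eqxx/= mul1r big1 ?addr0// => x xk.
    by rewrite !mxE (negbTE xk) mul0r.
  have -> : (N - Gamma) k k = qform (N - Gamma) (delta_mx k 0).
    by rewrite qformE dl -colE [RHS]mxE.
  rewrite qB -(I_Z _ gF); apply: I_le => [||u]; [exact: gdev|exact: gdomZ|].
  rewrite !dl; apply: (slice_mean_sqr pG pN gJ gfit (@jointE _ _ _ Gamma h p) fitE kap0 k (hh u)).
    exact: kap_reg.
have NGT : (N - Gamma)^T = N - Gamma by rewrite linearB /= NT GT.
have -> : N i j - Gamma i j = (N - Gamma) i j by rewrite [RHS]mxE [X in _ = _ + X]mxE.
apply: (le_trans (psd_entry_le i j NGT qB0)).
by have := diag i; have := diag j; lra.
Qed.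

Lemma elliptic_reg_cov : elliptic lam m N.
Proof.
have [GT Gl _] := eG; have [_ _ Sm] := eS; have [NT Nn] := posdef_psd pN.
split => // [s|i j].
  apply: (le_trans (Gl s)); have := qB0 s; rewrite qB => q0.
  by rewrite qform_reg_cov_joint lerDl.
have dm k : N k k <= m.
  apply: (le_trans (reg_cov_diag_le k pS)); exact: le_trans (ler_norm _) (Sm _ _).
apply: (le_trans (psd_entry_le i j NT Nn)).
by have := dm i; have := dm j; lra.
Qed.

End gaussian_fit.

Lemma elliptic_le (R : realType) n (lam M M' : R) (S : 'M[R]_n) :
  M <= M' -> elliptic lam M S -> elliptic lam M' S.
Proof. by move=> MM [ST Sl SM]; split=> // i j; exact: le_trans (SM i j) MM. Qed.

Section analysis_consistency.
Context (R : realType) (d K : nat) (C c sig lam M kh ky : R).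
Hypotheses (c0 : 0 < c) (sig0 : 0 < sig) (lam0 : 0 < lam) (M0 : 0 < M).
Hypothesis kh0 : 0 <= kh.

Lemma gauss_weight_ub n (l m r : R) : 0 < l -> exists2 B : R, 0 <= B &
  forall (S : 'M[R]_n) a, elliptic l m S -> sqn a <= r ->
  \I (fun u => (1 + sqn u) * gauss_pdf S (u - a)) <= B.
Proof.
move=> l0; have k0 := decay_gt0 n m l0; set k := decay n l m in k0.
have k20 : 0 < 2 * k by rewrite mulr_gt0.
pose A := peak n l * expR (4 * k * r).
have A0 : 0 <= A by apply: mulr_ge0; rewrite ?expR_ge0// ltW// peak_gt0.
exists (\I (fun u : 'cV[R]_n => (1 + sqn u) * (A * expR (- (2 * k * sqn u))))).
  apply: I_ge0 => u; apply: mulr_ge0; first by rewrite addr_ge0// sqn_ge0.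
  by apply: mulr_ge0; rewrite ?expR_ge0.
move=> S a eS ar; apply: I_le => [||u].
- exact/gdom_weight/(gdom_gauss_pdf (elliptic_posdef l0 eS)).
- exact/gdom_weight/gdom_exp.
rewrite ler_wpM2l; [by []|by rewrite addr_ge0// sqn_ge0|].
apply: (le_trans (gauss_pdf_ub l0 _ _ eS)); rewrite ler_wpM2r ?expR_ge0// /A.
by rewrite ler_pM2l ?peak_gt0// ler_expR ler_wpM2l// mulr_ge0// ltW.
Qed.

(** The observation is bounded, so its density stays away from zero whatever the
    state. *)
Lemma joint_slice_lb : exists2 z : R, 0 < z &
  forall Gamma h (p : 'cV[R]_d -> R) (y : 'cV[R]_K),
  elliptic lam M Gamma -> continuous h -> (forall u, sqn (h u) <= kh) ->
  prediction_density C c sig p -> sqn y <= ky ->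
  z <= \I (fun u => joint Gamma h p (col_mx u y)).
Proof.
have [cg [b [cg0 b0 Hg]]] := gauss_pdf_lb K lam0 M0.
exists (cg * expR (- (b * (2 * ky + 2 * kh)))).
  by apply: mulr_gt0; rewrite ?expR_gt0.
move=> Gamma h p y eG ch hh pp yk.
have gJ := gdom_joint c0 lam0 eG ch hh pp.
have [_ p0 _ p1 _] := pp; have gp := gdom_prediction c0 pp.
set z := cg * _.
rewrite -[z]mulr1 -p1 -(I_Z _ gp); apply: I_le => [||u].
- exact: gdomZ.
- exact: (gdom_col_mxl y gJ).
rewrite jointE mulrC /z; apply: ler_wpM2l => //; apply: le_trans (Hg _ _ eG).
rewrite ler_pM2l// ler_expR lerN2 ler_pM2l//.
by apply: (le_trans (sqnB_le _ _)); apply: lerD; rewrite ler_pM2l.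
Qed.

(** Conditioning on a value of the observation is not continuous for the weighted
    distance, but here both joint laws are mixtures of Gaussian kernels in the
    observation. Their distance controls the difference of the marginals, of the
    means and of the covariances of these kernels, hence that of the densities
    at every single observation. *)
Lemma gauss_analysis_consistency : exists2 L : R, 0 <= L &
  forall Gamma h (p : 'cV[R]_d -> R) (y : 'cV[R]_K) (e : R),
  elliptic lam M Gamma -> continuous h -> (forall u, sqn (h u) <= kh) ->
  prediction_density C c sig p -> sqn y <= ky ->
  \I (fun v => (1 + sqn v) * `|joint Gamma h p v - fit_density Gamma h p v|) <= e ->
  \I (fun u => (1 + sqn u) * `|normalized (gauss_joint Gamma h p y) u -
    normalized (fun u => joint Gamma h p (col_mx u y)) u|) <= L * e.
Proof.
have [l [m [r [l0 m0 r0 HE]]]] := joint_elliptic d K C M c0 sig0 lam0 kh0.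
have [kap kap0 Hk] := reg_mean_le d K m r l0.
have mM0 : 0 < m + M by rewrite addr_gt0.
have [L1 L10 H1] := slice_compare K lam0 mM0 kh0.
have [z1 z10 Hz1] := gslice_lb d K r ky l0 m0.
have [z2 z20 Hz2] := joint_slice_lb.
have [Bq Bq0 HBq] := @gauss_weight_ub d l m r l0.
pose z := Num.min z1 z2; have z0 : 0 < z by rewrite lt_min z10.
pose P := peak K lam; have P0 : 0 < P := peak_gt0 K lam0.
pose B := P * \I (fun u : 'cV[R]_d => (1 + sqn u) * (C * expR (- (c * sqn u)))).
pose k := 1 + 2 * kap + kh.
have k0 : 0 <= k by rewrite /k addr_ge0// addr_ge0// mulr_ge0.
exists ((z^-1 + z^-1 ^+ 2 * `|B|) * (L1 * (1 + k * Bq))).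
  apply: mulr_ge0.
    by apply: addr_ge0; [rewrite invr_ge0 ltW|apply: mulr_ge0; rewrite ?sqr_ge0].
  by apply: mulr_ge0 => //; apply: addr_ge0 => //; exact: mulr_ge0.
move=> Gamma h p y e eG ch hh pp yk fe.
have [eC mr] := HE _ _ _ eG ch hh pp.
set S := dcov _ in eC; set mm := dmean _ in mr.
have pC := elliptic_posdef l0 eC; have pG := elliptic_posdef lam0 eG.
have gJ := gdom_joint c0 lam0 eG ch hh pp.
have gfit : gdom (fit_density Gamma h p) by exact: gdom_gauss_pdf.
have [_ p0 pub p1 _] := pp; have gp := gdom_prediction c0 pp.
have gS : gdom (gauss_joint Gamma h p y) by exact: gdom_gslice.
have gJy : gdom (fun u => joint Gamma h p (col_mx u y)) := gdom_col_mxl y gJ.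
have pA := posdef_ulsubmx pC.
rewrite -mulrA; apply: (normalized_lip z0) => //.
- by move=> u; exact: joint_ge0.
- by apply: le_trans (Hz1 _ _ _ eC mr yk); rewrite ge_min lexx.
- by apply: le_trans (Hz2 _ _ _ _ eG ch hh pp yk); rewrite ge_min lexx orbT.
- apply: le_trans (ler_norm B); rewrite /B -I_Z; last exact/gdom_weight/gdom_exp.
  apply: I_le => [||u]; [exact: gdom_weight|exact/gdomZ/gdom_weight/gdom_exp|].
  have -> : P * ((1 + sqn u) * (C * expR (- (c * sqn u)))) =
    (1 + sqn u) * ((C * expR (- (c * sqn u))) * P) by ring.
  rewrite jointE; apply: ler_wpM2l; first by rewrite addr_ge0// sqn_ge0.
  apply: ler_pM; rewrite ?gauss_pdf_ge0//; exact: (gauss_pdf_le_peak lam0 _ eG).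
have kap_reg (S' : 'M[R]_(d + K)) m' u : elliptic l m S' -> sqn m' <= r ->
    sqn (reg_mean S' m' u) <= kap * (1 + sqn u) by exact: Hk.
have gF := gdom_slice_dist gJ gfit; have IF := I_slice_dist gJ gfit.
set F := slice_dist _ _ in gF IF.
have F0 : 0 <= \I F by apply: I_ge0 => u; exact: slice_dist_ge0.
have eN := elliptic_reg_cov c0 lam0 l0 eG ch hh pp eC.
have NG i j := reg_cov_dist c0 lam0 l0 kap0 kap_reg eG ch hh pp eC mr i j.
have GNe i j : `|Gamma i j - reg_cov S i j| <= k * \I F by rewrite distrC; exact: NG.
have eG' : elliptic lam (m + M) Gamma by apply: elliptic_le eG; rewrite lerDr ltW.
have eN' : elliptic lam (m + M) (reg_cov S) by apply: elliptic_le eN; rewrite lerDl ltW.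
pose q u := gauss_pdf (ulsubmx S) (u - usubmx mm).
have q0 u : 0 <= q u by exact: gauss_pdf_ge0.
have gq : gdom (fun u => (1 + sqn u) * q u) by exact/gdom_weight/gdom_gauss_pdf.
have kF0 : 0 <= k * \I F by exact: mulr_ge0.
have fitE' u y' : fit_density Gamma h p (col_mx u y') =
   q u * gauss_pdf (reg_cov S) (y' - reg_mean S mm u) by exact: (fitE l0 eC).
have pw u := H1 d _ _ _ _ _ _ _ _ _ u y eG' eN' q0 gJ gfit (@jointE _ _ _ Gamma h p)
   fitE' kF0 GNe (hh u).
have qB : \I (fun u => (1 + sqn u) * q u) <= Bq.
  apply: HBq; first exact: elliptic_ulsubmx.
  by apply: le_trans mr; rewrite -{2}(vsubmxK mm) sqn_col_mx lerDl sqn_ge0.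
apply: (@le_trans _ _ (\I (fun u => L1 * (F u + (k * \I F) * ((1 + sqn u) * q u))))).
  apply: I_le => [||u].
  - by apply/gdom_weight/gdom_norm/gdomB.
  - by apply: gdomZ; apply: gdomD => //; exact: gdomZ.
  - by rewrite distrC; exact: pw.
rewrite I_Z; last by apply: gdomD => //; exact: gdomZ.
rewrite I_D//; last exact: gdomZ.
rewrite I_Z// -[leRHS]mulrA; apply: ler_wpM2l => //.
apply: (@le_trans _ _ (\I F + k * \I F * Bq)); first by rewrite lerD2l; exact: ler_wpM2l.
have -> : \I F + k * \I F * Bq = (1 + k * Bq) * \I F by ring.
apply: ler_wpM2l; first by rewrite addr_ge0// mulr_ge0.
by rewrite IF.
Qed.

End analysis_consistency.

(** * One step of the filters *)

Section total_variation.
Context (R : realType) (n : nat).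

(** The form in which the error of the filters is carried from one step to the
    next: a total variation bound is all that the prediction needs. *)
Definition tv_close (e : R) (nu nu' : {measure set 'cV[R]_n -> \bar R}) :=
  [/\ nu setT = 1%E, nu' setT = 1%E &
   forall (f : 'cV[R]_n -> R) A, measurable_fun setT f -> (forall v, `|f v| <= A) ->
    `|\int[nu]_v f v - \int[nu']_v f v| <= A * e].

Lemma tv_close_density (f f' : 'cV[R]_n -> R) e :
  gdom f -> gdom f' -> (forall v, 0 <= f v) -> (forall v, 0 <= f' v) ->
  \I f = 1 -> \I f' = 1 -> \I (fun v => (1 + sqn v) * `|f v - f' v|) <= e ->
  tv_close e (density_measure (lebesgue_cV R n) f) (density_measure (lebesgue_cV R n) f').
Proof.
move=> gf gf' f0 f0' f1 f1' fe; split.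
- by rewrite [LHS](density_total gf f0) f1.
- by rewrite [LHS](density_total gf' f0') f1'.
move=> psi A mpsi pA.
have A0 : 0 <= A := le_trans (normr_ge0 _) (pA 0).
have pW v : `|psi v| <= A * (1 + sqn v).
  by apply: (le_trans (pA v)); rewrite ler_peMr// weight_ge1.
have g := gdomM_weight mpsi pW gf; have g' := gdomM_weight mpsi pW gf'.
rewrite (Rintegral_density gf f0 mpsi pW) (Rintegral_density gf' f0' mpsi pW).
rewrite -I_B//; apply: (le_trans (I_norm_le (gdomB g g'))).
have gW := gdom_weight (gdom_norm (gdomB gf gf')).
apply: (@le_trans _ _ (A * \I (fun v => (1 + sqn v) * `|f v - f' v|))); last first.
  exact: ler_wpM2l.
rewrite -I_Z//; apply: I_le => [||v]; [exact/gdom_norm/gdomB|exact: gdomZ|].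
by rewrite -mulrBr normrM mulrA ler_wpM2r.
Qed.

Lemma I_weight_triangle (f g k : 'cV[R]_n -> R) : gdom f -> gdom g -> gdom k ->
  \I (fun v => (1 + sqn v) * `|f v - k v|) <=
  \I (fun v => (1 + sqn v) * `|f v - g v|) + \I (fun v => (1 + sqn v) * `|g v - k v|).
Proof.
move=> gf gg gk; have G a b ga gb := gdom_weight (gdom_norm (@gdomB R n a b ga gb)).
rewrite -I_D; [|exact: G|exact: G].
apply: I_le => [||v]; [exact: G|by apply: gdomD; exact: G|].
rewrite -mulrDr; apply: ler_wpM2l; first by rewrite (le_trans ler01)// weight_ge1.
by rewrite (_ : f v - k v = (f v - g v) + (g v - k v)) ?ler_normD//; ring.
Qed.

End total_variation.

Section one_step.
Context (R : realType) (d K : nat) (lamS MS k lamG MG kh ky : R).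
Hypotheses (lamS0 : 0 < lamS) (k0 : 0 <= k).
Hypotheses (lamG0 : 0 < lamG) (MG0 : 0 < MG) (kh0 : 0 <= kh).

Section operators.
Variables (Psi : 'cV[R]_d -> 'cV[R]_d) (h : 'cV[R]_d -> 'cV[R]_K).
Variables (Sigma : 'M[R]_d) (Gamma : 'M[R]_K).
Hypotheses (eS : elliptic lamS MS Sigma) (eG : elliptic lamG MG Gamma).
Hypotheses (mPsi : measurable_fun setT Psi) (kPsi : forall v, sqn (Psi v) <= k).
Hypotheses (ch : continuous h) (hh : forall u, sqn (h u) <= kh).
Variable nu : {measure set 'cV[R]_d -> \bar R}.
Hypothesis nu1 : nu setT = 1%E.

Let p := predict Psi Sigma nu.
Let c0 : 0 < 2 * decay d lamS MS. Proof. by rewrite mulr_gt0// decay_gt0. Qed.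
Let pp := predict_density lamS0 k0 eS mPsi kPsi nu1.
Let QP := op_Q h Gamma (op_P Psi Sigma nu).
Let gJ := gdom_joint c0 lamG0 eG ch hh pp.
Let J0 v : 0 <= joint Gamma h p v. Proof. by apply: joint_ge0; case: pp. Qed.
Let J1 := I_joint1 c0 lamG0 eG ch hh pp.

Lemma op_QPE A : measurable A ->
  QP A = (\int[lebesgue_cV R (d + K)]_(v in A) (joint Gamma h p v)%:E)%E.
Proof.
move=> mA; rewrite /QP (op_PE lamS0 eS mPsi kPsi nu1).
exact: (op_QE c0 lamG0 eG ch hh pp).
Qed.

Lemma op_QP_density A : measurable A ->
  QP A = density_measure (lebesgue_cV R (d + K)) (joint Gamma h p) A.
Proof. by move=> mA; rewrite op_QPE// density_measureE. Qed.

Lemma op_BQPE y : op_B y QP = density_measure (lebesgue_cV R d)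
  (normalized (fun u => joint Gamma h p (col_mx u y))).
Proof.
rewrite /op_B (continuous_densityE (continuous_joint lamG0 eG ch pp) J0)//.
exact: op_QPE.
Qed.

Hypothesis pC : posdefmx (dcov (joint Gamma h p)).

Lemma op_GQPE A : measurable A -> op_G QP A =
  (\int[lebesgue_cV R (d + K)]_(v in A) (fit_density Gamma h p v)%:E)%E.
Proof.
move=> mA; rewrite /op_G (mean_density gJ J0 op_QP_density).
by rewrite (covariance_density gJ J0 J1 op_QP_density) normal_measureE.
Qed.

Lemma op_BGQPE y : op_B y (op_G QP) = density_measure (lebesgue_cV R d)
  (normalized (gauss_joint Gamma h p y)).
Proof.
have cfit : continuous (fit_density Gamma h p).
  have cs : continuous (fun v : 'cV[R]_(d + K) => v - dmean (joint Gamma h p)).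
    by move=> v; apply: continuousB; [exact: cvg_id|exact: cst_continuous].
  have cg := continuous_gauss_pdf pC.
  have : continuous (gauss_pdf (dcov (joint Gamma h p)) \o
      (fun v : 'cV[R]_(d + K) => v - dmean (joint Gamma h p))).
    by move=> v; apply: continuous_comp; [exact: cs|exact: cg].
  by [].
rewrite /op_B (continuous_densityE cfit)//; last exact: op_GQPE.
by move=> v; exact: gauss_pdf_ge0.
Qed.

End operators.

(** One step of the two filters: errors made earlier are propagated by the
    Gaussian filter, and the projection error at the current step is added. *)
Lemma filter_step : exists C1 C2 : R, [/\ 0 <= C1, 0 <= C2 &
  forall Psi h (Sigma : 'M[R]_d) (Gamma : 'M[R]_K)
    (nu nu' : {measure set 'cV[R]_d -> \bar R}) y e E,
  elliptic lamS MS Sigma -> elliptic lamG MG Gamma ->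
  measurable_fun setT Psi -> (forall v : 'cV[R]_d, sqn (Psi v : 'cV[R]_d) <= k) ->
  continuous h -> (forall u : 'cV[R]_d, sqn (h u : 'cV[R]_K) <= kh) ->
  sqn y <= ky -> tv_close e nu' nu ->
  (dist_g (op_Q h Gamma (op_P Psi Sigma nu))
     (op_G (op_Q h Gamma (op_P Psi Sigma nu))) <= E%:E)%E ->
  exists f f' : 'cV[R]_d -> R,
  [/\ [/\ gdom f, forall u, 0 <= f u & \I f = 1],
    [/\ gdom f', forall u, 0 <= f' u & \I f' = 1],
    op_B y (op_G (op_Q h Gamma (op_P Psi Sigma nu'))) = density_measure (lebesgue_cV R d) f,
    op_B y (op_Q h Gamma (op_P Psi Sigma nu)) = density_measure (lebesgue_cV R d) f' &
    \I (fun u => (1 + sqn u) * `|f u - f' u|) <= C1 * e + C2 * E]].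
Proof.
pose c := 2 * decay d lamS MS.
have c0 : 0 < c by rewrite mulr_gt0// decay_gt0.
pose C := peak d lamS * expR (4 * decay d lamS MS * k).
have [l [m [r [l0 m0 r0 HE]]]] := joint_elliptic d K C MG c0 lamS0 lamG0 kh0.
have [L1 L10 H1] := gauss_analysis_lip d K C MG ky c0 lamS0 lamG0 kh0.
have [L2 L20 H2] := gauss_analysis_consistency d K C ky c0 lamS0 lamG0 MG0 kh0.
have [z1 z10 Hz1] := gslice_lb d K r ky l0 m0.
have [z2 z20 Hz2] := @joint_slice_lb R d K C c lamS lamG MG kh ky c0 lamG0 MG0.
exists (L1 * predict_const d lamS MS k), L2; split=> //.
  by apply: mulr_ge0 => //; exact: predict_const_ge0.
move=> Psi h Sigma Gamma nu nu' y e E eS eG mPsi kPsi ch hh yk [nu'1 nu1 tv] dE.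
set p := predict Psi Sigma nu; set p' := predict Psi Sigma nu'.
have pp : prediction_density C c lamS p := predict_density lamS0 k0 eS mPsi kPsi nu1.
have pp' : prediction_density C c lamS p' := predict_density lamS0 k0 eS mPsi kPsi nu'1.
have [eC mr] := HE _ _ _ eG ch hh pp; have [eC' mr'] := HE _ _ _ eG ch hh pp'.
have pC := elliptic_posdef l0 eC; have pC' := elliptic_posdef l0 eC'.
have gJ := gdom_joint c0 lamG0 eG ch hh pp.
have J0 v : 0 <= joint Gamma h p v by apply: joint_ge0; case: pp.
have gfit : gdom (fit_density Gamma h p) by exact: gdom_gauss_pdf.
have dp : \I (fun u => (1 + sqn u) * `|p' u - p u|) <= predict_const d lamS MS k * e.
  exact: (predict_lip lamS0 k0 eS mPsi kPsi nu'1 nu1 tv).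
have fE : \I (fun v => (1 + sqn v) * `|joint Gamma h p v - fit_density Gamma h p v|) <= E.
  apply: (le_dist_g_density gJ gfit J0 _ _ _ dE).
  - by move=> v; exact: gauss_pdf_ge0.
  - move=> A mA. exact: (op_QP_density eS eG mPsi kPsi ch hh nu1).
  - move=> A mA; rewrite [RHS](density_measureE gfit)//; last first.
      by move=> v; exact: gauss_pdf_ge0.
    exact: (op_GQPE eS eG mPsi kPsi ch hh nu1 pC mA).
exists (normalized (gauss_joint Gamma h p' y)).
exists (normalized (fun u => joint Gamma h p (col_mx u y))).
have gg : gdom (gauss_joint Gamma h p y) by exact: gdom_gslice.
have gg' : gdom (gauss_joint Gamma h p' y) by exact: gdom_gslice.
have gj := gdom_col_mxl y gJ.
have g0 u : 0 <= gauss_joint Gamma h p' y u by exact: gslice_ge0.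
have Ig : 0 < \I (gauss_joint Gamma h p' y) := lt_le_trans z10 (Hz1 _ _ _ eC' mr' yk).
have Ij : 0 < \I (fun u => joint Gamma h p (col_mx u y)) :=
  lt_le_trans z20 (Hz2 _ _ _ _ eG ch hh pp yk).
split.
- split; [exact: gdom_normalized| |exact: I_normalized].
  by move=> u; rewrite divr_ge0// ltW.
- split; [exact: gdom_normalized| |exact: I_normalized].
  by move=> u; rewrite divr_ge0// ltW.
- exact: (op_BGQPE eS eG mPsi kPsi ch hh nu'1 pC').
- exact: (op_BQPE eS eG mPsi kPsi ch hh nu1).
apply: (le_trans (I_weight_triangle (gdom_normalized gg') (gdom_normalized gg)
  (gdom_normalized gj))).
by apply: lerD; [rewrite -mulrA; exact: H1|exact: H2].
Qed.

End one_step.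

(** * The error estimate *)

Lemma sqn_le_enorm (R : realType) n (v : 'cV[R]_n) k : enorm v <= k -> sqn v <= k ^+ 2.
Proof.
move=> vk; have e0 : 0 <= enorm v by exact: sqrtr_ge0.
by rewrite -enorm_sqr !expr2; apply: ler_pM.
Qed.

Theorem theorem9 (R : realType) (d K J : nat)
    (hd : (1 <= d)%N) (hK : (1 <= K)%N) (hJ : (1 <= J)%N)
    (kappa_y kappa_Psi kappa_h : R)
    (hkappa_y : 0 < kappa_y) (hkappa_Psi : 0 < kappa_Psi)
    (hkappa_h : 0 < kappa_h)
    (Sigma : 'M[R]_d) (Gamma : 'M[R]_K)
    (hSigma : posdefmx Sigma) (hGamma : posdefmx Gamma) :
  exists C : R,
    forall (y : nat -> 'cV[R]_K)
      (hy : forall j, (1 <= j <= J)%N -> enorm (y j) <= kappa_y)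
      (Psi : 'cV[R]_d -> 'cV[R]_d)
      (mPsi : measurable_fun [set: 'cV[R]_d] Psi)
      (hPsi : forall u, enorm (Psi u) <= kappa_Psi)
      (h : 'cV[R]_d -> 'cV[R]_K)
      (ch : continuous h)
      (hh : forall u, enorm (h u) <= kappa_h)
      (mu0 : probability 'cV[R]_d R)
      (gmu0 : is_gaussian mu0),
    let mu := true_filter Psi h Sigma Gamma y mu0 in
    let muG := gauss_filter Psi h Sigma Gamma y mu0 in
    let QP := fun nu => op_Q h Gamma (op_P Psi Sigma nu) in
    (dist_g (muG J) (mu J) <=
     C%:E * \big[maxe/-oo]_(j < J) dist_g (QP (mu j)) (op_G (QP (mu j))))%E.
Proof.
have [lamS [MS [lamS0 MS0 eS]]] := posdef_elliptic hSigma.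
have [lamG [MG [lamG0 MG0 eG]]] := posdef_elliptic hGamma.
have [C1 [C2 [C10 C20 step]]] := @filter_step R d K lamS MS (kappa_Psi ^+ 2) lamG MG
  (kappa_h ^+ 2) (kappa_y ^+ 2) lamS0 (sqr_ge0 _) lamG0 MG0 (sqr_ge0 _).
pose D := fix D j := if j is i.+1 then C1 * D i + C2 else 0 : R.
have D0 j : 0 <= D j by elim: j => //= j IH; rewrite addr_ge0// mulr_ge0.
(* Adding 1 makes the constant positive, which matters when a distance is
   infinite. *)
exists (1 + D J) => y hy Psi mPsi hPsi h ch hh mu0 gmu0.
pose mu := true_filter Psi h Sigma Gamma y mu0.
pose muG := gauss_filter Psi h Sigma Gamma y mu0.
pose QP nu := op_Q h Gamma (op_P Psi Sigma nu).
change (dist_g (muG J) (mu J) <=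
  (1 + D J)%:E * \big[maxe/-oo]_(j < J) dist_g (QP (mu j)) (op_G (QP (mu j))))%E.
pose e (j : nat) := dist_g (QP (mu j)) (op_G (QP (mu j))).
set X := (X in (_ <= _ * X)%E).
have eX (j : 'I_J) : (e j <= X)%E by exact: (le_bigmax_cond _ (fun j : 'I_J => e j)).
have X0 : (0 <= X)%E.
  exact: le_trans (dist_g_ge0 _ _) (eX (Ordinal hJ)).
have [->|Xoo] := eqVneq X +oo%E.
  by rewrite gt0_muley ?leey// lte_fin ltr_pwDl.
have Xfin : X \is a fin_num by rewrite ge0_fin_numE// ltey.
have E0 := fine_ge0 X0; have XE := fineK Xfin; set E := fine X in E0 XE.
have kPsi v : sqn (Psi v) <= kappa_Psi ^+ 2 by exact: sqn_le_enorm.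
have kh u : sqn (h u) <= kappa_h ^+ 2 by exact: sqn_le_enorm.
have ky j : (j < J)%N -> sqn (y j.+1) <= kappa_y ^+ 2.
  by move=> jJ; apply: sqn_le_enorm; apply: hy.
have eE j : (j < J)%N -> (e j <= E%:E)%E by move=> jJ; rewrite XE; exact: (eX (Ordinal jJ)).
have next j : (j < J)%N -> tv_close (D j * E) (muG j) (mu j) ->
    tv_close (D j.+1 * E) (muG j.+1) (mu j.+1) /\
    (dist_g (muG j.+1) (mu j.+1) <= (D j.+1 * E)%:E)%E.
  move=> jJ cl.
  have [f [f' [[gf f0 f1] [gf' f0' f1'] fG fT fE]]] :=
    step Psi h Sigma Gamma (mu j) (muG j) (y j.+1) _ E eS eG mPsi kPsi ch kh (ky _ jJ) cl (eE _ jJ).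
  have fD : \I (fun u => (1 + sqn u) * `|f u - f' u|) <= D j.+1 * E.
    by apply: (le_trans fE); rewrite /= mulrDl mulrA.
  have -> : muG j.+1 = density_measure (lebesgue_cV R d) f := fG.
  have -> : mu j.+1 = density_measure (lebesgue_cV R d) f' := fT.
  by split; [exact: tv_close_density|exact: dist_g_density_le].
have all_close j : (j <= J)%N -> tv_close (D j * E) (muG j) (mu j).
  elim: j => [_|j IH jJ]; last by case: (next _ jJ (IH (ltnW jJ))).
  have m1 : mu0 setT = 1%E by exact: probability_setT.
  by split => // f A mf fA; rewrite subrr normr0 !mul0r mulr0.
have JE : J.-1.+1 = J by rewrite prednK.
have J1 : (J.-1 < J)%N by rewrite JE.
have [_] := next _ J1 (all_close _ (ltnW J1)); rewrite JE => /le_trans; apply.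
by rewrite -XE -EFinM lee_fin ler_wpM2r// lerDr.
Qed.
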